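(* Let $V$ be a vertex superalgebra with a Hamiltonian operator $H$ whose eigenvalues are real, and let $g$ be a diagonalizable automorphism of $V$ commuting with $H$ with eigenvalues of modulus $1$. Suppose that $V$ is freely generated by free generators $\{e_\alpha\}_{\alpha\in I}$ homogeneous for $g$, $H$ and the parity, with an ordered index set $I$, and is pregraded by $\Gamma_{\ge0}$. Then the canonical surjection $$R_{g,H}(V)\twoheadrightarrow\operatorname{gr}\operatorname{Zhu}_{g,H}V$$ is an isomorphism of Poisson superalgebras.
   Context: **Vertex superalgebras.** Over $\mathbb C$; vacuum $|0\rangle$, translation operator $\partial$, parity $p$, $a(z)=\sum_{n\in\mathbb Z}a_{(n)}z^{-n-1}$, $[a_\lambda b]=\sum_{n\ge0}\frac{\lambda^n}{n!}a_{(n)}b$, $:\!ab\!:\,=a_{(-1)}b$ (nested from the right), $\partial^{(k)}=\partial^k/k!$. A Hamiltonian operator is a semisimple operator with $[H,a(z)]=z\partial_za(z)+(Ha)(z)$; $\Delta_a$ is the $H$-eigenvalue of $a$. **Twisted Zhu algebra.** For $a$ with $g(a)=e^{2\pi i\gamma}a$, $Ha=\Delta_aa$ let $\epsilon_a$ be the unique real number with $-1<\epsilon_a\le0$, $\epsilon_a+\Delta_a\in\gamma+\mathbb Z$, and $\gamma_a=\epsilon_a+\Delta_a$. For homogeneous $a,b$: $\chi_{a,b}=1$ if $\epsilon_a+\epsilon_b\le-1$, else $0$. Define bilinearly $a*_nb=\sum_{j\ge0}\binom{\gamma_a}{j}a_{(n+j)}b$, $a*b=a*_{-1}b$, $[a_*b]=\sum_{j\ge0}\binom{\gamma_a-1}{j}a_{(j)}b$.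 $V_{g,H}=\operatorname{Span}\{a:\epsilon_a=0\}$, $J_{g,H}=\operatorname{Span}\{a*_{-2+\chi_{a,b}}b:a,b\text{ homogeneous},\ \epsilon_a+\epsilon_b\in\mathbb Z\}$, $\operatorname{Zhu}_{g,H}V=V_{g,H}/J_{g,H}$ with product induced by $*$. **The graded algebra.** For $p\in\mathbb R$, $F^pV_{g,H}$ (resp. $F^{p_-}V_{g,H}$) is the span of $a\in V_{g,H}$ with $\Delta_a\le p$ (resp. $\Delta_a<p$), and $F^p\operatorname{Zhu}_{g,H}V$, $F^{p_-}\operatorname{Zhu}_{g,H}V$ are their images. $\operatorname{gr}\operatorname{Zhu}_{g,H}V=\bigoplus_{p\in\mathbb R}F^p\operatorname{Zhu}_{g,H}V/F^{p_-}\operatorname{Zhu}_{g,H}V$ is a Poisson superalgebra with product $\bar a\,\bar b=\overline{a*b}\in\operatorname{gr}^{p+q}$ and bracket $\{\bar a,\bar b\}=\overline{[a_*b]}\in\operatorname{gr}^{p+q-1}$ for $\bar a\in\operatorname{gr}^p,\bar b\in\operatorname{gr}^q$. **The algebra $R_{g,H}(V)$.** $C_{g,H}(V)=\operatorname{Span}\{a_{(-2+\chi_{a,b})}b: a,b\in V\text{ homogeneous}\}\cap V_{g,H}$ and $R_{g,H}(V)=V_{g,H}/C_{g,H}(V)$, a Poisson superalgebra with $\bar a\cdot\bar b=\overline{a_{(-1)}b}$, $\{\bar a,\bar b\}=\overline{a_{(0)}b}$, graded by $H$: $R_{g,H}(V)=\bigoplus_pR^p_{g,H}(V)$. The canonical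 surjection of graded Poisson superalgebras sends the class in $R^p_{g,H}(V)$ of $a\in V_{g,H}$ with $Ha=pa$ to the class of $a$ in $\operatorname{gr}^p\operatorname{Zhu}_{g,H}V$. **Free generation and pregrading.** $\Gamma\subset\mathbb R$ is a discrete additive subgroup, $\Gamma_{\ge0}=\Gamma\cap\mathbb R_{\ge0}$, $\Gamma_{>0}=\Gamma\cap\mathbb R_{>0}$; $\zeta_-$ is the largest element of $\Gamma_{\ge0}$ strictly smaller than $\zeta\in\Gamma_{>0}$. $\mathbb I=\mathbb Z_{\ge0}\times I$ ($I$ totally ordered) is ordered by $(k,\alpha)<(l,\beta)$ iff $\alpha<\beta$, or $\alpha=\beta$ and $k<l$; $e_{(k,\alpha)}=\partial^{(k)}e_\alpha$. $V$ is freely generated by $\{e_\alpha\}$ if the $:\!e_{i_1}\cdots e_{i_s}\!:$ ($s\ge0$, $i_j\le i_{j+1}$, $i_j<i_{j+1}$ if $e_{i_j}$ odd) form a basis of $V$. $V$ is pregraded by $\Gamma_{\ge0}$ if there is a grading $\alpha\mapsto\zeta_\alpha\in\Gamma_{>0}$ with $[\mathfrak v_{\zeta_1\,\lambda}\mathfrak v_{\zeta_2}]\subset\mathbb C[\lambda]\otimes V_{(\zeta_1+\zeta_2)_-}$ for all $\zeta_1,\zeta_2$, where $\mathfrak v_\zeta=\operatorname{Span}\{e_\alpha:\zeta_\alpha=\zeta\}$ and $V_\zeta=\sum_{\zeta_1+\cdots+\zeta_s\le\zeta}:\!(\partial^{k_1}\mathfrak v_{\zeta_1})\cdots(\partial^{k_s}\mathfrak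 v_{\zeta_s})\!:$ ($s=0$ gives $\mathbb C|0\rangle$). *)

(* Defs.v *)
(* The complex numbers are R[i] for an arbitrary R : realType. *)
From HB Require Import structures.
From mathcomp Require Import all_boot all_order all_algebra.
From mathcomp Require Import archimedean ring_quotient.
From mathcomp Require Import all_classical all_reals all_analysis.
From mathcomp Require Import complex.

Set Implicit Arguments.
Unset Strict Implicit.
Unset Printing Implicit Defensive.

Import Order.TTheory GRing.Theory Num.Theory.
Import numFieldNormedType.Exports.

Local Open Scope classical_set_scope.
Local Open Scope ring_scope.

Section LinearAlgebra.
Context {K : nzRingType}.

Record lsubspace (M : lmodType K) := Lsubspace {
  lsubspace_pred :> {pred M};
  lsubspace_closed : GRing.submod_closed lsubspace_pred }.

HB.instance Definition _ (M : lmodType K) (S : lsubspace M) :=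
  GRing.isSubmodClosed.Build K M (lsubspace_pred S) (lsubspace_closed S).

Definition in_lspan (M : lmodType K) (X : set M) : {pred M} :=
  fun v => `[< exists s : seq (K * M),
    (forall x, x \in s -> X x.2) /\ v = \sum_(x <- s) x.1 *: x.2 >].

Lemma lspan_closed (M : lmodType K) (X : set M) :
  GRing.submod_closed (in_lspan X).
Proof.
split; first by apply/asboolP; exists [::]; split => //; rewrite big_nil.
move=> a u v /asboolP[s [sX ->]] /asboolP[t [tX ->]].
apply/asboolP; exists ([seq (a * x.1, x.2) | x <- s] ++ t); split.
  move=> x; rewrite mem_cat => /orP[|/tX //].
  by move=> /mapP[y /sX Xy ->].
rewrite big_cat big_map /= scaler_sumr; congr (_ + _).
by apply: eq_bigr => x _; rewrite scalerA.
Qed.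

Definition lspan (M : lmodType K) (X : set M) : lsubspace M :=
  Lsubspace (lspan_closed X).

Lemma cap_closed (M : lmodType K) (A B : lsubspace M) :
  GRing.submod_closed [predI A & B].
Proof.
split; first by rewrite inE !rpred0.
move=> a u v; rewrite !inE => /andP[uA uB] /andP[vA vB].
by rewrite !rpredD ?rpredZ.
Qed.

Definition lcap (M : lmodType K) (A B : lsubspace M) : lsubspace M :=
  Lsubspace (cap_closed A B).

Definition submod (M : lmodType K) (A : lsubspace M) : Type :=
  {x : M | x \in A}.

HB.instance Definition _ (M : lmodType K) (A : lsubspace M) :=
  SubChoice.on (submod A).
HB.instance Definition _ (M : lmodType K) (A : lsubspace M) :=
  [SubChoice_isSubLmodule of submod A by <:].

Lemma sub_closed (M : lmodType K) (A B : lsubspace M) :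
  GRing.submod_closed [pred x : submod A | val x \in B].
Proof.
split; first by rewrite inE raddf0 rpred0.
by move=> a u v; rewrite !inE linearP => uB vB; rewrite rpredD ?rpredZ.
Qed.

Definition sub_subspace (M : lmodType K) (A B : lsubspace M) :
  lsubspace (submod A) := Lsubspace (sub_closed A B).

(* A / (A :&: B) *)
Definition subquot (M : lmodType K) (A B : lsubspace M) : Type :=
  Quotient.quot (sub_subspace A B).

HB.instance Definition _ (M : lmodType K) (A B : lsubspace M) :=
  GRing.Zmodule.on (subquot A B).

Section Subquotient.
Variables (M : lmodType K) (A B : lsubspace M).

Definition subquot_pi (x : submod A) : subquot A B :=
  \pi_(Quotient.quot (sub_subspace A B))%qT x.

Definition subquot_repr (x : subquot A B) : M := val (generic_quotient.repr x).

(* The class of v, for v in A; the junk value 0 for v outside A. *)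
Definition subquot_class (v : M) : subquot A B := subquot_pi (insubd 0 v).

Definition subquot_scale (a : K) (x : subquot A B) : subquot A B :=
  subquot_pi (a *: generic_quotient.repr x).

Lemma subquot_piE (x y : submod A) :
  subquot_pi x = subquot_pi y <-> val x - val y \in B.
Proof.
rewrite -[val x - val y]/(val (x - y)).
have := Quotient.idealrBE (sub_subspace A B) x y.
by rewrite unfold_in /= => ->; split => [/eqP|/eqP].
Qed.

Lemma subquot_piD : {morph subquot_pi : x y / x + y}.
Proof. by move=> x y; rewrite /subquot_pi raddfD. Qed.

Lemma subquot_reprK (x : subquot A B) :
  subquot_pi (generic_quotient.repr x) = x.
Proof. exact: reprK. Qed.

Lemma subquot_scale_pi a x : subquot_scale a (subquot_pi x) = subquot_pi (a *: x).
Proof.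
apply/subquot_piE; rewrite /= -scalerBr rpredZ //.
exact/subquot_piE/subquot_reprK.
Qed.

Lemma subquot_scaleA a b x :
  subquot_scale a (subquot_scale b x) = subquot_scale (a * b) x.
Proof.
by rewrite -(subquot_reprK x) !subquot_scale_pi scalerA.
Qed.

Lemma subquot_scale1 : left_id 1 subquot_scale.
Proof. by move=> x; rewrite -(subquot_reprK x) subquot_scale_pi scale1r. Qed.

Lemma subquot_scaleDr : right_distributive subquot_scale +%R.
Proof.
move=> a x y; rewrite -(subquot_reprK x) -(subquot_reprK y).
by rewrite -subquot_piD !subquot_scale_pi scalerDr subquot_piD.
Qed.

Lemma subquot_scaleDl x : {morph subquot_scale^~ x : a b / a + b}.
Proof.
move=> a b; rewrite -(subquot_reprK x).
by rewrite !subquot_scale_pi scalerDl subquot_piD.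
Qed.

HB.instance Definition _ := GRing.Zmodule_isLmodule.Build K (subquot A B)
  subquot_scaleA subquot_scale1 subquot_scaleDr subquot_scaleDl.

End Subquotient.

Section DirectSum.
Variables (I : choiceType) (M : I -> lmodType K).

Definition dprod : Type := forall i, M i.

HB.instance Definition _ := gen_eqMixin dprod.
HB.instance Definition _ := gen_choiceMixin dprod.

Definition dprod_addr (f g : dprod) : dprod := fun i => f i + g i.
Definition dprod_oppr (f : dprod) : dprod := fun i => - f i.
Definition dprod_scaler (a : K) (f : dprod) : dprod := fun i => a *: f i.

Fact dprod_addA : associative dprod_addr.
Proof. by move=> f g h; apply: functional_extensionality_dep => i; apply: addrA. Qed.
Fact dprod_addC : commutative dprod_addr.
Proof. by move=> f g; apply: functional_extensionality_dep => i; apply: addrC. Qed.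
Fact dprod_add0 : left_id ((fun i => 0 : M i) : dprod) dprod_addr.
Proof. by move=> f; apply: functional_extensionality_dep => i; apply: add0r. Qed.
Fact dprod_addN :
  left_inverse ((fun i => 0 : M i) : dprod) dprod_oppr dprod_addr.
Proof. by move=> f; apply: functional_extensionality_dep => i; apply: addNr. Qed.

HB.instance Definition _ :=
  GRing.isZmodule.Build dprod dprod_addA dprod_addC dprod_add0 dprod_addN.

Fact dprod_scaleA a b f :
  dprod_scaler a (dprod_scaler b f) = dprod_scaler (a * b) f.
Proof. by apply: functional_extensionality_dep => i; apply: scalerA. Qed.
Fact dprod_scale1 : left_id 1 dprod_scaler.
Proof. by move=> f; apply: functional_extensionality_dep => i; apply: scale1r. Qed.
Fact dprod_scaleDr : right_distributive dprod_scaler +%R.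
Proof. by move=> a f g; apply: functional_extensionality_dep => i; apply: scalerDr. Qed.
Fact dprod_scaleDl f : {morph dprod_scaler^~ f : a b / a + b}.
Proof. by move=> a b; apply: functional_extensionality_dep => i; apply: scalerDl. Qed.

HB.instance Definition _ := GRing.Zmodule_isLmodule.Build K dprod
  dprod_scaleA dprod_scale1 dprod_scaleDr dprod_scaleDl.

Definition dsupp (f : dprod) : set I := [set i | f i <> 0].

Lemma dsum_closed :
  GRing.submod_closed [pred f : dprod | `[< finite_set (dsupp f) >]].
Proof.
split; first by apply/asboolP; rewrite (_ : dsupp 0 = set0) // -subset0.
move=> a f g /asboolP fs /asboolP gs; apply/asboolP.
have fg : finite_set (dsupp f `|` dsupp g) by rewrite finite_setU.
apply: sub_finite_set fg => i; apply: contraPP => /= /not_orP[].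
move=> /contrapT fi /contrapT gi; apply; rewrite -[LHS]/(a *: f i + g i).
by rewrite fi gi scaler0 addr0.
Qed.

Definition dsum : Type := submod (Lsubspace dsum_closed).
HB.instance Definition _ := GRing.Lmodule.on dsum.

Lemma dsum_in_subproof i (x : M i) :
  @dfwith I (fun j => M j) (fun=> 0) i x \in Lsubspace dsum_closed.
Proof.
apply/asboolP; apply: (sub_finite_set _ (finite_set1 i)) => j /=.
by apply: contraPP => /eqP; rewrite eq_sym => /eqP ij; apply; apply: dfwith_out; apply/eqP.
Qed.

Definition dsum_in i (x : M i) : dsum :=
  exist (fun f : dprod => f \in Lsubspace dsum_closed) _ (dsum_in_subproof x).

Definition dsum_proj (x : dsum) (i : I) : M i := val x i.

End DirectSum.

End LinearAlgebra.

Section Superspaces.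
Context {K : fieldType}.

(* par true is the odd part. *)
Definition superspace (M : lmodType K) (par : bool -> set M) : Prop :=
  [/\ forall b, par b 0,
      forall b (k : K) u v, par b u -> par b v -> par b (k *: u + v),
      forall v, exists v0 v1, [/\ par false v0, par true v1 & v = v0 + v1]
    & forall v, par false v -> par true v -> v = 0].

Record poissonData := PoissonData {
  pcar :> lmodType K;
  pone : pcar;
  pmul : pcar -> pcar -> pcar;
  pbr : pcar -> pcar -> pcar;
  ppar : bool -> set pcar }.

Definition poisson_superalgebra (P : poissonData) : Prop :=
  [/\ [/\ superspace (@ppar P), ppar false (pone P),
          forall b c (x y : P), ppar b x -> ppar c y ->
            ppar (b (+) c) (pmul x y)
        & forall b c (x y : P), ppar b x -> ppar c y ->
            ppar (b (+) c) (pbr x y)],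
      [/\ forall x : P, linear (pmul x), forall y : P, linear (@pmul P ^~ y),
          forall x : P, linear (pbr x) & forall y : P, linear (@pbr P ^~ y)],
      [/\ associative (@pmul P), left_id (pone P) (@pmul P)
        & forall b c (x y : P), ppar b x -> ppar c y ->
            pmul x y = (-1) ^+ (b && c) *: pmul y x],
      forall b c (x y z : P), ppar b x -> ppar c y ->
        pbr y x = - ((-1) ^+ (b && c) *: pbr x y) /\
        pbr x (pbr y z) =
          pbr (pbr x y) z + (-1) ^+ (b && c) *: pbr y (pbr x z)
    & forall b c (x y z : P), ppar b x -> ppar c y ->
        pbr x (pmul y z) =
          pmul (pbr x y) z + (-1) ^+ (b && c) *: pmul y (pbr x z)].

Definition poisson_isomorphism (P Q : poissonData) (f : P -> Q) : Prop :=
  [/\ linear f /\ bijective f,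
      forall b x, ppar b x -> ppar b (f x),
      f (pone P) = pone Q,
      {morph f : x y / pmul x y} & {morph f : x y / pbr x y}].

Definition eigenvalue_of (M : lmodType K) (f : M -> M) (c : K) : Prop :=
  exists2 v, v != 0 & f v = c *: v.

Definition diagonalizable_op (M : lmodType K) (f : M -> M) : Prop :=
  forall v, v \in lspan [set x | exists c : K, f x = c *: x].

Definition family_basis (M : lmodType K) (S : choiceType) (P : set S)
    (m : S -> M) : Prop :=
  (forall v, v \in lspan [set m s | s in P]) /\
  forall (t : seq S) (c : S -> K), uniq t -> (forall s, s \in t -> P s) ->
    \sum_(s <- t) c s *: m s = 0 -> forall s, s \in t -> c s = 0.

Definition gbinom (x : K) (j : nat) : K :=
  (\prod_(k < j) (x - k%:R)) / j`!%:R.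

End Superspaces.

Arguments poissonData : clear implicits.

(* nprod a n b is a_(n) b.  A vertex superalgebra is given by its products with
   the field, vacuum and translation axioms and the Borcherds identity, whose
   sums are finite by nprod_field (\sum_(j \in A) is the sum of a finitely
   supported family). *)
Record vertexSuperalgebra (R : realType) := VertexSuperalgebra {
  vsa_car :> lmodType R[i];
  vac : vsa_car;
  vD : {linear vsa_car -> vsa_car};
  vpar : bool -> set vsa_car;
  nprod : vsa_car -> int -> vsa_car -> vsa_car;
  vpar_super : superspace vpar;
  vac_even : vpar false vac;
  nprod_par : forall b c n u v, vpar b u -> vpar c v ->
    vpar (b (+) c) (nprod u n v);
  nprod_linl : forall n v, linear (fun u => nprod u n v);
  nprod_linr : forall u n, linear (nprod u n);
  nprod_field : forall u v, exists N : int,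
    forall n : int, N <= n -> nprod u n v = 0;
  vac_left : forall n v, nprod vac n v = if n == -1 then v else 0;
  vac_right : forall u, nprod u (-1) vac = u /\
    forall n : nat, nprod u n%:Z vac = 0;
  vD_vac : vD vac = 0;
  nprod_trans : forall u n v,
    vD (nprod u n v) - nprod u n (vD v) = - n%:~R *: nprod u (n - 1) v;
  borcherds : forall b c u v w (m n k : int), vpar b u -> vpar c v ->
    \sum_(j \in [set: nat]) gbinom (m%:~R : R[i]) j *:
      nprod (nprod u (n + j%:Z) v) (m + k - j%:Z) w =
    \sum_(j \in [set: nat]) ((-1) ^+ j * gbinom (n%:~R : R[i]) j) *:
      (nprod u (m + n - j%:Z) (nprod v (k + j%:Z) w) -
       ((-1) ^ n * (-1) ^+ (b && c)) *:
         nprod v (n + k - j%:Z) (nprod u (m + j%:Z) w)) }.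

Section VertexSuperalgebra.
Context {R : realType} (V : vertexSuperalgebra R).
Implicit Types (a b v : V) (H g : V -> V).

Definition cexp2pi (t : R) : R[i] :=
  (cos (2 * pi * t) +i* sin (2 * pi * t))%C.

Definition hamiltonian H : Prop :=
  diagonalizable_op H /\
  forall a n b, H (nprod a n b) - nprod a n (H b) =
    (- n%:~R - 1) *: nprod a n b + nprod (H a) n b.

Definition vsa_automorphism g : Prop :=
  [/\ bijective g, g (vac V) = vac V,
      forall a n b, g (nprod a n b) = nprod (g a) n (g b)
    & forall p a, vpar p a -> vpar p (g a)].

(* :a_1 ... a_s:, nested from the right, equal to |0> for s = 0. *)
Definition nop (s : seq V) : V := foldr (fun a b => nprod a (-1) b) (vac V) s.

Section Generators.
Variables (d : Order.disp_t) (I : orderType d) (e : I -> V).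

Definition gen_elt (i : nat * I) : V :=
  (i.1`!%:R)^-1 *: iter i.1 (vD V) (e i.2).

Definition gen_lt (i j : nat * I) : bool :=
  (i.2 < j.2)%O || (i.2 == j.2) && (i.1 < j.1)%N.

Definition pbw_index : set (seq (nat * I)) :=
  [set s | sorted (fun i j =>
     ((i == j) || gen_lt i j) && (`[< vpar true (gen_elt i) >] ==> gen_lt i j))
     s].

Definition homogeneous_generators (H g : V -> V) : Prop :=
  forall i, [/\ exists c, g (e i) = c *: e i, exists c, H (e i) = c *: e i
    & exists p, vpar p (e i)].

Definition freely_generated : Prop :=
  family_basis pbw_index (fun s => nop (map gen_elt s)).

(* The coefficient of lambda^n in [a_lambda b]. *)
Definition lambda_coef a b (n : nat) : V := (n`!%:R)^-1 *: nprod a n%:Z b.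

Definition discrete_subgroup (G : set R) : Prop :=
  [/\ G 0, forall x y, G x -> G y -> G (x - y) & G `<=` isolated G].

Definition gpos (G : set R) : set R := [set x | G x /\ 0 < x].

(* zeta_-; the default 0 is never used when G is a discrete subgroup and
   z \in gpos G. *)
Definition gpred (G : set R) (z : R) : R :=
  let below := [set y | [/\ G y, 0 <= y & y < z]] in
  xget 0 [set y | below y /\ forall x, below x -> x <= y].

Definition gen_span (zeta : I -> R) (z : R) : lsubspace V :=
  lspan [set e i | i in [set i | zeta i = z]].

Definition gen_filtration (G : set R) (zeta : I -> R) (z : R) : lsubspace V :=
  lspan [set v | exists s : seq (nat * R * V),
    [/\ forall x, x \in s -> gpos G x.1.2 /\ x.2 \in gen_span zeta x.1.2,
        \sum_(x <- s) x.1.2 <= z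
      & v = nop [seq iter x.1.1 (vD V) x.2 | x <- s]]].

Definition pregraded (G : set R) : Prop :=
  exists zeta : I -> R, (forall i, gpos G (zeta i)) /\
    forall z1 z2, gpos G z1 -> gpos G z2 ->
    forall a b, a \in gen_span zeta z1 -> b \in gen_span zeta z2 ->
    forall n, lambda_coef a b n \in gen_filtration G zeta (gpred G (z1 + z2)).

End Generators.

Section Twisted.
Variables H g : V -> V.

(* a is homogeneous with Delta_a = i.1 and epsilon_a = i.2, so that
   gamma_a = i.1 + i.2. *)
Definition ghom (i : R * R) : set V :=
  [set a | [/\ H a = i.1%:C%C *: a, -1 < i.2 <= 0
    & exists t : R, g a = cexp2pi t *: a /\ i.2 + i.1 - t \is a Num.int]].

Definition chi (e1 e2 : R) : int := (e1 + e2 <= -1 :> R)%:Z.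

(* The component of a in ghom i along the sum of the other ghom j; it is used
   to extend bilinearly formulas given for homogeneous a. *)
Definition ghom_comp (i : R * R) (a : V) : V :=
  xget 0 [set a' | ghom i a' /\
    a - a' \in lspan (\bigcup_(j in [set j | j <> i]) ghom j)].

(* a *_n b in the usual notation *)
Definition star (n : int) (a b : V) : V :=
  \sum_(i \in [set: R * R]) \sum_(j \in [set: nat])
    (gbinom (i.1 + i.2) j)%:C%C *: nprod (ghom_comp i a) (n + j%:Z) b.

(* [a_* b] in the usual notation *)
Definition star_br (a b : V) : V :=
  \sum_(i \in [set: R * R]) \sum_(j \in [set: nat])
    (gbinom (i.1 + i.2 - 1) j)%:C%C *: nprod (ghom_comp i a) j%:Z b.

Definition V_gH : lsubspace V := lspan [set a | exists D, ghom (D, 0) a].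

Definition J_gH : lsubspace V :=
  lspan [set v | exists i a j b, [/\ ghom i a, ghom j b,
    i.2 + j.2 \is a Num.int & v = star (-2 + chi i.2 j.2) a b]].

Definition Zhu_gH : lmodType R[i] := subquot V_gH J_gH.

Definition zhu_class (a : V) : Zhu_gH := subquot_class V_gH J_gH a.

Definition FV (p : R) : lsubspace V :=
  lspan [set a | a \in V_gH /\ exists D : R, D <= p /\ H a = D%:C%C *: a].
Definition FVlt (p : R) : lsubspace V :=
  lspan [set a | a \in V_gH /\ exists D : R, D < p /\ H a = D%:C%C *: a].

(* These images are already subspaces; lspan only bundles them as such. *)
Definition FZhu (p : R) : lsubspace Zhu_gH :=
  lspan [set zhu_class a | a in [set a | a \in FV p]].
Definition FZhult (p : R) : lsubspace Zhu_gH :=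
  lspan [set zhu_class a | a in [set a | a \in FVlt p]].

Definition gr_piece (p : R) : lmodType R[i] := subquot (FZhu p) (FZhult p).

Definition gr_class (p : R) (a : V) : gr_piece p :=
  subquot_class (FZhu p) (FZhult p) (zhu_class a).

Definition gr_repr (p : R) (x : gr_piece p) : V :=
  xget 0 [set a | a \in FV p /\ gr_class p a = x].

Definition grZhu : lmodType R[i] := dsum gr_piece.

Definition gr_in (p : R) (x : gr_piece p) : grZhu := dsum_in x.

Definition gr_supp (x : grZhu) : set R := [set p | dsum_proj x p <> 0].

Definition gr_mul (x y : grZhu) : grZhu :=
  \sum_(p \in gr_supp x) \sum_(q \in gr_supp y)
    gr_in (gr_class (p + q)
      (star (-1) (gr_repr (dsum_proj x p)) (gr_repr (dsum_proj y q)))).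

Definition gr_bracket (x y : grZhu) : grZhu :=
  \sum_(p \in gr_supp x) \sum_(q \in gr_supp y)
    gr_in (gr_class (p + q - 1)
      (star_br (gr_repr (dsum_proj x p)) (gr_repr (dsum_proj y q)))).

Definition gr_par (b : bool) : set grZhu :=
  [set x | forall p, exists a,
    [/\ a \in FV p, vpar b a & dsum_proj x p = gr_class p a]].

Definition grZhu_poisson : poissonData R[i] :=
  PoissonData (gr_in (gr_class 0 (vac V))) gr_mul gr_bracket gr_par.

(* gr_mul and gr_bracket are defined through chosen representatives; this says
   that the choice is immaterial. *)
Definition grZhu_well_defined : Prop :=
  forall p q a b, a \in FV p -> b \in FV q ->
    gr_mul (gr_in (gr_class p a)) (gr_in (gr_class q b)) =
      gr_in (gr_class (p + q) (star (-1) a b)) /\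
    gr_bracket (gr_in (gr_class p a)) (gr_in (gr_class q b)) =
      gr_in (gr_class (p + q - 1) (star_br a b)).

Definition C_gH : lsubspace V :=
  lcap (lspan [set v | exists i a j b, [/\ ghom i a, ghom j b
    & v = nprod a (-2 + chi i.2 j.2) b]]) V_gH.

Definition R_gH : lmodType R[i] := subquot V_gH C_gH.

Definition R_class (a : V) : R_gH := subquot_class V_gH C_gH a.

Definition R_mul (x y : R_gH) : R_gH :=
  R_class (nprod (subquot_repr x) (-1) (subquot_repr y)).

Definition R_bracket (x y : R_gH) : R_gH :=
  R_class (nprod (subquot_repr x) 0 (subquot_repr y)).

Definition R_par (b : bool) : set R_gH :=
  [set R_class a | a in [set a | a \in V_gH /\ vpar b a]].

Definition R_poisson : poissonData R[i] :=
  PoissonData (R_class (vac V)) R_mul R_bracket R_par.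

Definition R_well_defined : Prop :=
  forall a b, a \in V_gH -> b \in V_gH ->
    R_mul (R_class a) (R_class b) = R_class (nprod a (-1) b) /\
    R_bracket (R_class a) (R_class b) = R_class (nprod a 0 b).

(* These conditions determine a linear f: the classes of the H-eigenvectors of
   V_gH span R_gH. *)
Definition canonical_map (f : R_poisson -> grZhu_poisson) : Prop :=
  forall (p : R) a, a \in V_gH -> H a = p%:C%C *: a ->
    f (R_class a) = gr_in (gr_class p a).

End Twisted.

End VertexSuperalgebra.

(* Main.v *)
Require Import Defs.
From HB Require Import structures.
From mathcomp Require Import all_boot all_order all_algebra.
From mathcomp Require Import all_classical all_reals all_analysis.
From mathcomp Require Import complex.
From mathcomp Require Import ring lra zify.

(** R_{g,H}(V) is a Poisson superalgebra for general reasons: every correction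
term of the Borcherds identity that spoils commutativity or associativity of
the (-1)-product is a product of two vectors of V_{g,H} of index at most -2,
hence lies in C_{g,H}(V) (C_deep, C_skew, C_assoc), and C_{g,H}(V) is stable
under the (-1)- and 0-products with V_{g,H} (C_left, C_right).

Everything about gr Zhu then follows from one statement, leading_J_C: if an
element of J_{g,H}(V) has all its conformal weights at most p, its component of
weight p lies in C_{g,H}(V).  Since conversely every element of C_{g,H}(V) of
weight p is the leading term of an element of J_{g,H}(V) (C_lift), sending a
vector to its component of weight p identifies gr^p Zhu with the weight p part
of R_{g,H}(V) (gr_eq0).  A star product has the ordinary product as its leading
term (star_op_top), so this identification respects products and brackets
(gr_op_symbol), and the Poisson axioms for gr Zhu are those of R_{g,H}(V)
(poisson_transport).

The proof of leading_J_C treats J and C as the cases h = 1 and h = 0 of one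
construction.  For a vector a with gamma_a = g, the coefficients of
(1 + h z)^g Y(a, z) are the ordinary modes of a if h = 0 and the operators
a *_n if h = 1; in both cases the Borcherds identity gives commutator and
associativity formulas (smode_comm, smode_assoc).  Nesting these operators for
the free generators yields deformed monomials hmono h s.  Call the generator
d^(k) e_alpha killed if k > 0 or epsilon_alpha <> 0: in the quotients by C and
J only the other generators survive.  Two facts hold for every h.

First, a mode of index at most kill_bound of a monomial, applied to a deformed
monomial, is a combination of deformed monomials with a killed factor; in
particular J consists of such combinations (J_in_hfilt).  This is proved by
induction on the pregrading (mode_bound_all), together with the facts that
modes respect the pregrading and that modes of nonnegative index lower it.  The
induction needs the pregrading because conformal weights need neither be bounded
below nor be well ordered.

Second, exchanging two factors of a deformed monomial changes it, up to sign,
by terms of strictly lower pregrading that still have a killed factor if the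
monomial had one (hmono_swap); hence the monomials may be taken ordered as in
the basis of V (hfilt_sorted).

For an ordered s, hmono 1 s is the basis vector hmono 0 s plus terms of lower
weight.  Basis vectors cannot cancel, so the leading term of a combination of
ordered hmono 1 s with killed factors is a combination of ordinary basis
monomials with killed factors, and these lie in C_{g,H}(V)
(killed_mono_C). *)

Set Implicit Arguments.
Unset Strict Implicit.
Unset Printing Implicit Defensive.

Import Order.TTheory GRing.Theory Num.Theory.
Local Open Scope classical_set_scope.
Local Open Scope ring_scope.

(** * Linear algebra in a basis *)

Section Span.
Context {K : nzRingType} {M : lmodType K}.
Implicit Types (X Y : set M) (S : lsubspace M).

Lemma mem_lspan X x : X x -> x \in lspan X.
Proof.
move=> Xx; apply/asboolP; exists [:: (1, x)]; split.
  by move=> y; rewrite inE => /eqP ->.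
by rewrite big_seq1 scale1r.
Qed.

Lemma lspan_ind X (P : M -> Prop) :
  P 0 -> (forall (k : K) u v, P u -> P v -> P (k *: u + v)) ->
  (forall x, X x -> P x) -> forall v, v \in lspan X -> P v.
Proof.
move=> P0 PL PX v /asboolP[s [sX ->]].
elim: s sX => [|[k x] s IH] sX; first by rewrite big_nil.
rewrite big_cons /=; apply: PL; first by apply: PX (sX (k, x) _); rewrite mem_head.
by apply: IH => y ys; apply: sX; rewrite inE ys orbT.
Qed.

Lemma lspan_sub X S : (forall x, X x -> x \in S) -> forall v, v \in lspan X -> v \in S.
Proof.
apply: lspan_ind; first exact: rpred0.
by move=> k u v uS vS; rewrite rpredD ?rpredZ.
Qed.

Lemma lspan_mono X Y : X `<=` Y -> forall v, v \in lspan X -> v \in lspan Y.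
Proof. by move=> XY; apply: lspan_sub => x /XY; exact: mem_lspan. Qed.

End Span.

Lemma linear_fun0 (K : nzRingType) (M N : lmodType K) (f : M -> N) : linear f -> f 0 = 0.
Proof. by move=> fl; have := fl (-1) 0 0; rewrite scaler0 addr0 scaleN1r addNr. Qed.

Section Coordinates.
Context {K : fieldType} {M : lmodType K} {S : choiceType}.
Variables (P : set S) (m : S -> M).
Hypothesis basis : family_basis P m.

Let sum_widen (d : S -> K) (r r' : seq S) : uniq r -> uniq r' ->
  {subset r <= r'} -> (forall s, s \notin r -> d s = 0) ->
  \sum_(s <- r) d s *: m s = \sum_(s <- r') d s *: m s.
Proof.
move=> ur ur' rr' dr; rewrite [RHS](bigID (mem r)) /=.
rewrite [X in _ + X]big1 ?addr0; last by move=> s /dr ->; rewrite scale0r.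
rewrite -[RHS]big_filter; apply: perm_big; apply: uniq_perm => //.
  exact: filter_uniq.
by move=> s; rewrite mem_filter /=; case: (boolP (s \in r)) => //= /rr' ->.
Qed.

Let sub_undupl (r r' : seq S) : {subset r <= undup (r ++ r')}.
Proof. by move=> s sr; rewrite mem_undup mem_cat sr. Qed.

Let sub_undupr (r r' : seq S) : {subset r' <= undup (r ++ r')}.
Proof. by move=> s sr; rewrite mem_undup mem_cat sr orbT. Qed.

Let expansion (v : M) : exists (c : S -> K) (t : seq S),
  [/\ uniq t, forall s, s \in t -> P s, forall s, s \notin t -> c s = 0
    & v = \sum_(s <- t) c s *: m s].
Proof.
move: v (basis.1 v); apply: lspan_ind.
- by exists (fun=> 0), [::]; split; rewrite ?big_nil.
- move=> k u v [c [t [ut tP ct ->]]] [c' [t' [ut' tP' ct' ->]]].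
  exists (fun s => k * c s + c' s), (undup (t ++ t')); split.
  + exact: undup_uniq.
  + by move=> s; rewrite mem_undup mem_cat => /orP[/tP|/tP'].
  + move=> s; rewrite mem_undup mem_cat negb_or => /andP[/ct -> /ct' ->].
    by rewrite mulr0 addr0.
  + rewrite (@sum_widen c t (undup (t ++ t'))) ?undup_uniq//.
    rewrite (@sum_widen c' t' (undup (t ++ t'))) ?undup_uniq//.
    rewrite scaler_sumr -big_split; apply: eq_bigr => s _.
    by rewrite scalerA scalerDl.
- move=> _ [s Ps <-]; exists (fun s' => (s' == s)%:R), [:: s]; split => //.
  + by move=> s'; rewrite inE => /eqP ->.
  + by move=> s'; rewrite inE => /negPf ->.
  + by rewrite big_seq1 eqxx scale1r.
Qed.

Definition basis_coord (v : M) : S -> K := sval (cid (expansion v)).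
(** Some finite list outside which the coordinates vanish; it may contain
    indices whose coordinate is 0. *)
Definition csupp (v : M) : seq S := sval (cid (svalP (cid (expansion v)))).

Lemma csupp_spec v : [/\ uniq (csupp v), forall s, s \in csupp v -> P s,
  forall s, s \notin csupp v -> basis_coord v s = 0
  & v = \sum_(s <- csupp v) basis_coord v s *: m s].
Proof. exact: (svalP (cid (svalP (cid (expansion v))))). Qed.

Lemma bcoord_uniq (v : M) (c : S -> K) (t : seq S) : uniq t ->
  (forall s, s \in t -> P s) -> (forall s, s \notin t -> c s = 0) ->
  v = \sum_(s <- t) c s *: m s -> forall s, basis_coord v s = c s.
Proof.
move=> ut tP ct ev s; have [uv vP cv ev'] := csupp_spec v.
have [st|] := boolP (s \in undup (t ++ csupp v)); last first.
  by rewrite mem_undup mem_cat => /norP[/ct -> /cv ->].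
have := basis.2 (undup (t ++ csupp v)) (fun s => basis_coord v s - c s).
move=> d0; apply/eqP; rewrite -subr_eq0; apply/eqP; apply: d0 => //.
- exact: undup_uniq.
- by move=> s'; rewrite mem_undup mem_cat => /orP[/tP|/vP].
- under eq_bigr do rewrite scalerBl; rewrite sumrB.
  rewrite -(@sum_widen _ (csupp v)) ?undup_uniq// -ev'.
  by rewrite -(@sum_widen _ t) ?undup_uniq// -ev subrr.
Qed.

Lemma bcoord_lin k u v s : basis_coord (k *: u + v) s = k * basis_coord u s + basis_coord v s.
Proof.
have [uu uP cu eu] := csupp_spec u; have [uv vP cv ev] := csupp_spec v.
rewrite (@bcoord_uniq _ (fun s => k * basis_coord u s + basis_coord v s)
  (undup (csupp u ++ csupp v))) ?undup_uniq//.
- by move=> s'; rewrite mem_undup mem_cat => /orP[/uP|/vP].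
- move=> s'; rewrite mem_undup mem_cat => /norP[/cu -> /cv ->].
  by rewrite mulr0 addr0.
- rewrite {1}eu {1}ev (@sum_widen _ _ (undup (csupp u ++ csupp v))) ?undup_uniq//.
  rewrite [X in _ + X](@sum_widen _ _ (undup (csupp u ++ csupp v))) ?undup_uniq//.
  rewrite scaler_sumr -big_split; apply: eq_bigr => s' _.
  by rewrite scalerDl scalerA.
Qed.

Lemma bcoord0 s : basis_coord 0 s = 0.
Proof. by have := bcoord_lin (-1) 0 0 s; rewrite scaler0 addr0 mulN1r addNr. Qed.

Lemma bcoordD u v s : basis_coord (u + v) s = basis_coord u s + basis_coord v s.
Proof. by rewrite -[u]scale1r bcoord_lin mul1r scale1r. Qed.

Lemma bcoordZ k u s : basis_coord (k *: u) s = k * basis_coord u s.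
Proof. by rewrite -[k *: u]addr0 bcoord_lin bcoord0 addr0. Qed.

Lemma bcoordN u s : basis_coord (- u) s = - basis_coord u s.
Proof. by rewrite -scaleN1r bcoordZ mulN1r. Qed.

Lemma bcoordB u v s : basis_coord (u - v) s = basis_coord u s - basis_coord v s.
Proof. by rewrite bcoordD bcoordN. Qed.

Lemma bcoord_sum (J : Type) (r : seq J) (Q : pred J) (F : J -> M) s :
  basis_coord (\sum_(j <- r | Q j) F j) s = \sum_(j <- r | Q j) basis_coord (F j) s.
Proof.
apply: (big_morph (fun v => basis_coord v s)); last exact: bcoord0.
by move=> u v; rewrite bcoordD.
Qed.

Lemma bcoord_basis s t : P s -> basis_coord (m s) t = (t == s)%:R.
Proof.
move=> Ps; rewrite (@bcoord_uniq _ (fun t => (t == s)%:R) [:: s]) //.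
- by move=> s'; rewrite inE => /eqP ->.
- by move=> s'; rewrite inE => /negPf ->.
- by rewrite big_seq1 eqxx scale1r.
Qed.

Lemma bcoord_inj u v : (forall s, basis_coord u s = basis_coord v s) -> u = v.
Proof.
move=> uv; apply/eqP; rewrite -subr_eq0; apply/eqP.
have [_ _ _ ->] := csupp_spec (u - v).
by apply: big1 => s _; rewrite bcoordB uv subrr scale0r.
Qed.

Definition restr (Q : pred S) (v : M) : M := \sum_(s <- csupp v | Q s) basis_coord v s *: m s.

Lemma bcoord_restr Q v s : basis_coord (restr Q v) s = if Q s then basis_coord v s else 0.
Proof.
have [uv vP cv _] := csupp_spec v.
rewrite (@bcoord_uniq _ (fun s => if Q s then basis_coord v s else 0)
  [seq s <- csupp v | Q s]) //.
- exact: filter_uniq.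
- by move=> s'; rewrite mem_filter => /andP[_ /vP].
- by move=> s'; rewrite mem_filter; case: (Q s') => //= /cv.
- by rewrite big_filter; apply: eq_bigr => s' ->.
Qed.

Lemma restr_lin Q k u v : restr Q (k *: u + v) = k *: restr Q u + restr Q v.
Proof.
apply: bcoord_inj => s; rewrite bcoord_restr !bcoord_lin !bcoord_restr.
by case: (Q s); rewrite ?bcoord_lin // mulr0 addr0.
Qed.

Lemma restr_id (Q : pred S) v : (forall s, basis_coord v s != 0 -> Q s) -> restr Q v = v.
Proof.
move=> vQ; apply: bcoord_inj => s; rewrite bcoord_restr.
by case: ifPn => // Qs; apply/esym/eqP; apply: contraR Qs; exact: vQ.
Qed.

Lemma restr_eq0 (Q : pred S) v : (forall s, basis_coord v s != 0 -> ~~ Q s) -> restr Q v = 0.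
Proof.
move=> vQ; apply: bcoord_inj => s; rewrite bcoord_restr bcoord0.
case: ifPn => // Qs; apply/eqP; apply: contraLR Qs; exact: vQ.
Qed.

(** By this an eigenvector only involves basis vectors with the same eigenvalue. *)
Lemma bcoord_diag (f : {linear M -> M}) (l : S -> K) :
  (forall s, P s -> f (m s) = l s *: m s) ->
  forall v s, basis_coord (f v) s = l s * basis_coord v s.
Proof.
move=> fl v s; have [uv vP cv {1}->] := csupp_spec v.
have term t : t \in csupp v ->
    basis_coord (f (basis_coord v t *: m t)) s = basis_coord v t * (l t * (s == t)%:R).
  by move=> /vP Pt; rewrite linearZ /= fl// !bcoordZ bcoord_basis.
rewrite linear_sum bcoord_sum (eq_big_seq _ term).
have [sv|sv] := boolP (s \in csupp v).
  rewrite (bigD1_seq s) //= eqxx mulr1 mulrC big1 ?addr0// => t ts.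
  by rewrite eq_sym (negPf ts) !mulr0.
rewrite (cv _ sv) mulr0 big_seq big1// => t tv.
rewrite (_ : (s == t) = false) ?mulr0//.
by apply: contraNF sv => /eqP ->.
Qed.

Definition lin_ext (M' : lmodType K) (f : S -> M') v : M' :=
  \sum_(s <- csupp v) basis_coord v s *: f s.

Lemma lin_extE (M' : lmodType K) (f : S -> M') v (t : seq S) : uniq t ->
  {subset csupp v <= t} -> lin_ext f v = \sum_(s <- t) basis_coord v s *: f s.
Proof.
move=> ut vt; have [uv vP cv _] := csupp_spec v.
rewrite [RHS](bigID (mem (csupp v))) /= [X in _ + X]big1 ?addr0; last first.
  by move=> s /cv ->; rewrite scale0r.
rewrite -[RHS]big_filter; apply: perm_big; apply: uniq_perm => //.
  exact: filter_uniq.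
by move=> s; rewrite mem_filter /=; case: (boolP (s \in csupp v)) => //= /vt ->.
Qed.

Lemma lin_ext_lin (M' : lmodType K) (f : S -> M') : linear (lin_ext f).
Proof.
move=> k u v; set t := undup (csupp (k *: u + v) ++ csupp u ++ csupp v).
have ut : uniq t by exact: undup_uniq.
rewrite !(@lin_extE _ _ _ t)//.
- rewrite scaler_sumr -big_split; apply: eq_bigr => s _.
  by rewrite bcoord_lin scalerDl scalerA.
- by move=> s sv; rewrite mem_undup !mem_cat sv !orbT.
- by move=> s su; rewrite mem_undup !mem_cat su orbT.
- by move=> s su; rewrite mem_undup !mem_cat su.
Qed.

Lemma lin_ext_id (M' : lmodType K) (f : M -> M') : linear f ->
  forall v, lin_ext (fun s => f (m s)) v = f v.
Proof.
move=> fl v; have [_ _ _ ev] := csupp_spec v; pose F := GRing.isLinear.Build _ _ _ _ f fl.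
pose f' : {linear M -> M'} := HB.pack f F.
rewrite [in RHS]ev -[f _]/(f' _) linear_sum; apply: eq_bigr => s _.
by rewrite linearZ.
Qed.

Lemma eq_lin_ext (M' : lmodType K) (f f' : S -> M') v :
  (forall s, basis_coord v s != 0 -> f s = f' s) -> lin_ext f v = lin_ext f' v.
Proof.
move=> ff; apply: eq_bigr => s _; have [->|/ff ->//] := eqVneq (basis_coord v s) 0.
by rewrite !scale0r.
Qed.

Lemma coord_space_closed (Q : pred S) :
  GRing.submod_closed [pred v : M | `[< forall s, basis_coord v s != 0 -> Q s >]].
Proof.
split; first by apply/asboolP => s; rewrite bcoord0 eqxx.
move=> k u v /asboolP hu /asboolP hv; apply/asboolP => s; rewrite bcoord_lin => c0.
have [cu|/hu//] := eqVneq (basis_coord u s) 0.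
by apply: hv; apply: contra c0 => /eqP ->; rewrite cu mulr0 addr0.
Qed.

Definition coord_space (Q : pred S) : lsubspace M := Lsubspace (coord_space_closed Q).

Lemma coord_spaceP (Q : pred S) v :
  v \in coord_space Q <-> forall s, basis_coord v s != 0 -> Q s.
Proof. by split=> [/asboolP|H]; last exact/asboolP. Qed.

Lemma lspan_coord v : v \in lspan [set m s | s in [set s | P s /\ basis_coord v s != 0]].
Proof.
have [uv vP cv {1}->] := csupp_spec v.
rewrite big_seq; apply: rpred_sum => s sv.
have [->|c0] := eqVneq (basis_coord v s) 0; first by rewrite scale0r rpred0.
by apply/rpredZ/mem_lspan; exists s => //; split=> //; apply: vP.
Qed.

End Coordinates.

(** * Generalised binomial coefficients *)

Section Binomial.
Context {K : numFieldType}.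
Implicit Types x y : K.

Lemma gbinom0 x : gbinom x 0 = 1.
Proof. by rewrite /gbinom big_ord0 mul1r fact0 invr1. Qed.

Lemma gbinomS x j : j.+1%:R * gbinom x j.+1 = (x - j%:R) * gbinom x j.
Proof.
rewrite /gbinom big_ord_recr factS natrM /=.
have j0 : (j.+1)%:R != 0 :> K by rewrite pnatr_eq0.
have f0 : (j`!)%:R != 0 :> K by rewrite pnatr_eq0 -lt0n fact_gt0.
by field; rewrite f0 /= addrC natr1.
Qed.

Lemma gbinomS' x j : gbinom x j.+1 = (x - j%:R) * gbinom x j / j.+1%:R.
Proof. by rewrite -gbinomS mulrC mulKf // pnatr_eq0. Qed.

Lemma gbinom0S j : gbinom (0 : K) j.+1 = 0.
Proof.
by rewrite /gbinom big_ord_recl /= subrr !mul0r.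
Qed.

Lemma gbinom_small (n j : nat) : (n < j)%N -> gbinom (n%:R : K) j = 0.
Proof.
move=> nj; rewrite /gbinom (bigD1 (Ordinal nj)) //= subrr !mul0r //.
Qed.

(** Vandermonde's identity, from the recursion (j + 1) b(x, j + 1) =
    (x - j) b(x, j): both sides satisfy the same recursion in j. *)
Lemma gbinom_add x y j :
  gbinom (x + y) j = \sum_(i < j.+1) gbinom x i * gbinom y (j - i).
Proof.
elim: j => [|j IH]; first by rewrite big_ord_recl big_ord0 !gbinom0 mulr1 addr0.
apply: (@mulfI K (j.+1%:R)); first by rewrite pnatr_eq0.
rewrite gbinomS IH.
have -> : j.+1%:R * (\sum_(i < j.+2) gbinom x i * gbinom y (j.+1 - i)) =
  \sum_(i < j.+2) (i%:R * gbinom x i) * gbinom y (j.+1 - i) +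
  \sum_(i < j.+2) gbinom x i * ((j.+1 - i)%:R * gbinom y (j.+1 - i)).
  rewrite mulr_sumr -big_split; apply: eq_bigr => i _ /=.
  rewrite natrB -1?ltnS //; ring.
rewrite [X in _ = X + _]big_ord_recl /= !mul0r add0r.
rewrite [X in _ = _ + X]big_ord_recr /= subnn mul0r mulr0 addr0.
rewrite -big_split mulr_sumr; apply: eq_bigr => i _ /=.
have ij : (i <= j)%N by rewrite -ltnS.
rewrite /bump leq0n add1n gbinomS subSS subSn // gbinomS natrB //; ring.
Qed.

Lemma gbinom_mul x i j : (j <= i)%N ->
  gbinom x i * gbinom (i%:R) j = gbinom x j * gbinom (x - j%:R) (i - j).
Proof.
move=> ji; have f0 n : (n`!)%:R != 0 :> K by rewrite pnatr_eq0 -lt0n fact_gt0.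
have fall (n : nat) y : gbinom y n * n`!%:R = \prod_(k < n) (y - k%:R).
  by rewrite /gbinom divfK.
have natf (n m : nat) : (m <= n)%N -> gbinom (n%:R : K) m * (m`!%:R * (n - m)`!%:R) = n`!%:R.
  move=> mn; rewrite mulrA fall; move: (n - m)%N (subnK mn) => k <-.
  elim: m {n mn} => [|m IHm]; first by rewrite big_ord0 mul1r addn0.
  rewrite addnS factS natrM -IHm mulrA big_ord_recl subr0; congr (_ * _ * _).
  by apply: eq_bigr => l _; rewrite /= /bump leq0n add1n -!natr1; ring.
apply: (mulIf (f0 i)); apply: (mulIf (f0 j)); apply: (mulIf (f0 (i - j)%N)).
transitivity ((gbinom x i * i`!%:R) * (gbinom (i%:R) j * (j`!%:R * (i - j)`!%:R))); first by ring.
transitivity ((gbinom x j * j`!%:R) * (gbinom (x - j%:R) (i - j) * (i - j)`!%:R) * i`!%:R);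
  last by ring.
rewrite natf // !fall; congr (_ * _).
have -> : \prod_(k < i) (x - k%:R) = \prod_(k < j + (i - j)) (x - k%:R).
  by rewrite subnKC.
rewrite big_split_ord /=; congr (_ * _).
by apply: eq_bigr => k _; rewrite natrD opprD addrA.
Qed.

Lemma gbinom_pascal x j : gbinom (x + 1) j.+1 = gbinom x j.+1 + gbinom x j.
Proof.
rewrite gbinom_add big_ord_recr big_ord_recr /= big1 ?add0r.
  rewrite subnn subSnn gbinom0 mulr1 addrC; congr (_ + _).
  by rewrite gbinomS' gbinom0 subr0 mulr1 divff ?mulr1 // oner_eq0.
move=> i _; rewrite (@gbinom_small 1) ?mulr0 //.
by have := ltn_ord i; lia.
Qed.

End Binomial.

Lemma gbinom_rmorph (K L : fieldType) (f : {rmorphism K -> L}) (x : K) j :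
  f (gbinom x j) = gbinom (f x) j.
Proof.
rewrite /gbinom fmorph_div rmorph_prod rmorph_nat; congr (_ / _).
by apply: eq_bigr => k _; rewrite rmorphB rmorph_nat.
Qed.

(** * Finitely supported sums *)

Section FinSums.
Context {K : nzRingType} {M : lmodType K}.
Implicit Types F : nat -> M.

(** Bounds on the support of the families below depend on the vectors on which
    the fields act, so the sums are kept infinite and truncated in proofs. *)
Definition tsum F : M := \sum_(j \in [set: nat]) F j.

Lemma tsumE N F : (forall j, (N <= j)%N -> F j = 0) -> tsum F = \sum_(j < N) F j.
Proof.
move=> FN; rewrite fsbig_ord; symmetry; apply: fsbig_widen => //.
by move=> j [_ /negP]; rewrite -leqNgt => /FN.
Qed.

Lemma tsum_in (S : lsubspace M) F : (forall j, F j \in S) -> tsum F \in S.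
Proof. by move=> FS; apply: rpred_sum => j _; exact: FS. Qed.

Lemma eq_tsum F G : F =1 G -> tsum F = tsum G.
Proof. by move=> /funext ->. Qed.

Lemma tsum_box2 N (F : nat -> nat -> M) :
  (forall i j, (N <= i)%N || (N <= j)%N -> F i j = 0) ->
  tsum (fun i => tsum (F i)) = \sum_(i < N) \sum_(j < N) F i j.
Proof.
move=> FN; rewrite (@tsumE N); last first.
  move=> i Ni; rewrite (@tsumE 0) ?big_ord0// => j _.
  by rewrite FN ?Ni.
apply: eq_bigr => i _; apply: tsumE => j Nj.
by rewrite FN ?Nj ?orbT.
Qed.

Lemma tsum_exchange N (F : nat -> nat -> M) :
  (forall i j, (N <= i)%N || (N <= j)%N -> F i j = 0) ->
  tsum (fun i => tsum (F i)) = tsum (fun j => tsum (F^~ j)).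
Proof.
move=> FN; rewrite (tsum_box2 FN) exchange_big (@tsum_box2 N)//.
by move=> i j; rewrite orbC => /FN.
Qed.

Lemma tsum_shift N i F : (forall j, (N <= j)%N -> F j = 0) ->
  tsum (fun j => F (i + j)%N) = tsum (fun j => if (i <= j)%N then F j else 0).
Proof.
move=> FN; rewrite (@tsumE N); last by move=> j Nj; apply: FN; lia.
rewrite (@tsumE (i + N)); last first.
  by move=> j Nj; case: ifP => // _; apply: FN; lia.
rewrite big_split_ord /= [X in _ = X + _]big1 ?add0r; last first.
  by move=> j _ /=; rewrite leqNgt ltn_ord.
by apply: eq_bigr => j _; rewrite leq_addr.
Qed.

(** The product of two power series, tested on a finitely supported family. *)
Lemma tsum_conv N (p q : nat -> K) F : (forall j, (N <= j)%N -> F j = 0) ->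
  tsum (fun i => tsum (fun l => (p i * q l) *: F (i + l)%N)) =
  tsum (fun s => (\sum_(i < s.+1) p i * q (s - i)%N) *: F s).
Proof.
move=> FN.
have -> : tsum (fun i => tsum (fun l => (p i * q l) *: F (i + l)%N)) =
    tsum (fun i => tsum (fun s =>
      if (i <= s)%N then (p i * q (s - i)%N) *: F s else 0)).
  apply: eq_tsum => i; rewrite -(@tsum_shift N i (fun s => (p i * q (s - i)%N) *: F s)).
    by apply: eq_tsum => l; rewrite addKn.
  by move=> j /FN ->; rewrite scaler0.
rewrite (@tsum_exchange N); last first.
  move=> i j /orP[Ni|/FN ->]; last by rewrite scaler0 if_same.
  by case: ifP => // ij; rewrite FN ?scaler0//; exact: leq_trans ij.
apply: eq_tsum => s; rewrite (@tsumE s.+1); last first.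
  by move=> j; rewrite ltnNge => /negPf ->.
rewrite scaler_suml; apply: eq_bigr => i _.
by rewrite -ltnS ltn_ord.
Qed.

Lemma tsum0 : tsum (fun=> 0) = 0 :> M.
Proof. by rewrite (@tsumE 0) ?big_ord0. Qed.

Lemma tsum_first N F : (forall j, (N <= j)%N -> F j = 0) ->
  tsum F = F 0%N + tsum (fun j => F j.+1).
Proof.
move=> FN; rewrite (@tsumE N.+1) ?big_ord_recl; last by move=> j /ltnW /FN.
by rewrite (@tsumE N)// => j Nj; apply: FN; exact: leqW.
Qed.

Lemma tsum_one i F : (forall j, j != i -> F j = 0) -> tsum F = F i.
Proof.
move=> Fi; rewrite (@tsumE i.+1); last by move=> j ij; apply: Fi; rewrite gtn_eqF.
rewrite (bigD1 (Ordinal (ltnSn i))) //= big1 ?addr0// => j ji.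
by apply: Fi; move: ji; apply: contra => /eqP ji; apply/eqP/val_inj.
Qed.

End FinSums.

(** Finitely many families that are eventually well behaved are so from a
    common rank on. *)
Lemma uniform_bound n (P : nat -> nat -> Prop) :
  (forall j, (j < n)%N -> exists L, forall i, (L <= i)%N -> P j i) ->
  exists L, forall j i, (j < n)%N -> (L <= i)%N -> P j i.
Proof.
elim: n => [|n IH] Pn; first by exists 0%N.
have [|L PL] := IH; first by move=> j jn; apply: Pn; exact: ltnW.
have [L' PL'] := Pn n (ltnSn n).
exists (maxn L L') => j i; rewrite ltnS leq_eqVlt geq_max => /orP[/eqP ->|jn] /andP[Li L'i].
  exact: PL'.
exact: PL.
Qed.

(** * Subquotients and transport of Poisson structures *)

Section Classes.
Context {K : nzRingType} {M : lmodType K} (A B : lsubspace M).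
Local Notation cls := (subquot_class A B).

Let insubA v : v \in A -> val (insubd (0 : submod A) v) = v.
Proof. by move=> vA; rewrite val_insubd vA. Qed.

Lemma class_eq v w : v \in A -> w \in A -> cls v = cls w <-> v - w \in B.
Proof. by move=> vA wA; rewrite /subquot_class subquot_piE !insubA. Qed.

Lemma class_lin (k : K) v w : v \in A -> w \in A ->
  cls (k *: v + w) = k *: cls v + cls w.
Proof.
move=> vA wA; rewrite /subquot_class.
have -> : insubd (0 : submod A) (k *: v + w) = k *: insubd 0 v + insubd 0 w.
  apply: val_inj; rewrite linearP /= !insubA//.
  by apply: rpredD => //; exact: rpredZ.
by rewrite subquot_piD -subquot_scale_pi.
Qed.

Lemma class0 : cls 0 = 0.
Proof.
have := class_lin (-1) (rpred0 A) (rpred0 A).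
by rewrite scaler0 addr0 scaleN1r addNr.
Qed.

Lemma class_eq0 v : v \in A -> cls v = 0 <-> v \in B.
Proof. by move=> vA; rewrite -class0 class_eq ?rpred0// subr0. Qed.

Lemma class_repr x : cls (subquot_repr x) = x.
Proof. by rewrite /subquot_class /subquot_repr valKd subquot_reprK. Qed.

Lemma repr_in (x : subquot A B) : subquot_repr x \in A.
Proof. exact: valP. Qed.

End Classes.

(** A bijection that respects the operations carries every axiom over; since an
    isomorphism is only asked to map homogeneous elements to homogeneous ones,
    the converse is a separate hypothesis. *)
Lemma poisson_transport (K : fieldType) (P Q : poissonData K) (f : P -> Q) :
  poisson_isomorphism f ->
  (forall b y, ppar b y -> exists2 x, ppar b x & f x = y) ->
  poisson_superalgebra P -> poisson_superalgebra Q.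
Proof.
move=> [[fl [f' fK f'K]] fp f1 fM fB] fpar [[[S1 S2 S3 S4] P1 PM PB]
  [ml mr bl br] [mA m1 mC] JA LA].
have fD x y : f (x + y) = f x + f y by rewrite -[x]scale1r fl !scale1r.
have f0 : f 0 = 0 := linear_fun0 fl.
have fZ k x : f (k *: x) = k *: f x by rewrite -[k *: x]addr0 fl f0 addr0.
have fN x : f (- x) = - f x by rewrite -scaleN1r fZ scaleN1r.
split.
- split.
  + split.
    * by move=> b; rewrite -f0; exact/fp/S1.
    * move=> b k _ _ /fpar[u hu <-] /fpar[v hv <-]; rewrite -fl.
      exact/fp/S2.
    * move=> y; have [v0 [v1 [h0 h1 e]]] := S3 (f' y).
      exists (f v0), (f v1); split; [exact: fp|exact: fp|].
      by rewrite -fD -e f'K.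
    * move=> _ /fpar[u hu <-] /fpar[v hv] /(can_inj fK) e.
      by have -> : u = 0 by apply: S4 => //; rewrite -e.
  + by rewrite -f1; exact: fp.
  + by move=> b c _ _ /fpar[u hu <-] /fpar[v hv <-]; rewrite -fM; exact/fp/PM.
  + by move=> b c _ _ /fpar[u hu <-] /fpar[v hv <-]; rewrite -fB; exact/fp/PB.
- split=> y k u v; rewrite -[y]f'K -[u]f'K -[v]f'K -fl.
  + by rewrite -!fM ml fl.
  + by rewrite -!fM mr fl.
  + by rewrite -!fB bl fl.
  + by rewrite -!fB br fl.
- split.
  + by move=> x y z; rewrite -[x]f'K -[y]f'K -[z]f'K -!fM mA.
  + by move=> x; rewrite -[x]f'K -f1 -fM m1.
  + by move=> b c _ _ /fpar[u hu <-] /fpar[v hv <-]; rewrite -!fM (mC b c)// fZ.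
- move=> b c _ _ z /fpar[u hu <-] /fpar[v hv <-]; rewrite -[z]f'K -!fB.
  have [-> ->] := JA b c u v (f' z) hu hv.
  by rewrite fN fD !fZ.
- move=> b c _ _ z /fpar[u hu <-] /fpar[v hv <-]; rewrite -[z]f'K -!fM -!fB -!fM.
  by rewrite (LA b c)// fD fZ.
Qed.

Lemma tsum_lin (K : nzRingType) (M : lmodType K) N (k : K) (F G : nat -> M) :
  (forall j, (N <= j)%N -> F j = 0) -> (forall j, (N <= j)%N -> G j = 0) ->
  tsum (fun j => k *: F j + G j) = k *: tsum F + tsum G.
Proof.
move=> FN GN; rewrite !(@tsumE _ _ N)//.
  by rewrite scaler_sumr -big_split.
by move=> j Nj; rewrite FN ?GN ?scaler0 ?addr0.
Qed.

Lemma tsumZ (K : nzRingType) (M : lmodType K) N (k : K) (F : nat -> M) :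
  (forall j, (N <= j)%N -> F j = 0) -> tsum (fun j => k *: F j) = k *: tsum F.
Proof.
by move=> FN; rewrite !(@tsumE _ _ N) ?scaler_sumr// => j /FN ->; rewrite scaler0.
Qed.

(** * The Borcherds identity for fields multiplied by power series *)

Section Modes.
Context {R : realType} {V : vertexSuperalgebra R}.
Local Notation K := R[i].
Implicit Types (a b c d u v w : V) (p q : nat -> K) (m n k : int).

HB.instance Definition _ (a : V) (n : int) :=
  GRing.isLinear.Build K V V *:%R (nprod a n) (nprod_linr a n).

Definition nprodl n v : V -> V := fun u => nprod u n v.
HB.instance Definition _ n v :=
  GRing.isLinear.Build K V V *:%R (nprodl n v) (nprod_linl n v).

Lemma nprodDl a b n v : nprod (a + b) n v = nprod a n v + nprod b n v.
Proof. exact: (raddfD (nprodl n v)). Qed.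
Lemma nprodZl (c : K) a n v : nprod (c *: a) n v = c *: nprod a n v.
Proof. exact: (linearZZ (nprodl n v)). Qed.
Lemma nprod0l n v : nprod 0 n v = 0 :> V.
Proof. exact: (raddf0 (nprodl n v)). Qed.
Lemma nprod0r a n : nprod a n 0 = 0.
Proof. exact: (raddf0 (nprod a n)). Qed.
Lemma nprodDr a n v w : nprod a n (v + w) = nprod a n v + nprod a n w.
Proof. exact: (raddfD (nprod a n)). Qed.
Lemma nprodZr a n (c : K) v : nprod a n (c *: v) = c *: nprod a n v.
Proof. exact: (linearZZ (nprod a n)). Qed.

Lemma nprod_subE a b c d n :
  nprod a n b - nprod c n d = nprod (a - c) n b + nprod c n (b - d).
Proof.
rewrite nprodDl nprodDr -[- c]scaleN1r -[- d]scaleN1r nprodZl nprodZr.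
by rewrite !scaleN1r addrA subrK.
Qed.

Lemma nprod_bound a m v :
  exists L, forall i, (L <= i)%N -> nprod a (m + i%:Z) v = 0.
Proof.
have [N PN] := nprod_field a v; exists `|N - m|%N => i Li.
by apply: PN; move: Li; lia.
Qed.

(** The coefficient of index n of the field p(z) Y(a, z), that is
    Res_z z^n p(z) Y(a, z) v, for the power series p with coefficients p i. *)
Definition smode p a n v : V := tsum (fun i => p i *: nprod a (n + i%:Z) v).

Lemma smode_linr p a n : linear (smode p a n).
Proof.
move=> c v w; have [L1 P1] := nprod_bound a n v; have [L2 P2] := nprod_bound a n w.
rewrite /smode -(@tsum_lin _ _ (maxn L1 L2)).
- by apply: eq_tsum => j; rewrite linearP scalerDr !scalerA mulrC.
- by move=> j; rewrite geq_max => /andP[/P1 -> _]; rewrite scaler0.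
- by move=> j; rewrite geq_max => /andP[_ /P2 ->]; rewrite scaler0.
Qed.

Lemma smode_linl p n v : linear (fun a => smode p a n v).
Proof.
move=> c a b; have [L1 P1] := nprod_bound a n v; have [L2 P2] := nprod_bound b n v.
rewrite /smode -(@tsum_lin _ _ (maxn L1 L2)).
- apply: eq_tsum => j; rewrite nprodDl nprodZl scalerDr !scalerA mulrC //.
- by move=> j; rewrite geq_max => /andP[/P1 -> _]; rewrite scaler0.
- by move=> j; rewrite geq_max => /andP[_ /P2 ->]; rewrite scaler0.
Qed.

HB.instance Definition _ p a n :=
  GRing.isLinear.Build K V V *:%R (smode p a n) (smode_linr p a n).

Lemma smode0l p n v : smode p 0 n v = 0.
Proof.
by rewrite /smode (@tsumE _ _ 0) ?big_ord0// => i _; rewrite nprod0l scaler0.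
Qed.

(** A composition of two such modes is a finite double sum once the
    composition of the ordinary modes vanishes outside a box. *)
Lemma smode_smode_box p q a b m k v L :
  (forall i l, (L <= i)%N || (L <= l)%N -> nprod a (m + i%:Z) (nprod b (k + l%:Z) v) = 0) ->
  (forall l, (L <= l)%N -> nprod b (k + l%:Z) v = 0) ->
  smode p a m (smode q b k v) =
  \sum_(i < L) \sum_(l < L) (p i * q l) *:
     nprod a (m + i%:Z) (nprod b (k + l%:Z) v).
Proof.
move=> PL QL.
have -> : smode q b k v = \sum_(l < L) q l *: nprod b (k + l%:Z) v.
  by rewrite /smode (@tsumE _ _ L)// => l /QL ->; rewrite scaler0.
rewrite raddf_sum exchange_big; apply: eq_bigr => l _.
rewrite /= linearZZ /= /smode (@tsumE _ _ L); last first.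
  by move=> i Li; rewrite PL ?Li ?scaler0.
by rewrite scaler_sumr; apply: eq_bigr => i _; rewrite scalerA mulrC.
Qed.

(** For v to survive, l + j is bounded; finitely many vectors remain, and these
    bound i. *)
Lemma nprod_box a b m k v :
  exists L, forall i l j, [|| (L <= i)%N, (L <= l)%N | (L <= j)%N] ->
     nprod b (k + (l + j)%:Z) v = 0 \/
     nprod a (m - j%:Z + i%:Z) (nprod b (k + (l + j)%:Z) v) = 0.
Proof.
have [L1 P1] := nprod_bound b k v.
have [|L2 P2] := @uniform_bound L1 (fun s i =>
    forall j, (j < L1)%N -> nprod a (m - j%:Z + i%:Z) (nprod b (k + s%:Z) v) = 0).
  move=> s sL1; have [|L PL] := @uniform_bound L1 (fun j i =>
      nprod a (m - j%:Z + i%:Z) (nprod b (k + s%:Z) v) = 0).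
    by move=> j jL; exact: nprod_bound.
  by exists L => i Li j jL1; apply: PL.
exists (maxn L1 L2) => i l j; rewrite !geq_max.
have [lj|lj] := leqP L1 (l + j)%N; first by rewrite P1; [left|].
move=> H; right; apply: P2 => //; first 2 last.
- by move: H lj; lia.
- by move: H lj; lia.
Qed.

Lemma sgn_scale (s : K) (c : K) (x y : V) :
  c *: (x - s *: y) = c *: x - s *: (c *: y).
Proof. by rewrite scalerBr !scalerA mulrC. Qed.

(** The Borcherds identity is linear in the test function z^m w^k (z - w)^n, so
    this function may be multiplied by p(z) q(w).  All the sums involved live in
    a common finite box, where they can be interchanged. *)
Lemma smode_borcherds p q pa pb u v w m n k : vpar pa u -> vpar pb v ->
  tsum (fun j => tsum (fun i => tsum (fun l =>
    (p i * q l * gbinom ((m + i%:Z)%:~R) j) *: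
      nprod (nprod u (n + j%:Z) v) (m + k - j%:Z + (i + l)%:Z) w))) =
  tsum (fun j => ((-1) ^+ j * gbinom (n%:~R : K) j) *:
    (smode p u (m + n - j%:Z) (smode q v (k + j%:Z) w) -
     ((-1) ^ n * (-1) ^+ (pa && pb)) *:
       smode q v (n + k - j%:Z) (smode p u (m + j%:Z) w))).
Proof.
move=> hu hv; set s := (-1) ^ n * _.
have [L1 P1] := @nprod_box u v (m + n) k w.
have [L2 P2] := @nprod_box v u (n + k) m w.
have [L3 P3] := nprod_bound u n v.
have [|L4 P4] := @uniform_bound L3 (fun j i =>
    nprod (nprod u (n + j%:Z) v) (m + k - j%:Z + i%:Z) w = 0).
  by move=> j _; exact: nprod_bound.
have [L5 P5] := nprod_bound v k w.
have [L6 P6] := nprod_bound u m w.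
pose L := maxn L1 (maxn L2 (maxn L3 (maxn L4 (maxn L5 L6)))).
pose X i l j := nprod u (m + n - j%:Z + i%:Z) (nprod v (k + (l + j)%:Z) w).
pose Y i l j := nprod v (n + k - j%:Z + l%:Z) (nprod u (m + (i + j)%:Z) w).
pose Z i l j := nprod (nprod u (n + j%:Z) v) (m + k - j%:Z + (i + l)%:Z) w.
have X0 i l j : [|| (L <= i)%N, (L <= l)%N | (L <= j)%N] -> X i l j = 0.
  move=> H; have [|e|//] := P1 i l j; first by move: H; rewrite /L; lia.
  by rewrite /X e nprod0r.
have Y0 i l j : [|| (L <= i)%N, (L <= l)%N | (L <= j)%N] -> Y i l j = 0.
  move=> H; have [|e|//] := P2 l i j; first by move: H; rewrite /L; lia.
  by rewrite /Y e nprod0r.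
have Z0 i l j : [|| (L <= i)%N, (L <= l)%N | (L <= j)%N] -> Z i l j = 0.
  rewrite /Z => H; have [L3j|jL3] := leqP L3 j; first by rewrite P3// nprod0l.
  by rewrite P4//; move: H; rewrite /L; lia.
have E i l : \sum_(j < L) gbinom ((m + i%:Z)%:~R : K) j *: Z i l j =
    \sum_(j < L) ((-1) ^+ j * gbinom (n%:~R : K) j) *: (X i l j - s *: Y i l j).
  have := borcherds w (m + i%:Z) n (k + l%:Z) hu hv.
  rewrite -/s -[LHS]/(tsum _) -[RHS]/(tsum _) !(@tsumE _ _ L).
  - have eZ (j : 'I_L) : (m + i%:Z + (k + l%:Z) - j%:Z) = m + k - j%:Z + (i + l)%:Z.
      by rewrite PoszD; ring.
    under eq_bigr do rewrite eZ.
    move=> ->; apply: eq_bigr => j _; congr (_ *: (_ - _ *: _)).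
      by rewrite /X; congr (nprod _ _ (nprod _ _ _)); rewrite ?PoszD; ring.
    by rewrite /Y; congr (nprod _ _ (nprod _ _ _)); rewrite ?PoszD; ring.
  - move=> j Lj; have := X0 i l j; have := Y0 i l j.
    rewrite /X /Y Lj !orbT => /(_ isT) y0 /(_ isT) x0.
    rewrite (_ : m + i%:Z + n - j%:Z = m + n - j%:Z + i%:Z); last by ring.
    rewrite (_ : k + l%:Z + j%:Z = k + (l + j)%:Z); last by rewrite PoszD; ring.
    rewrite (_ : n + (k + l%:Z) - j%:Z = n + k - j%:Z + l%:Z); last by ring.
    rewrite (_ : m + i%:Z + j%:Z = m + (i + j)%:Z); last by rewrite PoszD; ring.
    by rewrite x0 y0 scaler0 subrr scaler0.
  - move=> j Lj; have := Z0 i l j; rewrite /Z Lj !orbT => /(_ isT) z0.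
    rewrite (_ : m + i%:Z + (k + l%:Z) - j%:Z = m + k - j%:Z + (i + l)%:Z).
      by rewrite z0 scaler0.
    by rewrite PoszD; ring.
transitivity (\sum_(i < L) \sum_(l < L) (p i * q l) *:
    \sum_(j < L) gbinom ((m + i%:Z)%:~R : K) j *: Z i l j).
  rewrite (@tsumE _ _ L); last first.
    move=> j Lj; rewrite (@tsum_box2 _ _ 0) ?big_ord0// => i l _.
    by rewrite -[nprod _ _ _]/(Z i l j) Z0 ?Lj ?orbT// scaler0.
  transitivity (\sum_(j < L) \sum_(i < L) \sum_(l < L)
      (p i * q l * gbinom ((m + i%:Z)%:~R : K) j) *: Z i l j).
    apply: eq_bigr => j _; apply: tsum_box2 => i l il.
    by rewrite -[nprod _ _ _]/(Z i l j) Z0 ?scaler0// orbA il.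
  rewrite exchange_big; apply: eq_bigr => i _.
  rewrite exchange_big; apply: eq_bigr => l _.
  rewrite scaler_sumr; apply: eq_bigr => j _.
  by rewrite scalerA.
under eq_bigr do under eq_bigr do rewrite E.
have eX (j : nat) : (j < L)%N -> smode p u (m + n - j%:Z) (smode q v (k + j%:Z) w) =
    \sum_(i < L) \sum_(l < L) (p i * q l) *: X i l j.
  move=> jL; have e l : k + j%:Z + l%:Z = k + (l + j)%:Z by rewrite PoszD; ring.
  rewrite (@smode_smode_box _ _ _ _ _ _ _ L).
  - by apply: eq_bigr => i _; apply: eq_bigr => l _; rewrite e.
  - by move=> i l il; rewrite e -/(X i l j) X0// orbA il.
  - by move=> l Ll; rewrite e P5//; move: Ll; rewrite /L; lia.
have eY (j : nat) : (j < L)%N -> smode q v (n + k - j%:Z) (smode p u (m + j%:Z) w) =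
    \sum_(i < L) \sum_(l < L) (p i * q l) *: Y i l j.
  move=> jL; have e l : m + j%:Z + l%:Z = m + (l + j)%:Z by rewrite PoszD; ring.
  rewrite (@smode_smode_box _ _ _ _ _ _ _ L).
  - by rewrite exchange_big; apply: eq_bigr => i _; apply: eq_bigr => l _; rewrite e mulrC.
  - by move=> i l il; rewrite e -/(Y l i j) Y0// orbA orbC orbA orbC orbA; move: il; lia.
  - by move=> l Ll; rewrite e P6//; move: Ll; rewrite /L; lia.
rewrite (@tsumE _ _ L); last first.
  move=> j Lj; rewrite (_ : smode q v (k + j%:Z) w = 0); last first.
    rewrite /smode (@tsumE _ _ 0) ?big_ord0// => l _.
    rewrite -addrA -PoszD P5 ?scaler0//; move: Lj; rewrite /L; lia.
  rewrite (_ : smode p u (m + j%:Z) w = 0); last first.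
    rewrite /smode (@tsumE _ _ 0) ?big_ord0// => l _.
    rewrite -addrA -PoszD P6 ?scaler0//; move: Lj; rewrite /L; lia.
  by rewrite !raddf0 addr0 scaler0.
under [RHS]eq_bigr => j _ do rewrite eX // eY // scaler_sumr -sumrB scaler_sumr.
rewrite [RHS]exchange_big; apply: eq_bigr => i _.
under [RHS]eq_bigr => j _ do rewrite scaler_sumr -sumrB scaler_sumr.
rewrite [RHS]exchange_big; apply: eq_bigr => l _.
rewrite scaler_sumr; apply: eq_bigr => j _.
by rewrite -sgn_scale !scalerA mulrC.
Qed.

End Modes.

(** * Fields multiplied by a power of 1 + h z *)

Section ExpSeries.
Context {K : numFieldType} (h : K).
Implicit Types g d : K.

(** The coefficients of (1 + h z)^g. *)
Definition bseries g (i : nat) : K := h ^+ i * gbinom g i.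

Lemma bseries0 g : bseries g 0 = 1.
Proof. by rewrite /bseries expr0 gbinom0 mulr1. Qed.

Lemma bseries_conv g d s :
  \sum_(i < s.+1) bseries g i * bseries d (s - i) = bseries (g + d) s.
Proof.
rewrite /bseries gbinom_add mulr_sumr; apply: eq_bigr => i _.
by rewrite mulrACA -exprD subnKC// -ltnS ltn_ord.
Qed.

Lemma bseries_mul g i j :
  bseries g (j + i) * gbinom ((j + i)%:R) j = bseries g j * bseries (g - j%:R) i.
Proof.
by rewrite /bseries -mulrA gbinom_mul ?leq_addr// addKn exprD; ring.
Qed.

(** The coefficient of w^s in (d^j/j! of (1 + h w)^g) w^j (1 + h w)^d. *)
Lemma bseries_conv_shift g d j s :
  \sum_(i < s.+1) (bseries g i * gbinom (i%:R) j) * bseries d (s - i) =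
  if (j <= s)%N then bseries g j * bseries (g - j%:R + d) (s - j) else 0.
Proof.
case: leqP => [js|sj]; last first.
  by apply: big1 => i _; rewrite gbinom_small ?mulr0 ?mul0r//; have := ltn_ord i; lia.
have [r ->] : exists r, s = (j + r)%N by exists (s - j)%N; rewrite subnKC.
rewrite addKn -addnS big_split_ord /= big1 ?add0r; last first.
  by move=> i _; rewrite gbinom_small ?mulr0 ?mul0r.
rewrite -bseries_conv mulr_sumr; apply: eq_bigr => i _.
by rewrite bseries_mul subnDl mulrA.
Qed.

Lemma bseries_pascal g i : bseries (g + 1) i.+1 = bseries g i.+1 + h * bseries g i.
Proof. by rewrite /bseries gbinom_pascal exprS; ring. Qed.
End ExpSeries.

Section ExpModes.
Context {R : realType} {V : vertexSuperalgebra R} (h : R[i]).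
Local Notation K := R[i].
Local Notation E := (bseries h).
Implicit Types (a b u v w : V) (g d : K) (m n k : int) (S : lsubspace V).

Lemma smode_bseries0 g a n v : smode (bseries 0 g) a n v = nprod a n v.
Proof.
rewrite /smode (@tsum_one _ _ 0%N) ?bseries0 ?scale1r ?addr0// => -[//|j] _.
by rewrite /bseries expr0n mul0r scale0r.
Qed.

(** Re-expanding (1 + h z)^g z^m around z = w produces, for each power of z - w,
    powers of w times (1 + h w)^(g - i); on the left of the Borcherds identity the
    field Y(a_(j) b, w) is therefore again multiplied by powers of 1 + h w. *)
Lemma smode_expansion g d c w (m t : int) j :
  tsum (fun i => tsum (fun l => (E g i * E d l * gbinom ((m + i%:Z)%:~R) j) *:
      nprod c (t + (i + l)%:Z) w)) =
  \sum_(i < j.+1) (E g i * gbinom (m%:~R) (j - i)) *: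
      smode (E (g - i%:R + d)) c (t + i%:Z) w :> V.
Proof.
have [N PN] := nprod_bound c t w; pose X s := nprod c (t + s%:Z) w.
have XN s : (N <= s)%N -> X s = 0 by apply: PN.
rewrite -/X.
pose B i' i l := ((E g i * gbinom (i%:R) i') * E d l) *: X (i + l)%N.
have B0 i' i l : (N <= i)%N || (N <= l)%N -> B i' i l = 0.
  by move=> il; rewrite /B XN ?scaler0//; move: il; lia.
have term i l : (E g i * E d l * gbinom ((m + i%:Z)%:~R) j) *: X (i + l)%N =
    \sum_(i' < j.+1) gbinom (m%:~R) (j - i') *: B i' i l.
  rewrite rmorphD /= addrC gbinom_add mulr_sumr scaler_suml; apply: eq_bigr => i' _.
  by rewrite /B scalerA; congr (_ *: _); rewrite -pmulrn; ring.
rewrite (@tsum_box2 _ _ N); last first.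
  by move=> i l il; rewrite -/(X (i + l)%N) term big1// => i' _; rewrite B0 ?scaler0.
under eq_bigr do under eq_bigr do rewrite -/(X _) term.
under eq_bigr do rewrite exchange_big.
rewrite exchange_big; apply: eq_bigr => i' _ /=.
under eq_bigr do rewrite -scaler_sumr.
rewrite -scaler_sumr [in RHS]mulrC -[RHS]scalerA; congr (_ *: _).
rewrite -(tsum_box2 (B0 i')) (tsum_conv _ _ XN).
under eq_tsum do rewrite bseries_conv_shift.
have -> : (fun s => (if (i' <= s)%N then E g i' * E (g - i'%:R + d) (s - i') else 0) *: X s)
  = (fun s => if (i' <= s)%N then (E g i' * E (g - i'%:R + d) (s - i')) *: X s else 0).
  by apply/funext => s; case: ifP => // _; rewrite scale0r.
rewrite -(@tsum_shift _ _ N i' (fun s => (E g i' * E (g - i'%:R + d) (s - i')) *: X s)); last first.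
  by move=> s /XN ->; rewrite scaler0.
rewrite /smode -(@tsumZ _ _ N); last first.
  move=> s Ns; have -> : t + i'%:Z + s%:Z = t + (i' + s)%:Z by rewrite PoszD addrA.
  by rewrite -/(X (i' + s)%N) XN ?scaler0//; lia.
by apply: eq_tsum => s; rewrite /X addKn scalerA PoszD addrA.
Qed.

Lemma smode_shift1 g a n v :
  smode (E (g + 1)) a n v = smode (E g) a n v + h *: smode (E g) a (n + 1) v.
Proof.
have [N PN] := nprod_bound a n v.
have PN' i : (N <= i)%N -> nprod a (n + 1 + i%:Z) v = 0.
  by move=> Ni; rewrite -addrA -(PoszD 1) PN//; lia.
rewrite /smode !(@tsumE _ _ N.+1).
- rewrite 2!big_ord_recl /= !bseries0 -addrA; congr (_ + _).
  rewrite [in RHS]big_ord_recr /= scalerDr PN'// !scaler0 addr0.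
  rewrite scaler_sumr -big_split; apply: eq_bigr => i _ /=.
  rewrite /bump leq0n add1n bseries_pascal scalerDl scalerA; congr (_ + _ *: nprod _ _ _).
  by rewrite -addn1 PoszD; ring.
- by move=> i Ni; rewrite PN' ?scaler0//; lia.
- by move=> i Ni; rewrite PN ?scaler0//; lia.
- by move=> i Ni; rewrite PN ?scaler0//; lia.
Qed.

(** By (1 + h z)^(g + r) = (1 + h z)^g (1 + h z)^r, the mode of index n for the
    exponent g + r only involves the modes n, ..., n + r for the exponent g. *)
Lemma smode_shift_in S g a n v r :
  (forall i, (i <= r)%N -> smode (E g) a (n + i%:Z) v \in S) ->
  smode (E (g + r%:R)) a n v \in S.
Proof.
elim: r n => [|r IH] n PS; first by have := PS 0%N isT; rewrite !addr0.
have -> : g + r.+1%:R = g + r%:R + 1 by rewrite -natr1 addrA.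
rewrite smode_shift1; apply: rpredD; last apply: rpredZ.
  by apply: IH => i ir; apply: PS; exact: leqW.
apply: IH => i ir; have -> : n + 1 + i%:Z = n + i.+1%:Z by lia.
exact: PS.
Qed.

(** The Borcherds identity for n = 0. *)
Lemma smode_comm g d pa pb u v w m k : vpar pa u -> vpar pb v ->
  smode (E g) u m (smode (E d) v k w) -
    (-1) ^+ (pa && pb) *: smode (E d) v k (smode (E g) u m w) =
  tsum (fun j => \sum_(i < j.+1) (E g i * gbinom (m%:~R) (j - i)) *:
    smode (E (g - i%:R + d)) (nprod u j%:Z v) (m + k - j%:Z + i%:Z) w).
Proof.
move=> hu hv; have := smode_borcherds (E g) (E d) w m 0 k hu hv.
rewrite [X in _ = X -> _](@tsum_one _ _ 0%N).
  rewrite gbinom0 !mulr1 expr0 scale1r expr0z mul1r add0r ?subr0 ?addr0 => <-.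
  by apply: eq_tsum => j; rewrite -smode_expansion add0r.
by move=> [//|j] _; rewrite gbinom0S mulr0 scale0r.
Qed.

(** The Borcherds identity for m = 0, where only the term i = j of the
    re-expansion remains. *)
Lemma smode_assoc g d pa pb u v w n k : vpar pa u -> vpar pb v ->
  tsum (fun j => E g j *: smode (E (g - j%:R + d)) (nprod u (n + j%:Z) v) k w) =
  tsum (fun j => ((-1) ^+ j * gbinom (n%:~R : K) j) *:
    (smode (E g) u (n - j%:Z) (smode (E d) v (k + j%:Z) w) -
     ((-1) ^ n * (-1) ^+ (pa && pb)) *:
       smode (E d) v (n + k - j%:Z) (smode (E g) u j%:Z w))).
Proof.
move=> hu hv; have := smode_borcherds (E g) (E d) w 0 n k hu hv.
move=> e; refine (etrans (etrans _ e) _); last by apply: eq_tsum => j; rewrite !add0r.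
apply: eq_tsum => j; rewrite smode_expansion big_ord_recr /= big1 ?add0r.
  by rewrite subnn gbinom0 mulr1 subrK.
move=> i _; have : (0 < j - i)%N by have := ltn_ord i; lia.
by case: (j - i)%N => // r _; rewrite gbinom0S mulr0 scale0r.
Qed.

(** The filtrations used below do not see coefficients, so the commutator
    formula is applied as a membership statement. *)
Lemma smode_comm_in S g d pa pb u v w m k : vpar pa u -> vpar pb v ->
  (forall j i, (i <= j)%N ->
    smode (E (g - i%:R + d)) (nprod u j%:Z v) (m + k - j%:Z + i%:Z) w \in S) ->
  smode (E g) u m (smode (E d) v k w) -
    (-1) ^+ (pa && pb) *: smode (E d) v k (smode (E g) u m w) \in S.
Proof.
move=> hu hv HS; rewrite (smode_comm _ _ _ _ _ hu hv); apply: tsum_in => j.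
by apply: rpred_sum => i _; apply/rpredZ/HS; rewrite -ltnS.
Qed.

(** Solving the associativity formula for the term of the left-hand side in
    which u and v are multiplied with the smallest index. *)
Lemma smode_assoc_in S g d pa pb u v w n k : vpar pa u -> vpar pb v ->
  (forall j, smode (E g) u (n - j%:Z) (smode (E d) v (k + j%:Z) w) \in S) ->
  (forall j, smode (E d) v (n + k - j%:Z) (smode (E g) u j%:Z w) \in S) ->
  (forall j, smode (E (g - j.+1%:R + d)) (nprod u (n + j.+1%:Z) v) k w \in S) ->
  smode (E (g + d)) (nprod u n v) k w \in S.
Proof.
move=> hu hv HS1 HS2 HS3; have := smode_assoc g d w n k hu hv.
have [N PN] := nprod_bound u n v.
rewrite (@tsum_first _ _ N); last first.
  by move=> j /PN ->; rewrite smode0l scaler0.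
rewrite bseries0 scale1r subr0 addr0 => /(canRL (addrK _)) ->.
apply: rpredB; apply: tsum_in => j; last exact/rpredZ/HS3.
by apply/rpredZ/rpredB => //; exact/rpredZ.
Qed.

End ExpModes.

(** * Consequences of the Borcherds identity for ordinary modes *)

Section VertexBasics.
Context {R : realType} {V : vertexSuperalgebra R}.
Local Notation K := R[i].
Implicit Types (a b u v w : V) (m n k : int) (S : lsubspace V).

Lemma parity_split v : exists v0 v1, [/\ vpar false v0, vpar true v1 & v = v0 + v1].
Proof. by have [_ _ + _] := vpar_super V; apply. Qed.

Lemma vparL (b : bool) (k : K) u v : vpar b u -> vpar b v -> vpar b (k *: u + v).
Proof. by have [_ + _ _] := vpar_super V; apply. Qed.

Lemma vpar0 (b : bool) : vpar b (0 : V).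
Proof. by have [+ _ _ _] := vpar_super V; apply. Qed.

Lemma vpar_disj v : vpar false v -> vpar true v -> v = 0.
Proof. by have [_ _ _ +] := vpar_super V; apply. Qed.

Lemma nprod_comm pa pb u v w m k : vpar pa u -> vpar pb v ->
  nprod u m (nprod v k w) - (-1) ^+ (pa && pb) *: nprod v k (nprod u m w) =
  tsum (fun j => gbinom (m%:~R : K) j *: nprod (nprod u j%:Z v) (m + k - j%:Z) w).
Proof.
move=> hu hv; have := borcherds w m 0 k hu hv.
rewrite -[LHS]/(tsum _) -[RHS]/(tsum _) [RHS](@tsum_one _ _ 0%N).
  rewrite gbinom0 !mulr1 expr0 scale1r expr0z mul1r add0r ?subr0 ?addr0 => <-.
  by apply: eq_tsum => j; rewrite add0r.
by move=> [//|j] _; rewrite gbinom0S mulr0 scale0r.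
Qed.

Lemma nprod_assoc pa pb u v w n k : vpar pa u -> vpar pb v ->
  nprod (nprod u n v) k w =
  tsum (fun j => ((-1) ^+ j * gbinom (n%:~R : K) j) *:
    (nprod u (n - j%:Z) (nprod v (k + j%:Z) w) -
     ((-1) ^ n * (-1) ^+ (pa && pb)) *:
       nprod v (n + k - j%:Z) (nprod u j%:Z w))).
Proof.
move=> hu hv; have := borcherds w 0 n k hu hv.
rewrite -[LHS]/(tsum _) -[RHS]/(tsum _) [LHS](@tsum_one _ _ 0%N).
  rewrite gbinom0 scale1r ?addr0 add0r ?subr0 => ->.
  by apply: eq_tsum => j; rewrite !add0r.
by move=> [//|j] _; rewrite gbinom0S scale0r.
Qed.

Lemma gbinomN1 j : gbinom (- 1 : K) j = (-1) ^+ j.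
Proof.
elim: j => [|j IH]; first by rewrite gbinom0.
by rewrite gbinomS' IH exprS mulN1r -opprD addrC natr1 mulNr mulNr mulrC mulKf.
Qed.

Lemma gbinomN2 j : (-1) ^+ j * gbinom (- 2 : K) j = j.+1%:R.
Proof.
elim: j => [|j IH]; first by rewrite gbinom0 mulr1.
rewrite gbinomS' exprS.
transitivity ((2 + j%:R) * ((-1) ^+ j * gbinom (-2 : K) j) / j.+1%:R); first by ring.
by rewrite IH mulfK ?pnatr_eq0// -natrD.
Qed.

(** Skew-symmetry: the Borcherds identity on the vacuum with m = -1 and k = 0. *)
Lemma nprod_skew pa pb u v n : vpar pa u -> vpar pb v ->
  nprod v n u = - (((-1) ^ n * (-1) ^+ (pa && pb)) *:
    tsum (fun j => (-1) ^+ j *: nprod (nprod u (n + j%:Z) v) (-1 - j%:Z) (vac V))).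
Proof.
move=> hu hv; have := borcherds (vac V) (-1) n 0 hu hv.
rewrite -[LHS]/(tsum _) -[RHS]/(tsum _) [RHS](@tsum_one _ _ 0%N); last first.
  move=> [//|j] _; rewrite !add0r (vac_right v).2 nprod0r.
  rewrite (_ : -1 + j.+1%:Z = j%:Z); last by rewrite -addn1 PoszD; ring.
  by rewrite (vac_right u).2 nprod0r scaler0 subrr scaler0.
rewrite gbinom0 expr0 mulr1 scale1r !addr0 (vac_right v).2 nprod0r sub0r ?subr0.
rewrite (vac_right u).1 => e.
have {}e : tsum (fun j => (-1) ^+ j *: nprod (nprod u (n + j%:Z) v) (-1 - j%:Z) (vac V))
   = - (((-1) ^ n * (-1) ^+ (pa && pb)) *: nprod v n u).
  rewrite -e; apply: eq_tsum => j; congr (_ *: _).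
  by rewrite rmorphN1 gbinomN1.
by rewrite e scalerN opprK scalerA expN1r -exprD -expr2 sqrr_sign scale1r.
Qed.

Lemma vDE a : vD V a = nprod a (-2) (vac V).
Proof.
have := nprod_trans a (-1) (vac V); rewrite (vac_right a).1 vD_vac nprod0r subr0 => ->.
by rewrite rmorphN1 opprK scale1r.
Qed.

(** The derivative of a is a_(-2) applied to the vacuum, and the associativity
    formula for n = -2 against the vacuum has a single nonzero term. *)
Lemma nprod_vD a n b : nprod (vD V a) n b = - n%:~R *: nprod a (n - 1) b.
Proof.
suff H pa u : vpar pa u -> nprod (vD V u) n b = - n%:~R *: nprod u (n - 1) b.
  have [a0 [a1 [/H e0 /H e1 ->]]] := parity_split a.
  by rewrite raddfD !nprodDl e0 e1 scalerDr.
move=> hu; rewrite vDE (nprod_assoc _ _ _ hu (vac_even V)).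
rewrite andbF expr0 mulr1 (_ : (-1) ^ (-2) = 1 :> K); last first.
  by rewrite expN1r -[`|_|%N]/2%N sqrrN expr1n.
under eq_tsum do rewrite scale1r !vac_left.
have N2 : (-2)%:~R = - 2 :> K by rewrite rmorphN.
case: n => n; last first.
  rewrite (@tsum_one _ _ n); last first.
    move=> j jn; rewrite ifF; last by apply/negbTE; move: jn; lia.
    by rewrite ifF ?nprod0r ?subrr ?scaler0//; lia.
  rewrite ifT; last by lia.
  rewrite ifF ?subr0; last by lia.
  rewrite N2 gbinomN2 NegzE rmorphN opprK /=; congr (_ *: nprod _ _ _); lia.
case: n => [|n].
  rewrite oppr0 scale0r (_ : (fun _ => _) = fun=> 0) ?tsum0//.
  apply/funext => j; rewrite ifF; last by lia.
  have -> : (0%:Z + j%:Z == -1) = false by lia.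
  by rewrite nprod0r subr0 scaler0.
rewrite (@tsum_one _ _ n); last first.
  move=> j jn; have -> : (n.+1%:Z + j%:Z == -1) = false by lia.
  have -> : (-2 + n.+1%:Z - j%:Z == -1) = false by move: jn; lia.
  by rewrite nprod0r subr0 scaler0.
have -> : (n.+1%:Z + n%:Z == -1) = false by lia.
have -> : (-2 + n.+1%:Z - n%:Z == -1) by lia.
rewrite nprod0r sub0r N2 gbinomN2 scalerN -scaleNr; congr (_ *: nprod _ _ _); lia.
Qed.

Lemma nprod_iter_vD a (k m : nat) b :
  m`!%:R *: nprod (iter k (vD V) a) (-1 - m%:Z) b =
  (m + k)`!%:R *: nprod a (-1 - (m + k)%:Z) b.
Proof.
elim: k m => [|k IH] m; first by rewrite addn0.
rewrite iterS nprod_vD scalerA addnS -addSn -IH factS natrM.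
congr (_ *: nprod _ _ _); last by lia.
have -> : (-1 - m%:Z)%:~R = - m.+1%:R :> K.
  by rewrite rmorphB rmorphN1 /= -pmulrn -natr1 opprD addrC.
by rewrite opprK mulrC.
Qed.

(** The modes of a divided derivative are multiples of those of the generator,
    shifted by the order of the derivative. *)
Lemma gen_elt_nprod_bin (d : Order.disp_t) (I : orderType d) (e : I -> V)
    (x : nat * I) (m : nat) b :
  nprod (gen_elt e x) (-1 - m%:Z) b =
  ('C(m + x.1, m))%:R *: nprod (e x.2) (-1 - (m + x.1)%:Z) b.
Proof.
have f0 (r : nat) : (r`!)%:R != 0 :> K by rewrite pnatr_eq0 -lt0n fact_gt0.
rewrite /gen_elt nprodZl; apply: (scalerI (f0 m)); apply: (scalerI (f0 x.1)).
rewrite !scalerA [X in X *: _ = _]mulrAC mulfV// mul1r nprod_iter_vD.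
rewrite -!natrM -(bin_fact (leq_addr x.1 m)) addKn; congr (_%:R *: _).
by rewrite mulnC (mulnC m`!).
Qed.

Lemma gen_elt_nprod (d : Order.disp_t) (I : orderType d) (e : I -> V) (x : nat * I) b :
  nprod (gen_elt e x) (-1) b = nprod (e x.2) (-1 - x.1%:Z) b.
Proof. by have := gen_elt_nprod_bin e x 0 b; rewrite !add0n bin0 scale1r. Qed.

End VertexBasics.

(** * Deformed monomials and the pregrading *)

Section Filtration.
Context {R : realType} {V : vertexSuperalgebra R}.
Local Notation K := R[i].
Context {disp : Order.disp_t} {I : orderType disp}.
Variables (e : I -> V) (par : I -> bool) (wt ep : I -> R) (gdeg : I -> nat).
Implicit Types (x y : nat * I) (s t : seq (nat * I)) (n l : int) (h : K) (b : bool).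

(** Boolean form of chi, so that it can be added to natural numbers. *)
Definition chi_b (e1 e2 : R) : bool := e1 + e2 <= -1.

(** The pair (Delta, epsilon) of a_(n) b, for a and b with pairs i and j; chi
    brings the sum of the epsilons back into the interval ]-1, 0]. *)
Definition idx_prod (i j : R * R) (n : int) : R * R :=
  (i.1 + j.1 - n%:~R - 1, i.2 + j.2 + (chi_b i.2 j.2)%:R).

(** gamma = Delta + epsilon. *)
Definition idx_gamma (i : R * R) : K := (i.1 + i.2)%:C%C.

Local Notation hmode h i := (smode (bseries h (idx_gamma i))).

Definition gen_idx (al : I) : R * R := (wt al, ep al).

Definition mono s : V := nop [seq gen_elt e x | x <- s].

Definition mono_idx s : R * R :=
  foldr (fun x i => idx_prod (gen_idx x.2) i (-1 - x.1%:Z)) (0, 0) s.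

Definition mono_parity s : bool := foldr (fun x b => par x.2 (+) b) false s.

Definition deg s : nat := \sum_(x <- s) gdeg x.2.

Definition gen_op h x (v : V) : V :=
  hmode h (gen_idx x.2) (e x.2) (-1 - x.1%:Z) v.

(** For h = 0 these are the normally ordered monomials; for h = 1 the nested
    products are those given by the operators a *_n. *)
Definition hmono h s : V := foldr (gen_op h) (vac V) s.

(** The generators d^(k) e_al that die in the quotients: a monomial with
    epsilon = 0 and such a head lies in C. *)
Definition killed x : bool := (0 < x.1)%N || (ep x.2 != 0).

(** The number -2 + chi in the definitions of C and J only depends on the first
    argument once the product lies in V_{g,H}. *)
Definition kill_bound (eps : R) : int := if eps == 0 then -2 else -1.

(** The bound on the degree is strict, so that level N is the strictly lower
    part of level N + 1. *)
Definition mono_filt N (i : R * R) : lsubspace V :=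
  lspan [set mono s | s in [set s | (deg s < N)%N /\ mono_idx s = i]].

(** The flag asks for a killed factor. *)
Definition hfilt h b N : lsubspace V :=
  lspan [set hmono h s | s in [set s | (deg s < N)%N /\ (b -> has killed s)]].

Hypothesis e_par : forall al, vpar (par al) (e al).
Hypothesis ep_range : forall al, -1 < ep al <= 0.
Hypothesis gdeg_gt0 : forall al, (0 < gdeg al)%N.
Hypothesis pregr : forall al be (j : nat), nprod (e al) j%:Z (e be) \in
  mono_filt (gdeg al + gdeg be) (idx_prod (gen_idx al) (gen_idx be) j%:Z).
Hypothesis mono_filt_proj : forall al s (j : nat) N,
  nprod (e al) j%:Z (mono s) \in lspan [set mono t | t in [set t | (deg t < N)%N]] ->
  nprod (e al) j%:Z (mono s) \in mono_filt N (idx_prod (gen_idx al) (mono_idx s) j%:Z).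

Lemma deg_cons x s : deg (x :: s) = (gdeg x.2 + deg s)%N.
Proof. by rewrite /deg big_cons. Qed.

Lemma deg_cat s t : deg (s ++ t) = (deg s + deg t)%N.
Proof. by rewrite /deg big_cat. Qed.

Lemma gen_elt_par x : vpar (par x.2) (gen_elt e x).
Proof.
case: x => k al; rewrite /gen_elt /=; suff : vpar (par al) (iter k (vD V) (e al)).
  by move=> H; rewrite -[_ *: _]addr0; apply: vparL => //; exact: vpar0.
elim: k => [|k IH] //=; move: (iter k _ _) IH => u hu.
by rewrite vDE -[par al]addbF; apply: nprod_par => //; exact: vac_even.
Qed.

Lemma mono_cons x s : mono (x :: s) = nprod (e x.2) (-1 - x.1%:Z) (mono s).
Proof. by rewrite -gen_elt_nprod. Qed.

Lemma mono_parP s : vpar (mono_parity s) (mono s).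
Proof.
elim: s => [|x s IH]; first exact: vac_even.
by apply: nprod_par => //; exact: gen_elt_par.
Qed.

Lemma chi_b_range (e1 e2 : R) : -1 < e1 <= 0 -> -1 < e2 <= 0 ->
  -1 < e1 + e2 + (chi_b e1 e2)%:R <= 0.
Proof.
rewrite /chi_b => /andP[l1 u1] /andP[l2 u2].
by apply/andP; split; case: (lerP (e1 + e2) (-1)) => /= H; lra.
Qed.

Lemma mono_idx_range s : -1 < (mono_idx s).2 <= 0.
Proof.
elim: s => [|x s IH] /=; first by rewrite ltrN10 lexx.
exact: chi_b_range.
Qed.

(** For epsilon = 0 no carry chi occurs. *)
Lemma mono_idx_kept x s : ep x.2 = 0 -> (mono_idx (x :: s)).2 = (mono_idx s).2.
Proof.
move=> /= ->; rewrite /chi_b add0r leNgt.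
by have /andP[-> _] := mono_idx_range s; rewrite addr0.
Qed.

Lemma hfilt_mono h b b' N N' : (N <= N')%N -> (b' -> b) ->
  forall v, v \in hfilt h b N -> v \in hfilt h b' N'.
Proof.
move=> NN bb; apply: lspan_mono => _ [s [sN sb] <-]; exists s => //; split.
  exact: leq_trans NN.
by move=> /bb /sb.
Qed.

Lemma hmono_hfilt h s : hmono h s \in hfilt h (has killed s) (deg s).+1.
Proof. by apply: mem_lspan; exists s. Qed.

Lemma gen_op_lin h x : linear (gen_op h x).
Proof. exact: smode_linr. Qed.

Lemma gen_op_hfilt h x b N v : v \in hfilt h b N ->
  gen_op h x v \in hfilt h (b || killed x) (gdeg x.2 + N).
Proof.
move: v; apply: lspan_ind.
- by rewrite /gen_op raddf0 rpred0.
- by move=> k u v Hu Hv; rewrite gen_op_lin rpredD ?rpredZ.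
move=> _ [s [sN sb] <-]; apply: mem_lspan; exists (x :: s) => //; split.
  by rewrite deg_cons ltn_add2l.
by rewrite /= orbC => /orP[-> //|/sb ->]; rewrite orbT.
Qed.

Lemma killed_bound x (j : nat) :
  killed (x.1 + j, x.2)%N = (-1 - (x.1 + j)%:Z <= kill_bound (ep x.2)).
Proof. by rewrite /killed /kill_bound /=; case: eqP => /=; lia. Qed.

(** Modes of monomials respect the pregrading, lower it if their index is
    nonnegative, keep a killed factor if their index is negative, and create one
    if their index is at most kill_bound.  The four claims are proved together,
    by induction on the total degree. *)
Definition mode_bound h k := forall s t n, (deg s + deg t < k)%N ->
  hmode h (mono_idx s) (mono s) n (hmono h t)
    \in hfilt h ((n <= kill_bound (mono_idx s).2) || (n < 0) && has killed t)
         (deg s + deg t + (n < 0)%R).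

Lemma kill_bound_lt0 eps n : n <= kill_bound eps -> n < 0.
Proof. by rewrite /kill_bound; case: ifP => _; lia. Qed.

Lemma mode_bound_lin h k : mode_bound h k -> forall N1 N2 i b c v n, (N1 + N2 <= k.+1)%N ->
  c \in mono_filt N1 i -> v \in hfilt h b N2 ->
  hmode h i c n v \in hfilt h ((n <= kill_bound i.2) || (n < 0) && b) (N1 + N2).-1.
Proof.
move=> Qk N1 N2 i b c v n NNk cM; move: v; apply: lspan_ind.
- by rewrite raddf0 rpred0.
- by move=> a u v Hu Hv; rewrite linearP rpredD ?rpredZ.
move=> _ [t [tN tb] <-]; move: c cM; apply: lspan_ind.
- by rewrite smode0l rpred0.
- by move=> a u v Hu Hv; rewrite smode_linl rpredD ?rpredZ.
move=> _ [s [sN <-] <-]; have /(Qk s t n) : (deg s + deg t < k)%N by lia.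
apply: hfilt_mono; first by case: (n < 0); lia.
by case/orP=> [-> //|/andP[-> /tb ->]]; rewrite orbT.
Qed.

(** The exponent produced by the commutator formula exceeds gamma of u_(m) v by
    m + 1 - r - chi, a natural number; so only modes of index l up to
    l + m + 1 - r - chi appear, and chi is what keeps them below kill_bound. *)
Lemma smode_comb_in h (S : lsubspace V) i j (u v w : V) (m : nat) (r : nat) l :
  (r <= m)%N ->
  (forall r', (r' <= m.+1 - r - chi_b i.2 j.2)%N ->
    hmode h (idx_prod i j m%:Z) (nprod u m%:Z v) (l + r'%:Z) w \in S) ->
  smode (bseries h (idx_gamma i - r%:R + idx_gamma j)) (nprod u m%:Z v) l w \in S.
Proof.
move=> rm HS; have -> : idx_gamma i - r%:R + idx_gamma j =
    idx_gamma (idx_prod i j m%:Z) + (m.+1 - r - chi_b i.2 j.2)%:R.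
  rewrite -subnDA natrB; last by case: chi_b; lia.
  rewrite natrD /idx_gamma /idx_prod /= -!natr1 -!(rmorph_nat (real_complex R)) -pmulrn.
  rewrite -(rmorph1 (real_complex R)) -!rmorphB -!rmorphD -!rmorphB -!rmorphD /=.
  congr (_%:C)%C; ring.
exact: smode_shift_in.
Qed.

(** An annihilation mode of a generator is moved to the right until it reaches
    the vacuum; the commutators have lower degree by the pregrading. *)
Lemma gen_nonneg h k : mode_bound h k -> forall al t n, 0 <= n -> (gdeg al + deg t <= k)%N ->
  hmode h (gen_idx al) (e al) n (hmono h t) \in hfilt h false (gdeg al + deg t).
Proof.
move=> Qk al t [n|//] _; elim: t => [|y t IH] alk.
  rewrite /smode (@tsumE _ _ 0) ?big_ord0 ?rpred0// => i _.
  by rewrite -PoszD (vac_right _).2 scaler0.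
rewrite deg_cons in alk *.
rewrite -[smode _ _ _ _](subrK ((-1) ^+ (par al && par y.2) *:
  gen_op h y (hmode h (gen_idx al) (e al) n%:Z (hmono h t)))).
apply: rpredD; last first.
  apply: rpredZ; have /(gen_op_hfilt y) : hmode h (gen_idx al) (e al) n%:Z (hmono h t)
    \in hfilt h false (gdeg al + deg t) by apply: IH; lia.
  by apply: hfilt_mono => //; lia.
apply: smode_comm_in; [exact: e_par|exact: e_par|] => j i ij.
apply: (@smode_comb_in h _ (gen_idx al) (gen_idx y.2)) => // r _.
have /(mode_bound_lin Qk) := pregr al y.2 j.
move=> /(_ (deg t).+1 (has killed t) (hmono h t)) H.
have {H} := H _ _ (hmono_hfilt h t); move=> /(_ (n%:Z + (-1 - y.1%:Z) - j%:Z + i%:Z + r%:Z)) H.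
by have {H} := H ltac:(lia); apply: hfilt_mono => //; lia.
Qed.

Lemma smode_vac h n v : hmode h (0, 0) (vac V) n v = nprod (vac V) n v.
Proof.
rewrite /smode (@tsum_one _ _ 0%N) ?bseries0 ?scale1r ?addr0// => -[//|j] _.
by rewrite /bseries /idx_gamma addr0 rmorph0 gbinom0S mulr0 scale0r.
Qed.

(** The bound for nonnegative modes of generators, but on ordinary monomials and
    with the bidegree recorded.  The step of the induction needs it for every h,
    because the vectors to which fields are attached are ordinary monomials. *)
Definition annihilation_bound k := forall al s (j : nat), (gdeg al + deg s <= k)%N ->
  nprod (e al) j%:Z (mono s) \in
    mono_filt (gdeg al + deg s) (idx_prod (gen_idx al) (mono_idx s) j%:Z).

(** The exponent of the second field that makes the associativity formula yield
    exactly the modes of exponent gamma of the products u_(-1-k+m) v. *)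
Lemma idx_gamma_prod i j (k m : nat) :
  idx_gamma i - m%:R + (idx_gamma j + (k + chi_b i.2 j.2)%:R) =
  idx_gamma (idx_prod i j (-1 - k%:Z + m%:Z)).
Proof.
have natC (r : nat) : r%:R = (r%:R)%:C%C :> K by rewrite rmorph_nat.
have rB (x y : R) : x%:C%C - y%:C%C = (x - y)%:C%C :> K by rewrite rmorphB.
have rD (x y : R) : x%:C%C + y%:C%C = (x + y)%:C%C :> K by rewrite rmorphD.
rewrite /idx_gamma /idx_prod /= !natC rB !rD; congr (_%:C)%C.
rewrite natrD rmorphD rmorphB rmorphN1 /= -!pmulrn; ring.
Qed.

(** A monomial e_al_(-1-k0) c is resolved by the associativity formula into
    modes of e_al and of c, both of lower degree. *)
Lemma mode_bound_step h k : mode_bound h k -> annihilation_bound k -> mode_bound h k.+1.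
Proof.
move=> Qk Khk s t n; rewrite ltnS leq_eqVlt => /orP[/eqP|]; last exact: Qk.
case: s => [|[k0 al] s] stk.
  rewrite smode_vac vac_left; case: (n =P -1) => [->|_]; last by rewrite rpred0.
  have := hmono_hfilt h t; apply: hfilt_mono; first by rewrite /deg big_nil add0n addn1.
  by rewrite /= /kill_bound eqxx.
rewrite deg_cons [(_, _).2]/= in stk; have al0 := gdeg_gt0 al.
elim/ltn_ind: k0 => k0 IHk; rewrite mono_cons deg_cons.
set S := hfilt _ _ _; set eps := (mono_idx s).2.
have gE : idx_gamma (idx_prod (gen_idx al) (mono_idx s) (-1 - k0%:Z)) =
    idx_gamma (gen_idx al) + (idx_gamma (mono_idx s) + (k0 + chi_b (ep al) eps)%:R).
  by have := idx_gamma_prod (gen_idx al) (mono_idx s) k0 0; rewrite subr0 addr0 => ->.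
(* The exponent of the second field is raised by k0 + chi, which makes the
   leading term on the left the wanted mode of the whole monomial. *)
rewrite gE; apply: (smode_assoc_in (e_par al) (mono_parP s)) => j.
(* Creation mode of e_al on the left: either this mode is a killed generator,
   or k0 = j = 0 and epsilon_al = 0, and then chi = 0, so that the inner mode
   is the mode n itself and carries the killed factor. *)
- rewrite -addrA -opprD -PoszD -[smode _ _ _ _]/(gen_op h ((k0 + j)%N, al) _).
  have inner : smode (bseries h (idx_gamma (mono_idx s) + (k0 + chi_b (ep al) eps)%:R))
      (mono s) (n + j%:Z) (hmono h t) \in hfilt h (~~ killed ((k0 + j)%N, al) && 
        ((n <= kill_bound eps) || (n < 0) && has killed t)) (deg s + deg t + (n < 0)%R).
    apply: smode_shift_in => r rk.
    have := @Qk s t (n + j%:Z + r%:Z) ltac:(lia).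
    apply: hfilt_mono; first by lia.
    rewrite /killed /= negb_or negbK => /andP[/andP[k0j /eqP ep0]].
    have r0 : r = 0%N.
      move: rk; rewrite /chi_b ep0 add0r leNgt; have /andP[-> _] := mono_idx_range s; lia.
    by rewrite r0 (_ : j = 0%N) ?addr0//; lia.
  have := gen_op_hfilt ((k0 + j)%N, al) inner; apply: hfilt_mono; first by rewrite /=; lia.
  case killE: (killed _); rewrite ?orbT// orbF mono_idx_kept//.
  by move: killE; rewrite /killed => /negbT /norP[_ /negPn/eqP].
(* Annihilation mode of e_al on the right: it may destroy a killed factor, but
   the index of the outer mode is at most n - 1 + chi, which is within
   kill_bound whenever n < 0. *)
- have inner := gen_nonneg Qk (n := j%:Z) (al := al) (t := t) isT ltac:(lia).
  apply: smode_shift_in => r rk.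
  have sM : mono s \in mono_filt (deg s).+1 (mono_idx s) by apply: mem_lspan; exists s.
  have := mode_bound_lin Qk (-1 - k0%:Z + n - j%:Z + r%:Z) _ sM inner.
  move=> /(_ ltac:(lia)); apply: hfilt_mono; first by rewrite /=; lia.
  move=> H; have n0 : n < 0.
    by move: H => /orP[/kill_bound_lt0|/andP[]].
  have /andP[epl epu] := ep_range al; have /andP[epl' epu'] := mono_idx_range s.
  move: rk; rewrite andbF orbF /chi_b /kill_bound; case: eqP => e0.
    rewrite /eps e0 addr0 leNgt epl /= => rk; lia.
  case: lerP => _ /= rk; lia.
(* The other terms on the left replace the head of the monomial by a lower
   derivative of e_al, or by a nonnegative mode of e_al, which lowers the
   pregrading. *)
rewrite idx_gamma_prod; have [jk|kj] := ltnP j k0.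
  have E : -1 - k0%:Z + j.+1%:Z = -1 - (k0 - j.+1)%:Z by lia.
  have H := IHk (k0 - j.+1)%N ltac:(lia).
  by rewrite deg_cons mono_cons in H; rewrite E; exact: H.
rewrite (_ : -1 - k0%:Z + j.+1%:Z = (j - k0)%:Z); last by lia.
have cM := @Khk al s (j - k0)%N ltac:(lia).
have := mode_bound_lin Qk n _ cM (hmono_hfilt h t).
by move=> /(_ ltac:(lia)); apply: hfilt_mono => /=; lia.
Qed.

Lemma hmono0 s : hmono 0 s = mono s.
Proof.
elim: s => [|x s IH] //=; rewrite mono_cons -IH /gen_op.
by rewrite smode_bseries0.
Qed.

(** For h = 0 deformed and ordinary monomials coincide, so that the bound on
    annihilation modes follows from the mode bound and the two are proved in
    turn. *)
Lemma mode_bound_plain k : mode_bound 0 k /\ annihilation_bound k.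
Proof.
elim: k => [|k [Qk Khk]].
  split=> // al s j; have := gdeg_gt0 al; lia.
have Qk1 := mode_bound_step Qk Khk; split=> // al s j alk.
apply: mono_filt_proj; have := gen_nonneg Qk1 (n := j%:Z) (al := al) (t := s) isT alk.
rewrite hmono0 smode_bseries0; apply: lspan_mono => _ [t [tN _] <-].
by exists t => //; rewrite hmono0.
Qed.

Lemma mode_bound_all h k : mode_bound h k.
Proof.
by elim: k => [//|k IH]; apply: mode_bound_step => //; exact: (mode_bound_plain k).2.
Qed.

Lemma mode_boundP h b N1 N2 i c v n : c \in mono_filt N1 i -> v \in hfilt h b N2 ->
  hmode h i c n v \in hfilt h ((n <= kill_bound i.2) || (n < 0) && b) (N1 + N2).-1.
Proof.
move=> cM vF; apply: (mode_bound_lin (@mode_bound_all h (N1 + N2)) _ _ cM vF).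
exact: leqW.
Qed.

Definition gen_ops h s (v : V) : V := foldr (gen_op h) v s.

(** The commutator only involves modes of lower degree and of negative index; if
    one of the exchanged factors is killed, this index is at most the
    kill_bound of the commutator. *)
Lemma hmono_swap h x y t :
  hmono h [:: x, y & t] - (-1) ^+ (par x.2 && par y.2) *: hmono h [:: y, x & t]
  \in hfilt h (has killed [:: x, y & t]) (deg [:: x, y & t]).
Proof.
apply: smode_comm_in; [exact: e_par|exact: e_par|] => j i ij.
apply: (@smode_comb_in h _ (gen_idx x.2) (gen_idx y.2)) => // r rj.
have := mode_boundP (-1 - x.1%:Z + (-1 - y.1%:Z) - j%:Z + i%:Z + r%:Z)
  (pregr x.2 y.2 j) (hmono_hfilt h t).
apply: hfilt_mono; first by rewrite !deg_cons; lia.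
rewrite /= => H; have l0 : (-1 - x.1%:Z + (-1 - y.1%:Z) - j%:Z + i%:Z + r%:Z < 0).
  by move: rj; case: chi_b; lia.
rewrite l0; move: H; rewrite !orbA; case/orP => [H|->]; last by rewrite orbT.
apply/orP; left; move: H rj; rewrite /killed /kill_bound /chi_b /=.
have /andP[exl exu] := ep_range x.2; have /andP[eyl eyu] := ep_range y.2.
case: (eqVneq (ep x.2) 0) => [->|ex]; case: (eqVneq (ep y.2) 0) => [->|ey];
  rewrite ?orbF ?orbT ?add0r ?addr0 /=.
- by rewrite leNgt oppr_lt0 ltr01 /= eqxx => /orP[]; lia.
- by rewrite leNgt eyl /= addr0 (negPf ey); lia.
- by rewrite leNgt exl /= addr0 (negPf ex); lia.
- move=> _; case: lerP => xy /=; first by case: ifP; lia.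
  rewrite addr0 ifF; last by apply/eqP; move/eqP: ex; lra.
  lia.
Qed.

Lemma hmono_cons_rel h x s t c b N : hmono h s - c *: hmono h t \in hfilt h b N ->
  hmono h (x :: s) - c *: hmono h (x :: t) \in hfilt h (b || killed x) (gdeg x.2 + N).
Proof.
by move/(gen_op_hfilt x); rewrite -[_ - _]addrC -scaleNr gen_op_lin scaleNr addrC.
Qed.

(** Moving the head through an initial segment, one exchange at a time. *)
Lemma hmono_bubble h x s t : exists c : bool,
  hmono h (x :: s ++ t) - (-1) ^+ c *: hmono h (s ++ x :: t)
  \in hfilt h (has killed (x :: s ++ t)) (deg (x :: s ++ t)).
Proof.
elim: s => [|y s [c IH]].
  by exists false; rewrite expr0 scale1r subrr rpred0.
have := hmono_swap h x y (s ++ t); have := hmono_cons_rel y IH.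
set a := par x.2 && par y.2 => H1 H2.
exists (a (+) c); rewrite signr_addb -scalerA.
rewrite -[X in X - _](subrK ((-1) ^+ a *: hmono h [:: y, x & s ++ t])) -addrA -scalerBr.
apply: rpredD => //; apply: rpredZ; move: H1.
apply: hfilt_mono; first by rewrite /= !deg_cons; lia.
by rewrite /=; case: (killed x); case: (killed y); rewrite ?orbT ?orbF.
Qed.

Lemma deg_perm s t : perm_eq s t -> deg s = deg t.
Proof. by move=> st; apply: perm_big. Qed.

Lemma hmono_perm h s t : perm_eq s t -> exists c : bool,
  hmono h s - (-1) ^+ c *: hmono h t \in hfilt h (has killed s) (deg s).
Proof.
elim: s t => [|x s IH] t.
  rewrite perm_sym => /perm_nilP ->; exists false.
  by rewrite expr0 scale1r subrr rpred0.
move=> st; have xt : x \in t by rewrite -(perm_mem st) mem_head.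
case/splitPr: xt st => t1 t2; rewrite -[x :: t2]cat1s perm_sym perm_catCA perm_cons perm_sym => st.
have [c1 H1] := IH _ st; have [c2 H2] := hmono_bubble h x t1 t2.
exists (c1 (+) c2); rewrite signr_addb -scalerA.
rewrite -[X in X - _](subrK ((-1) ^+ c1 *: hmono h (x :: t1 ++ t2))) -addrA -scalerBr.
apply: rpredD; first by have := hmono_cons_rel x H1; rewrite deg_cons /= orbC.
apply: rpredZ; move: H2; apply: hfilt_mono; first by rewrite !deg_cons (deg_perm st).
by rewrite /= (perm_has _ st).
Qed.

Hypothesis gen_odd : forall x, vpar true (gen_elt e x) -> par x.2.

Definition sorted_filt h b N : lsubspace V :=
  lspan [set hmono h s | s in [set s |
    [/\ pbw_index e s, (deg s < N)%N & b -> has killed s]]].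

Let gle x y := (x == y) || gen_lt x y.

Let gle_total : total gle.
Proof.
move=> [k al] [l be]; rewrite /gle /gen_lt /= !xpair_eqE.
by case: (ltgtP al be) => //= _; rewrite ?eqxx ?orbT //=; lia.
Qed.

Let pbw_or_square s : sorted gle s -> pbw_index e s \/
  exists p x q, s = p ++ [:: x, x & q] /\ par x.2.
Proof.
elim: s => [|x [|y s] IH]; [by left|by left|].
move=> /= /andP[xy /IH [H|[p [z [q [-> zo]]]]]]; last first.
  by right; exists (x :: p), z, q.
have [xo|xe] := boolP `[< vpar true (gen_elt e x) >]; last first.
  by left; rewrite /pbw_index /= -/(gle x y) xy (negPf xe).
have [lxy|nxy] := boolP (gen_lt x y).
  by left; rewrite /pbw_index /= lxy orbT implybT.
right; exists [::], x, s; move: xy; rewrite /gle (negPf nxy) orbF => /eqP <-.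
split=> //; apply: gen_odd; exact/asboolP.
Qed.

Lemma gen_ops_hfilt h p b N v : v \in hfilt h b N ->
  gen_ops h p v \in hfilt h (b || has killed p) (deg p + N).
Proof.
move=> vF; elim: p => [|x p IH] /=; first by rewrite orbF /deg big_nil add0n.
have := gen_op_hfilt x IH; rewrite deg_cons addnA; apply: hfilt_mono => //.
by rewrite -orbA; case: (killed x); case: (has killed p); rewrite ?orbT ?orbF.
Qed.

(** Twice the square of an odd factor is its commutator with itself. *)
Lemma hmono_square h p x q : par x.2 ->
  hmono h (p ++ [:: x, x & q]) \in
    hfilt h (has killed (p ++ [:: x, x & q])) (deg (p ++ [:: x, x & q])).
Proof.
move=> xo; have -> : hmono h (p ++ [:: x, x & q]) = gen_ops h p (hmono h [:: x, x & q]).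
  by rewrite /hmono foldr_cat.
have : hmono h [:: x, x & q] \in hfilt h (has killed [:: x, x & q]) (deg [:: x, x & q]).
  have := hmono_swap h x x q; rewrite xo expr1 scaleN1r opprK -mulr2n -scaler_nat.
  by move/(rpredZ (2%:R^-1)); rewrite scalerA mulVf ?pnatr_eq0// scale1r.
move/(gen_ops_hfilt p); rewrite deg_cat; apply: hfilt_mono => //.
by rewrite has_cat orbC.
Qed.

(** By induction on the degree: a monomial equals its ordered rearrangement up
    to sign and lower terms, and if the rearrangement is not allowed, because an
    odd factor is repeated, it is itself a lower term. *)
Lemma hfilt_sorted h N b v : v \in hfilt h b N -> v \in sorted_filt h b N.
Proof.
elim: N b v => [|N IH] b; apply: lspan_sub => _ [s [sN sb] <-]; first by [].
have IHs : forall v, v \in hfilt h (has killed s) (deg s) -> v \in sorted_filt h b N.+1.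
  move=> v vF; have : v \in sorted_filt h (has killed s) N.
    apply: IH; move: vF; exact: hfilt_mono.
  apply: lspan_mono => _ [t [tp tN tb] <-]; exists t => //; split=> //.
    exact: leqW.
  by move=> /sb /tb.
have st : perm_eq s (sort gle s) by rewrite perm_sym perm_sort.
have [c H] := hmono_perm h st.
rewrite -[hmono h s](subrK ((-1) ^+ c *: hmono h (sort gle s))).
apply: rpredD; first exact: IHs.
apply: rpredZ; have [P|[p [x [q [e1 xo]]]]] := pbw_or_square (sort_sorted gle_total s).
  apply: mem_lspan; exists (sort gle s) => //; split=> //.
    by rewrite -(deg_perm st).
  by move=> /sb; rewrite (perm_has _ st).
apply: IHs; rewrite (deg_perm st) (perm_has _ st) e1; exact: hmono_square.
Qed.

End Filtration.

(** * Degrees and bidegrees of the free generators *)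

Section UnitCircle.
Context {R : realType}.
Implicit Types s t : R.

Lemma cexp2piD s t : cexp2pi (s + t) = cexp2pi s * cexp2pi t.
Proof.
by rewrite /cexp2pi mulrDr cosD sinD; apply/eqP; rewrite eq_complex /= addrC eqxx /=
  [X in _ == X]addrC mulrC [X in X + _]mulrC eqxx.
Qed.

Lemma cexp2pi0 : cexp2pi (0 : R) = 1.
Proof. by rewrite /cexp2pi mulr0 cos0 sin0. Qed.

Lemma cexp2pi_nat (k : nat) : cexp2pi (k%:R : R) = 1.
Proof.
elim: k => [|k IH]; first exact: cexp2pi0.
rewrite -natr1 cexp2piD IH mul1r /cexp2pi mulr1 mulr_natl.
by rewrite cos2pi sin2pi.
Qed.

Lemma cexp2pi_int t : t \is a Num.int -> cexp2pi t = 1.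
Proof.
move=> /intrP[[k|k] ->]; first by rewrite -pmulrn cexp2pi_nat.
rewrite NegzE rmorphN /= -pmulrn; have := cexp2piD (- k.+1%:R) (k.+1%:R).
by rewrite addNr cexp2pi0 cexp2pi_nat mulr1.
Qed.

(** The eigenvalue of g determines gamma modulo 1, hence epsilon in ]-1, 0]. *)
Lemma cexp2pi_near s t : cexp2pi s = cexp2pi t -> -1 < s - t < 1 -> s = t.
Proof.
move=> [ce se] /andP[l u].
have cy : cos (pi * (s - t) *+ 2) = 1.
  rewrite -mulr_natl mulrA mulrBr cosD cosN sinN ce se mulrN opprK.
  by rewrite -!expr2 cos2Dsin2.
have s0 : sin (pi * (s - t)) = 0.
  have := cos2Dsin2 (pi * (s - t)); move: cy; rewrite cos_mulr2n => cy e.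
  have : sin (pi * (s - t)) ^+ 2 = 0 by lra.
  by move/eqP; rewrite sqrf_eq0 => /eqP.
have p0 : 0 < pi :> R := pi_gt0 R.
apply/eqP; rewrite -subr_eq0; case: (ltgtP (s - t) 0) => // H.
- have : 0 < sin (pi * (t - s)).
    apply: sin_gt0_pi; rewrite pmulr_rgt0// gtr_pMr//; apply/andP; split; lra.
  by rewrite -[t - s]opprB mulrN sinN s0 oppr0 ltxx.
- have : 0 < sin (pi * (s - t)).
    apply: sin_gt0_pi; rewrite pmulr_rgt0// gtr_pMr//; apply/andP; split; lra.
  by rewrite s0 ltxx.
Qed.

Lemma cexp2pi_surj (c : R[i]) : `|c| = 1 -> exists t, c = cexp2pi t.
Proof.
case: c => x y; rewrite normc_def /= => -[e].
have p0 : 0 < pi :> R := pi_gt0 R.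
have {e} xy : x ^+ 2 + y ^+ 2 = 1.
  by rewrite -(sqr_sqrtr (addr_ge0 (sqr_ge0 x) (sqr_ge0 y))) e expr1n.
have x1 : -1 <= x <= 1.
  rewrite -ler_norml -(@expr_le1 _ 2)// real_normK ?num_real//.
  by have := sqr_ge0 y; lra.
have pk (z : R) : 2 * pi * (z / (2 * pi)) = z.
  by rewrite mulrC divfK// mulf_neq0 ?pnatr_eq0// lt0r_neq0.
have sa : sin (acos x) = `|y|.
  by rewrite sin_acos// -sqrtr_sqr; congr Num.sqrt; lra.
have ca : cos (acos x) = x by rewrite acosK// in_itv.
have [y0|y0] := lerP 0 y.
  by exists (acos x / (2 * pi)); rewrite /cexp2pi pk ca sa ger0_norm.
exists (- (acos x / (2 * pi))); rewrite /cexp2pi mulrN pk cosN sinN ca sa.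
by rewrite ltr0_norm// opprK.
Qed.
End UnitCircle.

Section Discrete.
Context {R : realType} (G : set R).
Hypothesis HG : discrete_subgroup G.

Let G0 : G 0. Proof. by have [] := HG. Qed.
Let GB x y : G x -> G y -> G (x - y). Proof. by have [_ + _] := HG; apply. Qed.
Let GN x : G x -> G (- x). Proof. by rewrite -(sub0r x); apply: GB. Qed.
Let GD x y : G x -> G y -> G (x + y).
Proof. by move=> Gx Gy; rewrite -[y]opprK; apply: GB => //; exact: GN. Qed.
Let GM (k : nat) x : G x -> G (k%:R * x).
Proof.
move=> Gx; elim: k => [|k IH]; first by rewrite mul0r.
by rewrite -natr1 mulrDl mul1r; exact: GD.
Qed.

Let gap : exists2 r : R, 0 < r & forall x, G x -> 0 < x -> r <= x.
Proof.
have [_ _ /(_ 0 G0) [_ [U /nbhs_ballP[r /= r0 rU] UG]]] := HG.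
exists r => // x Gx x0; rewrite leNgt; apply/negP => xr.
have : (U `&` G) x.
  by split=> //; apply: rU; rewrite /ball /= sub0r normrN gtr0_norm.
by rewrite UG /= => e; rewrite e ltxx in x0.
Qed.

(** A discrete subgroup of the line is generated by its least positive element;
    this element exists since halving a positive element repeatedly, by taking
    y or z - y for some 0 < y < z, must stop before the gap at 0. *)
Lemma discrete_generator z0 : gpos G z0 ->
  exists2 r, gpos G r & forall z, gpos G z -> exists2 k : nat, (0 < k)%N & z = k%:R * r.
Proof.
have [r r0 rmin] := gap.
have small n z : gpos G z -> z < 2 ^+ n * r ->
    exists2 m, gpos G m & forall y, gpos G y -> m <= y.
  elim: n z => [|n IH] z [Gz z0'] zr.
    by move: zr; rewrite expr0 mul1r ltNge rmin.
  have [H|H] := pselect (forall y, gpos G y -> z <= y); first by exists z.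
  have [y [Gy y0] yz] : exists2 y, gpos G y & y < z.
    apply: contrapT => H'; apply: H => y gy; rewrite leNgt; apply/negP => yz.
    by apply: H'; exists y.
  have [h|h] := lerP (y *+ 2) z.
    by apply: (IH y) => //; move: zr h; rewrite exprS; lra.
  apply: (IH (z - y)); first by split; [exact: GB|rewrite subr_gt0].
  by move: zr h; rewrite exprS; lra.
move=> gz0; have [n nz] : exists n : nat, z0 < 2 ^+ n * r.
  exists (Num.truncn (z0 / r)).+1; rewrite -ltr_pdivrMr//.
  have := truncnS_gt (z0 / r) => /lt_le_trans; apply.
  by rewrite -natrX ler_nat ltnW // ltn_expl.
have [m [Gm m0] mmin] := small n z0 gz0 nz; exists m => // z [Gz z0'].
pose k := Num.truncn (z / m); have zm0 : 0 <= z / m by rewrite divr_ge0 ?ltW.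
have /andP[kl ku] : k%:R <= z / m < k.+1%:R by rewrite truncn_itv.
have ez : z = k%:R * m.
  apply/eqP; rewrite -subr_eq0; apply/contraT => nz0.
  have l0 : 0 <= z - k%:R * m by rewrite subr_ge0 -ler_pdivlMr.
  have gp : gpos G (z - k%:R * m).
    by split; [apply: GB => //; exact: GM|rewrite lt0r nz0].
  have := mmin _ gp; rewrite leNgt; move: ku; rewrite ltr_pdivrMr// -natr1 mulrDl mul1r => ku.
  by rewrite ltrBlDl ku.
exists k => //; rewrite lt0n; apply/eqP => k0.
by move: z0'; rewrite ez k0 mul0r ltxx.
Qed.

Lemma gpred_generator r (k : nat) : gpos G r ->
  (forall z, gpos G z -> exists2 k : nat, (0 < k)%N & z = k%:R * r) ->
  gpred G (k.+1%:R * r) = k%:R * r.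
Proof.
move=> [Gr r0] Hr; rewrite /gpred; case: xgetP => [x _ |]; last first.
  move/(_ (k%:R * r)) => []; split.
    by split; [exact: GM|rewrite mulr_ge0// ltW|rewrite ltr_pM2r// ltr_nat].
  move=> y [Gy y0 yk]; have [->|yn0] := eqVneq y 0; first by rewrite mulr_ge0// ltW.
  have [|j j0 ey] := Hr y; first by split=> //; rewrite lt0r yn0.
  by move: yk; rewrite ey ltr_pM2r// ltr_nat ltnS ler_pM2r// ler_nat.
move=> [[Gx x0 xk] xmax]; apply/eqP; rewrite eq_le; apply/andP; split; last first.
  by apply: xmax; split; [exact: GM|rewrite mulr_ge0// ltW|rewrite ltr_pM2r// ltr_nat].
have [->|xn0] := eqVneq x 0; first by rewrite mulr_ge0// ltW.
have [|j j0 ex] := Hr x; first by split=> //; rewrite lt0r xn0.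
by move: xk; rewrite ex ltr_pM2r// ltr_nat ltnS ler_pM2r// ler_nat.
Qed.

End Discrete.

Section PregradedDegrees.
Context {R : realType} {V : vertexSuperalgebra R}.
Local Notation K := R[i].
Context {disp : Order.disp_t} {I : orderType disp} (e : I -> V).

Lemma mono1 al : mono e [:: (0%N, al)] = e al.
Proof. by rewrite mono_cons subr0 (vac_right _).1. Qed.

Lemma mono_neq0 s : freely_generated e -> pbw_index e s -> mono e s != 0.
Proof.
move=> [_ free] ps; apply/eqP => s0.
have ps1 s' : s' \in [:: s] -> pbw_index e s' by rewrite inE => /eqP ->.
have sum0 : \sum_(s' <- [:: s]) (1 : K) *: mono e s' = 0.
  by rewrite big_seq1 scale1r.
have := free [:: s] (fun=> 1) isT ps1 sum0 s (mem_head _ _).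
by move/eqP; rewrite oner_eq0.
Qed.

Lemma gen_neq0 al : freely_generated e -> e al != 0.
Proof. by move=> free; rewrite -mono1; exact: mono_neq0. Qed.

Lemma gen_elt_neq0 x : freely_generated e -> gen_elt e x != 0.
Proof.
move=> free; have -> : gen_elt e x = mono e [:: x].
  by rewrite /mono /= (vac_right _).1.
exact: mono_neq0.
Qed.

(** Expanding each factor in the generators turns the spanning products of the
    filtration into monomials of bounded integral degree. *)
Lemma filtration_sub (G : set R) (zeta : I -> R) (gdeg : I -> nat) (r : R) N :
  0 < r -> (forall i, zeta i = (gdeg i)%:R * r) ->
  (forall z, gpos G z -> exists2 k : nat, (0 < k)%N & z = k%:R * r) ->
  forall v, v \in gen_filtration e G zeta (N%:R * r) ->
  v \in lspan [set mono e t | t in [set t | (deg gdeg t < N.+1)%N]].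
Proof.
move=> r0 zE zG; apply: lspan_sub => _ [s [sG sN ->]].
suff [k ek kM] : exists2 k : nat, \sum_(x <- s) x.1.2 = k%:R * r &
    nop [seq iter x.1.1 (vD V) x.2 | x <- s] \in
      lspan [set mono e t | t in [set t | deg gdeg t = k]].
  apply: lspan_mono kM => _ [t tk <-]; exists t => //=.
  by move: sN; rewrite ek tk ltnS ler_pM2r// ler_nat.
elim: s sG {sN} => [|[[k z] u] s IH] sG.
  exists 0%N; first by rewrite big_nil mul0r.
  by apply: mem_lspan; exists [::] => //=; rewrite /deg big_nil.
have [|k' ek' vM] := IH; first by move=> x xs; apply: sG; rewrite inE xs orbT.
have [/zG[j _ zj] uz] := sG (k, z, u) (mem_head _ _); rewrite /= in zj uz.
exists (j + k')%N; first by rewrite big_cons ek' /= zj natrD mulrDl.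
rewrite -[nop _]/(nprod (iter k (vD V) u) (-1) (nop [seq iter x.1.1 (vD V) x.2 | x <- s])).
move: u uz {sG}; apply: lspan_ind.
- by rewrite (_ : iter k (vD V) 0 = 0) ?nprod0l ?rpred0//; elim: k => //= k ->; rewrite raddf0.
- move=> c a b Ha Hb; have -> : iter k (vD V) (c *: a + b) = c *: iter k (vD V) a + iter k (vD V) b.
    by elim: k {Ha Hb} => //= k ->; rewrite linearP.
  by rewrite nprodDl nprodZl rpredD ?rpredZ.
move=> _ [i iz <-]; move: (nop _) vM; apply: lspan_ind.
- by rewrite nprod0r rpred0.
- by move=> c a b Ha Hb; rewrite nprodDr nprodZr rpredD ?rpredZ.
move=> _ [t tk <-].
have -> : iter k (vD V) (e i) = (k`!)%:R *: gen_elt e (k, i).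
  by rewrite /gen_elt scalerA mulfV ?scale1r// pnatr_eq0 -lt0n fact_gt0.
rewrite nprodZl; apply/rpredZ/mem_lspan; exists ((k, i) :: t) => //=.
rewrite deg_cons tk /=; congr (_ + _)%N.
have : (gdeg i)%:R * r = j%:R * r by rewrite -zE iz zj.
by move/(mulIf (lt0r_neq0 r0))/eqP; rewrite eqr_nat => /eqP.
Qed.

(** Dividing by the generator of Gamma makes the pregrading integral; the
    predecessor of the sum of two degrees then becomes a strict bound. *)
Lemma pregraded_degrees (G : set R) : discrete_subgroup G -> pregraded e G ->
  exists gdeg : I -> nat, (forall al, (0 < gdeg al)%N) /\
    forall al be (j : nat), nprod (e al) j%:Z (e be) \in
      lspan [set mono e t | t in [set t | (deg gdeg t < gdeg al + gdeg be)%N]].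
Proof.
move=> dG [zeta [zG pre]].
have [[z0 z0G]|noz] := pselect (exists z, gpos G z); last first.
  by exists (fun=> 1%N); split=> // al; exfalso; apply: noz; exists (zeta al).
have [r rG rgen] := discrete_generator dG z0G.
have r0 : 0 < r by case: rG.
have /choice[gdeg dgP] : forall al, exists k : nat, (0 < k)%N /\ zeta al = k%:R * r.
  by move=> al; have [k k0 ek] := rgen _ (zG al); exists k.
exists gdeg; split=> [al|al be j]; first by case: (dgP al).
have mem i : e i \in gen_span e zeta (zeta i) by apply: mem_lspan; exists i.
have := pre _ _ (zG al) (zG be) _ _ (mem al) (mem be) j.
have [da0 ea] := dgP al; have [db0 eb] := dgP be.
rewrite ea eb -mulrDl -natrD -(prednK (n := (gdeg al + gdeg be)%N)) ?addn_gt0 ?da0//.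
rewrite (gpred_generator dG) //.
move=> /(filtration_sub r0 (fun i => (dgP i).2) rgen) /(rpredZ (j`!%:R)).
by rewrite /lambda_coef scalerA mulfV ?scale1r// pnatr_eq0 -lt0n fact_gt0.
Qed.

End PregradedDegrees.

Section Homogeneous.
Context {R : realType} {V : vertexSuperalgebra R} (H g : {linear V -> V}).
Local Notation K := R[i].
Hypothesis H_ham : hamiltonian H.
Hypothesis g_aut : vsa_automorphism g.
Implicit Types (a b v : V) (i j : R * R) (n : int).

Lemma ghomP i a : ghom H g i a <->
  [/\ H a = i.1%:C%C *: a, -1 < i.2 <= 0 & g a = cexp2pi (i.2 + i.1) *: a].
Proof.
split=> [[Ha ri [t [ga ti]]]|[Ha ri ga]]; last first.
  by split=> //; exists (i.2 + i.1); rewrite subrr rpred0.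
split=> //; rewrite ga; congr (_ *: _).
by rewrite -[i.2 + i.1](subrK t) cexp2piD (cexp2pi_int ti) mul1r.
Qed.

Lemma ghom_lin i k a b : ghom H g i a -> ghom H g i b -> ghom H g i (k *: a + b).
Proof.
move=> /ghomP[Ha ri ga] /ghomP[Hb _ gb]; apply/ghomP; split=> //.
- by rewrite linearP Ha Hb scalerDr !scalerA mulrC.
- by rewrite linearP ga gb scalerDr !scalerA mulrC.
Qed.

Lemma ghom0 i : -1 < i.2 <= 0 -> ghom H g i 0.
Proof. by move=> ri; apply/ghomP; rewrite !raddf0. Qed.

Lemma H_vac : H (vac V) = 0.
Proof.
have := H_ham.2 (vac V) (-1) (vac V).
rewrite !vac_left !eqxx /= rmorphN1 opprK !subrr scale0r add0r.
by rewrite (vac_right _).1 => <-.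
Qed.

Lemma ghom_vac : ghom H g (0, 0) (vac V).
Proof.
have [_ gv _ _] := g_aut; apply/ghomP => /=.
by rewrite H_vac gv rmorph0 scale0r ltrN10 lexx addr0 cexp2pi0 scale1r.
Qed.

(** Weights and eigenvalues of g multiply as usual; chi is the integer by which
    epsilon_a + epsilon_b has to be corrected. *)
Lemma ghom_nprod i j n a b : ghom H g i a -> ghom H g j b ->
  ghom H g (idx_prod i j n) (nprod a n b).
Proof.
move=> /ghomP[Ha ri ga] /ghomP[Hb rj gb]; apply/ghomP; split.
- have := H_ham.2 a n b; rewrite Ha Hb nprodZl nprodZr => /(canRL (subrK _)) ->.
  rewrite -!scalerDl; congr (_ *: _); rewrite /idx_prod /=.
  by rewrite !rmorphB !rmorphD /= rmorph1 rmorph_int; ring.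
- exact: chi_b_range.
- have [_ _ -> _] := g_aut; rewrite ga gb nprodZl nprodZr scalerA -cexp2piD.
  congr (_ *: _); rewrite -[LHS]mulr1 -(@cexp2pi_int _ ((chi_b i.2 j.2)%:R - n%:~R - 1)).
    by rewrite -cexp2piD /idx_prod /=; congr cexp2pi; ring.
  by rewrite !rpredB ?rpred_nat ?intr_int ?rpred1.
Qed.

Lemma gen_homogeneous (disp : Order.disp_t) (I : orderType disp) (e : I -> V) :
  (forall c : K, eigenvalue_of H c -> c \is Num.real) ->
  (forall c : K, eigenvalue_of g c -> `|c| = 1) ->
  homogeneous_generators e H g -> (forall al, e al != 0) ->
  exists wt ep : I -> R, forall al, ghom H g (wt al, ep al) (e al).
Proof.
move=> Hreal gunit hom enz.
suff /choice[f fP] : forall al, exists i, ghom H g i (e al).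
  by exists (fun al => (f al).1), (fun al => (f al).2) => al; rewrite -surjective_pairing.
move=> al; have [[cg eg] [cH eH] _] := hom al.
have /RRe_real cHr : cH \is Num.real by apply: Hreal; exists (e al).
have [t et] : exists t, cg = cexp2pi t by apply/cexp2pi_surj/gunit; exists (e al).
pose x := t - complex.Re cH.
exists (complex.Re cH, x - (Num.ceil x)%:~R); split => /=.
- by rewrite cHr.
- by have := ceil_itv x; rewrite rmorphB /= => /andP[h1 h2]; apply/andP; split; lra.
- exists t; rewrite -et; split=> //.
  rewrite (_ : _ - t = - (Num.ceil x)%:~R); first by rewrite rpredN intr_int.
  by rewrite /x; ring.
Qed.

End Homogeneous.

(** * Coordinates in the basis of monomials *)

Section Main.
Context {R : realType} {V : vertexSuperalgebra R} (H g : {linear V -> V}).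
Local Notation K := R[i].
Context {disp : Order.disp_t} {I : orderType disp} (e : I -> V).
Variables (par : I -> bool) (wt ep : I -> R) (gdeg : I -> nat).
Hypothesis H_ham : hamiltonian H.
Hypothesis g_aut : vsa_automorphism g.
Hypothesis e_free : freely_generated e.
Hypothesis e_par : forall al, vpar (par al) (e al).
Hypothesis e_ghom : forall al, ghom H g (gen_idx wt ep al) (e al).
Hypothesis gdeg_gt0 : forall al, (0 < gdeg al)%N.
Hypothesis pregr0 : forall al be (j : nat), nprod (e al) j%:Z (e be) \in
  lspan [set mono e t | t in [set t | (deg gdeg t < gdeg al + gdeg be)%N]].

Local Notation mono := (mono e).
Local Notation mono_idx := (mono_idx wt ep).
Local Notation mono_parity := (mono_parity par).
Local Notation cd := (basis_coord e_free).
Local Notation restr := (restr e_free).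
Local Notation ghom := (ghom H g).
Local Notation hmode h i := (smode (bseries h (idx_gamma i))).
Local Notation VgH := (V_gH H g).
Local Notation CgH := (C_gH H g).
Local Notation JgH := (J_gH H g).
Implicit Types (a b u v w : V) (i j : R * R) (n m : int) (s t : seq (nat * I)).

Lemma ep_range al : -1 < ep al <= 0.
Proof. by have [] := e_ghom al. Qed.

Lemma mono_ghom s : ghom (mono_idx s) (mono s).
Proof.
elim: s => [|x s IH]; first exact: ghom_vac.
by rewrite mono_cons; apply: ghom_nprod.
Qed.

Lemma H_coord v s : cd (H v) s = (mono_idx s).1%:C%C * cd v s.
Proof.
apply: (bcoord_diag e_free (f := H) (l := fun s => (mono_idx s).1%:C%C)) => t _.
by have /ghomP[] := mono_ghom t.
Qed.

Lemma ghom_coord i v s : ghom i v -> cd v s != 0 -> mono_idx s = i.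
Proof.
move=> /ghomP[Hv ri gv] c0.
have gs t : pbw_index e t -> g (mono t) = cexp2pi ((mono_idx t).2 + (mono_idx t).1) *: mono t.
  by move=> _; have /ghomP[] := mono_ghom t.
have := H_coord v s; have := bcoord_diag e_free gs v s.
rewrite Hv gv !bcoordZ => /(mulIf c0) ge /(mulIf c0) [De].
rewrite [LHS]surjective_pairing [RHS]surjective_pairing De; congr pair.
move: ge; rewrite De => /cexp2pi_near ge; apply/esym/(addIr (mono_idx s).1)/ge.
have /andP[l1 u1] := ri; have /andP[l2 u2] := mono_idx_range wt ep_range s.
by apply/andP; split; lra.
Qed.

Lemma coord_span_ind (P : V -> Prop) v : P 0 ->
  (forall (k : K) u w, P u -> P w -> P (k *: u + w)) ->
  (forall s, pbw_index e s -> cd v s != 0 -> P (mono s)) -> P v.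
Proof.
move=> P0 PL PM; apply: (lspan_ind P0 PL) (lspan_coord e_free v).
by move=> _ [s [ps c0] <-]; exact: PM.
Qed.

Lemma ghom_of_coord i v : -1 < i.2 <= 0 ->
  (forall s, cd v s != 0 -> mono_idx s = i) -> ghom i v.
Proof.
move=> ri vi; apply: coord_span_ind.
- exact: ghom0.
- by move=> k u w; exact: ghom_lin.
- by move=> s _ /vi <-; exact: mono_ghom.
Qed.

Lemma vpar_of_coord (b : bool) v : (forall s, cd v s != 0 -> mono_parity s = b) -> vpar b v.
Proof.
move=> vb; apply: coord_span_ind.
- exact: vpar0.
- by move=> k u w; exact: vparL.
- by move=> s _ /vb <-; exact: mono_parP.
Qed.

(** Parity is read off the basis, whose members are homogeneous for H, g and the
    parity at once; so the bidegree components of a vector of pure parity have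
    the same parity. *)
Lemma vpar_coord (b : bool) v s : vpar b v -> cd v s != 0 -> mono_parity s = b.
Proof.
move=> vb c0; pose w := restr (fun s => mono_parity s != b) v.
have wb : vpar (~~ b) w.
  apply: vpar_of_coord => t; rewrite bcoord_restr.
  by case: (mono_parity t); case: b {vb w}; rewrite //= eqxx.
have wb' : vpar b w.
  have -> : w = (-1) *: (v - w) + v by rewrite scaleN1r opprB subrK.
  apply: vparL => //; apply: vpar_of_coord => t.
  by have [//|tb] := eqVneq (mono_parity t) b; rewrite bcoordB bcoord_restr tb subrr eqxx.
have w0 : w = 0 by case: (b) wb wb' => *; apply: vpar_disj.
have : cd w s = 0 by rewrite w0 bcoord0.
have [//|sb] := eqVneq (mono_parity s) b.
by rewrite bcoord_restr sb => c0'; rewrite c0' eqxx in c0.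
Qed.

Lemma gen_odd x : vpar true (gen_elt e x) -> par x.2.
Proof.
move=> xo; have := gen_elt_par e_par x; case: (par x.2) => // xe.
by have := gen_elt_neq0 x e_free; rewrite (vpar_disj xe xo) eqxx.
Qed.

(** The projection onto one bidegree maps each monomial, ordered or not, to
    itself or to 0. *)
Lemma ghom_proj i v N : ghom i v ->
  v \in lspan [set mono t | t in [set t | (deg gdeg t < N)%N]] ->
  v \in mono_filt e wt ep gdeg N i.
Proof.
move=> hv vN; have <- : restr (fun s => mono_idx s == i) v = v.
  by apply: restr_id => s /(ghom_coord hv) ->.
move: v vN {hv}; apply: lspan_ind.
- by rewrite restr_eq0 ?rpred0// => s; rewrite bcoord0 eqxx.
- by move=> k u w hu hw; rewrite restr_lin rpredD ?rpredZ.
move=> _ [t tN <-]; have [ti|ti] := eqVneq (mono_idx t) i.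
  rewrite restr_id; last by move=> s /(ghom_coord (mono_ghom t)) ->; rewrite ti.
  by apply: mem_lspan; exists t.
by rewrite restr_eq0 ?rpred0// => s /(ghom_coord (mono_ghom t)) ->.
Qed.

Lemma pregr al be (k : nat) : nprod (e al) k%:Z (e be) \in
  mono_filt e wt ep gdeg (gdeg al + gdeg be) (idx_prod (gen_idx wt ep al) (gen_idx wt ep be) k%:Z).
Proof. by apply: ghom_proj => //; apply: ghom_nprod. Qed.

Lemma mono_filt_proj al s (k : nat) N :
  nprod (e al) k%:Z (mono s) \in lspan [set mono t | t in [set t | (deg gdeg t < N)%N]] ->
  nprod (e al) k%:Z (mono s) \in
    mono_filt e wt ep gdeg N (idx_prod (gen_idx wt ep al) (mono_idx s) k%:Z).
Proof. by apply: ghom_proj; apply: ghom_nprod => //; exact: mono_ghom. Qed.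

Lemma VgHP v : v \in VgH <-> forall s, cd v s != 0 -> (mono_idx s).2 = 0.
Proof.
split; last first.
  move=> vV; apply: (@coord_span_ind (fun v => v \in VgH)) => [||s _ /vV s0].
  - exact: rpred0.
  - by move=> k u w hu hw; rewrite rpredD ?rpredZ.
  - by apply: mem_lspan; exists (mono_idx s).1; rewrite -s0 -surjective_pairing; exact: mono_ghom.
move: v; apply: lspan_ind.
- by move=> s; rewrite bcoord0 eqxx.
- move=> k u w hu hw s; rewrite bcoord_lin => c0.
  have [cu|/hu//] := eqVneq (cd u s) 0.
  by apply: hw; apply: contra c0 => /eqP ->; rewrite cu mulr0 addr0.
- by move=> v [D hv] s /(ghom_coord hv) ->.
Qed.

Lemma weight_spanP (Q : R -> Prop) v :
  v \in lspan [set a | a \in VgH /\ exists D : R, Q D /\ H a = D%:C%C *: a] <->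
  v \in VgH /\ forall s, cd v s != 0 -> Q (mono_idx s).1.
Proof.
set S := lspan _; split; last first.
  move=> [/VgHP vV vp]; apply: (@coord_span_ind (fun v => v \in S)) => [||s ps c0].
  - exact: rpred0.
  - by move=> k u w hu hw; rewrite rpredD ?rpredZ.
  - apply: mem_lspan; split.
      apply: mem_lspan; exists (mono_idx s).1; rewrite -(vV _ c0) -surjective_pairing.
      exact: mono_ghom.
    by exists (mono_idx s).1; split; [exact: vp|have /ghomP[] := mono_ghom s].
move: v; apply: lspan_ind.
- by split; [exact: rpred0|move=> s; rewrite bcoord0 eqxx].
- move=> k u w [uV hu] [wV hw]; split; first by rewrite rpredD ?rpredZ.
  move=> s; rewrite bcoord_lin => c0.
  have [cu|/hu//] := eqVneq (cd u s) 0.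
  by apply: hw; apply: contra c0 => /eqP ->; rewrite cu mulr0 addr0.
- move=> v [vV [D [Dp Hv]]]; split=> // s c0.
  by have := H_coord v s; rewrite Hv bcoordZ => /(mulIf c0) [<-].
Qed.

Lemma FVP p v : v \in FV H g p <-> v \in VgH /\ forall s, cd v s != 0 -> (mono_idx s).1 <= p.
Proof. exact: weight_spanP. Qed.

Lemma FVltP p v : v \in FVlt H g p <-> v \in VgH /\ forall s, cd v s != 0 -> (mono_idx s).1 < p.
Proof. exact: weight_spanP. Qed.

Lemma ghom_compE i a : -1 < i.2 <= 0 ->
  ghom_comp H g i a = restr (fun s => mono_idx s == i) a.
Proof.
move=> ri; rewrite /ghom_comp; set a' := restr _ _.
have ha' : ghom i a'.
  apply: ghom_of_coord => // s; rewrite bcoord_restr.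
  by case: ifPn => [/eqP//|_]; rewrite eqxx.
have out u : u \in lspan (\bigcup_(j in [set j | j <> i]) ghom j) ->
    forall s, mono_idx s = i -> cd u s = 0.
  move: u; apply: lspan_ind.
  - by move=> s _; rewrite bcoord0.
  - by move=> k u w hu hw s si; rewrite bcoord_lin hu// hw// mulr0 addr0.
  - move=> u [j ji hu] s si; apply/eqP; apply: contraT => c0; exfalso.
    by apply: ji; rewrite -(ghom_coord hu c0).
case: xgetP => [a'' _ [ha'' /out oa'']|/(_ a') []]; last first.
  split=> //; apply: (@coord_span_ind (fun v => v \in _)) => [||s _].
  - exact: rpred0.
  - by move=> k u w hu hw; rewrite rpredD ?rpredZ.
  - rewrite bcoordB bcoord_restr; case: ifPn => [_|/eqP si _]; first by rewrite subrr eqxx.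
    by apply: mem_lspan; exists (mono_idx s) => //; exact: mono_ghom.
apply: (bcoord_inj (basis := e_free)) => s; rewrite bcoord_restr; case: ifPn => /eqP si.
  by have := oa'' s si; rewrite bcoordB => /eqP; rewrite subr_eq0 eq_sym => /eqP.
by apply/eqP; apply: contraT => c0; exfalso; apply: si; exact: ghom_coord c0.
Qed.

(** * Star products and conformal weights *)

Lemma ghom_comp_out i a : ~~ (-1 < i.2 <= 0) -> ghom_comp H g i a = 0.
Proof.
move=> ri; rewrite /ghom_comp; case: xgetP => // a' _ [[_ ri'] _].
by rewrite ri' in ri.
Qed.

(** The bilinear extension by homogeneous components is the extension by
    linearity from the basis. *)
Lemma ghom_fsum (f : R * R -> V -> V) a : (forall i, linear (f i)) ->
  \sum_(i \in [set: R * R]) f i (ghom_comp H g i a) =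
  lin_ext e_free (fun s => f (mono_idx s) (mono s)) a.
Proof.
move=> fl; have f0 i : f i 0 = 0 := linear_fun0 (fl i).
pose L := undup [seq mono_idx s | s <- csupp e_free a].
have compE i : ghom_comp H g i a = restr (fun s => mono_idx s == i) a.
  have [ri|ri] := boolP (-1 < i.2 <= 0); first exact: ghom_compE.
  rewrite ghom_comp_out// restr_eq0// => s _.
  by apply: contra ri => /eqP <-; exact: (mono_idx_range wt ep_range).
under eq_fsbigr do rewrite compE.
rewrite -(fsbig_widen [set` L]) //; last first.
  move=> i /= [_ iL]; rewrite restr_eq0 ?f0// => s c0; apply/negP => /eqP si; apply: iL.
  rewrite mem_undup -si map_f//; have [_ _ cv _] := csupp_spec e_free a.
  by apply: contraR c0 => /cv ->.
rewrite -fsbig_seq ?undup_uniq//= /lin_ext.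
have fsum i (r : seq (seq (nat * I))) (Q : pred (seq (nat * I))) (c : seq (nat * I) -> K) :
    f i (\sum_(s <- r | Q s) c s *: mono s) = \sum_(s <- r | Q s) c s *: f i (mono s).
  elim: r => [|s r IH]; first by rewrite !big_nil.
  by rewrite !big_cons; case: ifP => // _; rewrite fl IH.
under eq_bigr do rewrite fsum.
rewrite (exchange_big_dep xpredT)//= big_seq [RHS]big_seq; apply: eq_bigr => s sa.
rewrite big_mkcond (bigD1_seq (mono_idx s)) ?undup_uniq ?mem_undup ?map_f//= eqxx.
by rewrite big1 ?addr0// => i; rewrite eq_sym => /negPf ->.
Qed.

Lemma gbinom_idx_gamma i k : (gbinom (i.1 + i.2) k)%:C%C = bseries 1 (idx_gamma i) k.
Proof. by rewrite /bseries expr1n mul1r /idx_gamma -gbinom_rmorph. Qed.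

Lemma starE n a b : star H g n a b =
  lin_ext e_free (fun s => hmode 1 (mono_idx s) (mono s) n b) a.
Proof.
rewrite -(ghom_fsum (f := fun i c => hmode 1 i c n b)).
  by apply: eq_fsbigr => i _; apply: eq_fsbigr => k _; rewrite gbinom_idx_gamma.
by move=> i; exact: smode_linl.
Qed.

Lemma star_brE a b : star_br H g a b =
  lin_ext e_free (fun s => smode (bseries 1 (idx_gamma (mono_idx s) - 1)) (mono s) 0 b) a.
Proof.
rewrite -(ghom_fsum (f := fun i c => smode (bseries 1 (idx_gamma i - 1)) c 0 b)).
  apply: eq_fsbigr => i _; apply: eq_fsbigr => k _; rewrite add0r.
  by rewrite /bseries expr1n mul1r /idx_gamma -(rmorph1 (real_complex R)) -rmorphB -gbinom_rmorph.
by move=> i; exact: smode_linl.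
Qed.

Lemma star_ghom i n a b : ghom i a -> star H g n a b = hmode 1 i a n b.
Proof.
move=> ha; rewrite starE.
rewrite (eq_lin_ext (f' := fun s => hmode 1 i (mono s) n b)).
  exact: (lin_ext_id _ (smode_linl (bseries 1 (idx_gamma i)) n b)).
by move=> s /(ghom_coord ha) ->.
Qed.

(** Raising the index of a mode lowers the conformal weight of the result. *)
Lemma smode_low h c i j n a b : ghom i a -> ghom j b ->
  smode (bseries h c) a n b - nprod a n b \in coord_space e_free
    (fun s => ((mono_idx s).2 == (idx_prod i j n).2) && ((mono_idx s).1 < (idx_prod i j n).1)).
Proof.
move=> ha hb; have [N PN] := nprod_bound a n b.
rewrite /smode (@tsum_first _ _ N) => [|k /PN ->]; last by rewrite scaler0.
rewrite bseries0 scale1r addr0 addrC addKr; apply: tsum_in => k; apply: rpredZ.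
apply/coord_spaceP => s /(ghom_coord (ghom_nprod H_ham g_aut _ ha hb)) ->.
rewrite /idx_prod /= eqxx /= ltrD2r ltrD2l ltrN2 ltr_int; lia.
Qed.

Lemma gen_op_low x (r : R) v : v \in coord_space e_free (fun s => (mono_idx s).1 < r) ->
  gen_op e wt ep 1 x v \in coord_space e_free (fun s => (mono_idx s).1 < wt x.2 + r + x.1%:R).
Proof.
move=> /coord_spaceP vr.
apply: (@coord_span_ind (fun v => gen_op e wt ep 1 x v \in _)) => [||s _ /vr sr].
- by rewrite /gen_op raddf0 rpred0.
- by move=> k u w hu hw; rewrite gen_op_lin rpredD ?rpredZ.
rewrite /gen_op -[smode _ _ _ _](subrK (nprod (e x.2) (-1 - x.1%:Z) (mono s))).
have low : (idx_prod (gen_idx wt ep x.2) (mono_idx s) (-1 - x.1%:Z)).1 < wt x.2 + r + x.1%:R.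
  rewrite /idx_prod /= rmorphB rmorphN1 /= -pmulrn; lra.
apply: rpredD.
  have := smode_low 1 (idx_gamma (gen_idx wt ep x.2)) (-1 - x.1%:Z) (e_ghom x.2) (mono_ghom s).
  move=> /coord_spaceP hl; apply/coord_spaceP => t /hl /andP[_ /lt_trans]; exact.
apply/coord_spaceP => t.
by move=> /(ghom_coord (ghom_nprod H_ham g_aut _ (e_ghom x.2) (mono_ghom s))) ->.
Qed.

(** Deforming a monomial only adds terms of lower conformal weight. *)
Lemma hmono_low s : hmono e wt ep 1 s - mono s \in
  coord_space e_free (fun t => (mono_idx t).1 < (mono_idx s).1).
Proof.
elim: s => [|x s IH]; first by rewrite subrr rpred0.
rewrite mono_cons -[hmono _ _ _ _ _]/(gen_op e wt ep 1 x (hmono e wt ep 1 s)).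
have -> : gen_op e wt ep 1 x (hmono e wt ep 1 s) - nprod (e x.2) (-1 - x.1%:Z) (mono s) =
    gen_op e wt ep 1 x (hmono e wt ep 1 s - mono s) +
    (gen_op e wt ep 1 x (mono s) - nprod (e x.2) (-1 - x.1%:Z) (mono s)).
  by rewrite /gen_op raddfB addrA subrK.
apply: rpredD.
  have E : wt x.2 + (mono_idx s).1 + x.1%:R = (mono_idx (x :: s)).1.
    by rewrite /idx_prod /= rmorphB rmorphN1 /= -pmulrn; ring.
  by rewrite -E; exact: gen_op_low.
have := smode_low 1 (idx_gamma (gen_idx wt ep x.2)) (-1 - x.1%:Z) (e_ghom x.2) (mono_ghom s).
by move=> /coord_spaceP hl; apply/coord_spaceP => t /hl /andP[].
Qed.

Local Notation Fil := (hfilt e wt ep gdeg 1).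

(** * Spanning J by deformed monomials *)

Lemma vac_hfilt (b : bool) : ~~ b -> vac V \in Fil b 1.
Proof.
move=> nb; have := hmono_hfilt e wt ep gdeg 1 [::]; rewrite /deg big_nil.
by apply: hfilt_mono => //; case: b nb.
Qed.

Lemma mode_hfilt (b : bool) N1 N2 i c v n : c \in mono_filt e wt ep gdeg N1 i -> v \in Fil b N2 ->
  hmode 1 i c n v \in Fil ((n <= kill_bound i.2) || (n < 0) && b) (N1 + N2).-1.
Proof. exact: (mode_boundP e_par ep_range gdeg_gt0 pregr mono_filt_proj). Qed.

Lemma smode_creation (p : nat -> K) a : p 0%N = 1 -> smode p a (-1) (vac V) = a.
Proof.
move=> p0; rewrite /smode (@tsum_one _ _ 0%N) ?addr0 ?p0 ?scale1r ?(vac_right a).1//.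
move=> [//|k] _; rewrite (_ : -1 + k.+1%:Z = k%:Z) ?(vac_right a).2 ?scaler0//.
by rewrite -addn1 PoszD; ring.
Qed.

Lemma hfilt_exhausts v : exists N, v \in Fil false N.
Proof.
apply: (@coord_span_ind (fun v => exists N, v \in Fil false N)) => [|k u w [N1 h1] [N2 h2]|s _ _].
- by exists 0%N; rewrite rpred0.
- exists (maxn N1 N2); apply: rpredD; first apply: rpredZ.
    by move: h1; apply: hfilt_mono => //; exact: leq_maxl.
  by move: h2; apply: hfilt_mono => //; exact: leq_maxr.
have sM : mono s \in mono_filt e wt ep gdeg (deg gdeg s).+1 (mono_idx s).
  by apply: mem_lspan; exists s.
have := mode_hfilt (-1) sM (@vac_hfilt false isT); rewrite smode_creation ?bseries0// => h.
by exists ((deg gdeg s).+1 + 1).-1; move: h; apply: hfilt_mono.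
Qed.

Lemma mono_filt_exhausts i v : ghom i v -> exists N, v \in mono_filt e wt ep gdeg N i.
Proof.
move=> hv; suff [N hN] : exists N, v \in lspan [set mono t | t in [set t | (deg gdeg t < N)%N]].
  by exists N; exact: ghom_proj.
apply: (@coord_span_ind (fun v => exists N, v \in lspan
   [set mono t | t in [set t | (deg gdeg t < N)%N]])) => [|k u w [N1 h1] [N2 h2]|s _ _].
- by exists 0%N; rewrite rpred0.
- exists (maxn N1 N2); apply: rpredD; first apply: rpredZ.
    move: h1; apply: lspan_mono => _ [t /= tN <-]; exists t => //=.
    by rewrite leq_max tN.
  move: h2; apply: lspan_mono => _ [t /= tN <-]; exists t => //=.
  by rewrite leq_max tN orbT.
by exists (deg gdeg s).+1; apply: mem_lspan; exists s => /=.
Qed.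

Lemma idx_sum_int (x y : R) : -1 < x <= 0 -> -1 < y <= 0 -> x + y \is a Num.int ->
  x + y = - (chi_b x y)%:R.
Proof.
move=> /andP[lx ux] /andP[ly uy] /intrP[z ez]; rewrite /chi_b ez.
have : (-2)%:~R < z%:~R :> R by rewrite -ez rmorphN /=; lra.
have : z%:~R <= 0%:~R :> R by rewrite -ez /=; lra.
rewrite ltr_int ler_int => z0 z2.
have [->|->] : z = 0 \/ z = -1 by lia.
  by rewrite (_ : 0%:~R <= -1 = false) ?oppr0//; apply/negbTE; rewrite -ltNge ltrN10.
by rewrite rmorphN1 lexx.
Qed.

Lemma chi_kill_bound (x y : R) : -1 < x <= 0 -> -1 < y <= 0 -> x + y = - (chi_b x y)%:R ->
  -2 + chi x y = kill_bound x.
Proof.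
move=> /andP[lx ux] /andP[ly uy]; rewrite /chi -/(chi_b x y) /kill_bound.
case: (chi_b x y) => /= xy; case: eqP => x0 //; last by exfalso; apply: x0; lra.
by exfalso; rewrite x0 in xy; lra.
Qed.

(** In a spanning product of J the index is the kill_bound of the first factor,
    so the mode bound provides a killed factor. *)
Lemma J_in_hfilt x : x \in JgH -> exists N, x \in Fil true N.
Proof.
move: x; apply: lspan_ind => [|k u w [N1 h1] [N2 h2]|x [i [a [j [b [ha hb ij ->]]]]]].
- by exists 0%N; rewrite rpred0.
- exists (maxn N1 N2); apply: rpredD; first apply: rpredZ.
    by move: h1; apply: hfilt_mono => //; exact: leq_maxl.
  by move: h2; apply: hfilt_mono => //; exact: leq_maxr.
have [Na aM] := mono_filt_exhausts ha; have [Nb bF] := hfilt_exhausts b.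
have [_ ri _] := ha; have [_ rj _] := hb.
rewrite (star_ghom _ _ ha); exists (Na + Nb).-1.
have := mode_hfilt (-2 + chi i.2 j.2) aM bF; apply: hfilt_mono => // _.
by rewrite (chi_kill_bound ri rj (idx_sum_int ri rj ij)) lexx.
Qed.

(** The component of conformal weight p. *)
Definition wpart (p : R) v := restr (fun s => (mono_idx s).1 == p) v.

Lemma wpart_lin p : linear (wpart p).
Proof. by move=> k u v; rewrite /wpart restr_lin. Qed.

Lemma prD0 p : wpart p 0 = 0.
Proof. exact: linear_fun0 (wpart_lin p). Qed.

Lemma wpart_low p v : v \in coord_space e_free (fun s => (mono_idx s).1 < p) -> wpart p v = 0.
Proof. by move=> /coord_spaceP hv; apply: restr_eq0 => s /hv sp; rewrite lt_eqF. Qed.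

Lemma wpart_ghom p i v : ghom i v -> wpart p v = if i.1 == p then v else 0.
Proof.
move=> hv; case: ifP => ip.
  by apply: restr_id => s /(ghom_coord hv) ->.
by apply: restr_eq0 => s /(ghom_coord hv) ->; rewrite ip.
Qed.

Lemma idx_prod_vac i : -1 < i.2 <= 0 -> idx_prod i (0, 0) (-2) = (i.1 + 1, i.2).
Proof.
move=> /andP[ri _]; rewrite /idx_prod /chi_b /= !addr0 leNgt ri /= addr0.
congr pair; rewrite rmorphN /=; ring.
Qed.

(** * The subspace C *)

Lemma ghom_vD i a : ghom i a -> ghom (i.1 + 1, i.2) (vD V a).
Proof.
move=> ha; have [_ ri _] := ha; rewrite -(idx_prod_vac ri) vDE.
by apply: ghom_nprod => //; exact: ghom_vac.
Qed.

Lemma VgH_ghom i a : ghom i a -> i.2 = 0 -> a \in VgH.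
Proof. by move=> ha i0; apply: mem_lspan; exists i.1; rewrite -i0 -surjective_pairing. Qed.

Lemma C_gen i j a b : ghom i a -> ghom j b -> i.2 + j.2 = - (chi_b i.2 j.2)%:R ->
  nprod a (-2 + chi i.2 j.2) b \in CgH.
Proof.
move=> ha hb ij; rewrite inE; apply/andP; split; first by apply: mem_lspan; exists i, a, j, b.
apply: (VgH_ghom (ghom_nprod H_ham g_aut _ ha hb)).
by rewrite /idx_prod /= ij addNr.
Qed.

(** Lower indices are reached from -2 + chi by differentiating a, which leaves
    epsilon unchanged. *)
Lemma C_mem i j a b n : ghom i a -> ghom j b -> i.2 + j.2 = - (chi_b i.2 j.2)%:R ->
  n <= -2 + chi i.2 j.2 -> nprod a n b \in CgH.
Proof.
move=> ha hb ij nle; have [k ->] : exists k : nat, n = -2 + chi i.2 j.2 - k%:Z.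
  by exists (absz (-2 + chi i.2 j.2 - n)%R); move: nle; lia.
elim: k i a ha ij {nle n} => [|k IH] i a ha ij; first by rewrite subr0; exact: C_gen.
have := IH _ _ (ghom_vD ha) ij; rewrite nprod_vD.
set c := (X in X *: _); have c0 : c != 0.
  by rewrite /c oppr_eq0 intr_eq0 /chi; case: (_ <= -1); lia.
move=> /(rpredZ c^-1); rewrite scalerA mulVf// scale1r.
by have -> : -2 + chi i.2 j.2 - k.+1%:Z = -2 + chi i.2 j.2 - k%:Z - 1 by lia.
Qed.

Lemma ghom_par_split i a : ghom i a -> exists a0 a1,
  [/\ ghom i a0, ghom i a1, vpar false a0, vpar true a1 & a = a0 + a1].
Proof.
move=> ha; have [_ ri _] := ha.
have hom Q : ghom i (restr Q a).
  apply: ghom_of_coord => // s; rewrite bcoord_restr.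
  by case: ifP => _; [exact: (ghom_coord ha)|rewrite eqxx].
exists (restr (fun s => ~~ mono_parity s) a), (restr mono_parity a); split=> //.
- by apply: vpar_of_coord => s; rewrite bcoord_restr; case: (mono_parity s); rewrite ?eqxx.
- by apply: vpar_of_coord => s; rewrite bcoord_restr; case: (mono_parity s); rewrite ?eqxx.
apply: (bcoord_inj (basis := e_free)) => s; rewrite bcoordD !bcoord_restr.
by case: (mono_parity s); rewrite ?addr0 ?add0r.
Qed.

(** The definition of C intersects a span with V_{g,H} and uses factors without
    parity; projecting shows that products in V_{g,H} of factors homogeneous for
    everything suffice. *)
Lemma C_ind (P : V -> Prop) : P 0 ->
  (forall (k : K) u v, P u -> P v -> P (k *: u + v)) ->
  (forall i j a b pa pb, ghom i a -> ghom j b -> vpar pa a -> vpar pb b ->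
    i.2 + j.2 = - (chi_b i.2 j.2)%:R -> P (nprod a (-2 + chi i.2 j.2) b)) ->
  forall x, x \in CgH -> P x.
Proof.
move=> P0 PL PG x; rewrite inE => /andP[xs /VgHP xV].
have <- : restr (fun s => (mono_idx s).2 == 0) x = x.
  by apply: restr_id => s /xV ->; rewrite eqxx.
have PD u v : P u -> P v -> P (u + v) by move=> hu hv; rewrite -[u]scale1r; exact: PL.
move: x xs {xV}; apply: lspan_ind.
- by rewrite restr_eq0// => s; rewrite bcoord0 eqxx.
- by move=> k u w hu hw; rewrite restr_lin; exact: PL.
move=> _ [i [a [j [b [ha hb ->]]]]].
have hv := ghom_nprod H_ham g_aut (-2 + chi i.2 j.2) ha hb.
have [ij|ij] := eqVneq (idx_prod i j (-2 + chi i.2 j.2)).2 0; last first.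
  by rewrite restr_eq0// => s /(ghom_coord hv) ->.
rewrite restr_id; last by move=> s /(ghom_coord hv) ->; rewrite ij.
have {}ij : i.2 + j.2 = - (chi_b i.2 j.2)%:R.
  by move: ij; rewrite /idx_prod /= => /eqP; rewrite addr_eq0 => /eqP.
have [a0 [a1 [h0 h1 p0 p1 ->]]] := ghom_par_split ha.
have [b0 [b1 [k0 k1 q0 q1 ->]]] := ghom_par_split hb.
by rewrite nprodDl !nprodDr; apply: (PD); apply: (PD); apply: (PG); eassumption.
Qed.

(** The commutator of c_(n) and a_(m) is a combination of (c_(j) a)_(n + m - j)
    with j >= 0; this index is at most m, and c_(j) a has the same epsilon as a. *)
Lemma C_left c x n : -1 <= n <= 0 -> c \in VgH -> x \in CgH -> nprod c n x \in CgH.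
Proof.
move=> n01 /VgHP cV; move: x; apply: C_ind.
- by rewrite nprod0r rpred0.
- by move=> k u v hu hv; rewrite nprodDr nprodZr rpredD ?rpredZ.
move=> i j a b pa pb ha hb hpa hpb ij.
have [_ /andP[ri _] _] := ha; have [_ /andP[rj _] _] := hb.
apply: (@coord_span_ind (fun c => nprod c n _ \in CgH)) => [||s _ /cV s0].
- by rewrite nprod0l rpred0.
- by move=> k u w hu hw; rewrite nprodDl nprodZl rpredD ?rpredZ.
have hs := mono_ghom s.
have := nprod_comm b n (-2 + chi i.2 j.2) (mono_parP e_par s) hpa.
move=> /(canRL (subrK _)) ->; apply: rpredD.
  apply: tsum_in => k; apply: rpredZ.
  have h := ghom_nprod H_ham g_aut k%:Z hs ha.
  have h2 : (idx_prod (mono_idx s) i k%:Z).2 = i.2.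
    by rewrite /idx_prod /chi_b /= s0 add0r leNgt ri addr0.
  by apply: (C_mem h hb); rewrite h2 //; move: n01; lia.
apply: rpredZ; have h := ghom_nprod H_ham g_aut n hs hb.
have h2 : (idx_prod (mono_idx s) j n).2 = j.2.
  by rewrite /idx_prod /chi_b /= s0 add0r leNgt rj addr0.
by apply: (C_mem ha h); rewrite h2.
Qed.

(** The head is either killed, and then the monomial is a product in C, or it
    acts on a shorter monomial in C by its (-1)-mode. *)
Lemma killed_mono_C s : has (killed ep) s -> (mono_idx s).2 = 0 -> mono s \in CgH.
Proof.
elim: s => [//|x s IH] hb i0.
have ij : ep x.2 + (mono_idx s).2 = - (chi_b (ep x.2) (mono_idx s).2)%:R.
  by apply/eqP; rewrite -addr_eq0; apply/eqP.
have [_ rx _] := e_ghom x.2; have rs := mono_idx_range wt ep_range s.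
rewrite mono_cons; have [bx|nbx] := boolP (killed ep x).
  apply: (C_mem (e_ghom x.2) (mono_ghom s) ij).
  by have := killed_bound ep x 0; rewrite addn0 -surjective_pairing bx (chi_kill_bound rx rs ij).
move: hb; rewrite /= (negPf nbx) /= => hb; move: nbx; rewrite /killed negb_or negbK -leqNgt leqn0.
move=> /andP[/eqP x1 /eqP x2]; rewrite x1 subr0; apply: C_left => //.
  by apply: (VgH_ghom (e_ghom x.2)).
by apply: IH => //; rewrite -(mono_idx_kept wt ep_range s x2).
Qed.

(** * Leading terms of J *)

Lemma seq_argmax (T : eqType) (f : T -> R) (r : seq T) (z0 : T) : z0 \in r ->
  exists2 z : T, z \in r & forall z' : T, z' \in r -> f z' <= f z.
Proof.
elim: r z0 => [//|x r IH] _ _; case: r IH => [_|y r /(_ y (mem_head _ _))[z zr zmax]].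
  by exists x; rewrite ?mem_head// => z'; rewrite inE => /eqP ->.
have [xz|zx] := lerP (f x) (f z).
  exists z; first by rewrite inE zr orbT.
  by move=> z'; rewrite inE => /orP[/eqP ->|/zmax].
exists x; first exact: mem_head.
move=> z'; rewrite inE => /orP[/eqP -> //|/zmax h]; exact: le_trans h (ltW zx).
Qed.

(** The linear map replacing each basis monomial by its deformation, which is
    unitriangular for the conformal weight. *)
Definition deform : V -> V := lin_ext e_free (fun s => hmono e wt ep 1 s).

Lemma deform_lin : linear deform.
Proof. exact: lin_ext_lin. Qed.

Lemma deform_basis s : pbw_index e s -> deform (mono s) = hmono e wt ep 1 s.
Proof.
move=> ps; rewrite /deform.
rewrite (@lin_extE _ _ _ _ _ e_free _ _ _ (undup (s :: csupp e_free (mono s)))) ?undup_uniq//;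
  last first.
  by move=> t ts; rewrite mem_undup inE ts orbT.
rewrite (bigD1_seq s) ?undup_uniq ?mem_undup ?mem_head//= bcoord_basis// eqxx scale1r.
rewrite big1 ?addr0// => t ts; rewrite bcoord_basis// (negPf ts) scale0r//.
Qed.

Lemma deform_low p u : (forall s, cd u s != 0 -> (mono_idx s).1 <= p) ->
  deform u - u \in coord_space e_free (fun s => (mono_idx s).1 < p).
Proof.
move=> up; apply: (@coord_span_ind (fun u => deform u - u \in _)) => [||s ps /up sp].
- by rewrite (linear_fun0 deform_lin) subr0 rpred0.
- move=> k v w hv hw; rewrite deform_lin opprD addrACA -scalerBr.
  by rewrite rpredD ?rpredZ.
rewrite deform_basis//; have := hmono_low s => /coord_spaceP hs.
by apply/coord_spaceP => t /hs h; exact: lt_le_trans h sp.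
Qed.

(** At an index of maximal weight in the support of u the coordinate of the
    deformed vector is that of u, since nothing of higher weight interferes. *)
Lemma deform_bound p u : (forall s, cd (deform u) s != 0 -> (mono_idx s).1 <= p) ->
  forall s, cd u s != 0 -> (mono_idx s).1 <= p.
Proof.
move=> up s us; have [_ _ cv _] := csupp_spec e_free u.
pose r := [seq t <- csupp e_free u | cd u t != 0].
have [|t tr tmax] := @seq_argmax _ (fun t => (mono_idx t).1) r s.
  by rewrite mem_filter us; apply: contraR us => /cv ->.
have st : (mono_idx s).1 <= (mono_idx t).1.
  by apply: tmax; rewrite mem_filter us; apply: contraR us => /cv ->.
apply: le_trans st _; apply: up; move: tr; rewrite mem_filter => /andP[ut _].
have tmax' s' : cd u s' != 0 -> (mono_idx s').1 <= (mono_idx t).1.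
  by move=> us'; apply: tmax; rewrite mem_filter us'; apply: contraR us' => /cv ->.
have /coord_spaceP h := deform_low tmax'.
have {h} : ~~ (cd (deform u - u) t != 0) by apply/negP => /h; rewrite ltxx.
by rewrite negbK bcoordB subr_eq0 => /eqP ->.
Qed.

(** An element of J is the deformation of a combination u of ordered monomials
    with killed factors; its component of weight p is that of u. *)
Lemma leading_J_C p x : x \in JgH -> x \in FV H g p -> wpart p x \in CgH.
Proof.
move=> /J_in_hfilt[N /(hfilt_sorted e_par ep_range gdeg_gt0 pregr mono_filt_proj gen_odd) xW].
move=> /FVP[/VgHP xV xp].
have [u ux ubad] : exists2 u, deform u = x & forall s, cd u s != 0 -> has (killed ep) s.
  move: x xW {xV xp}; apply: lspan_ind.
  - exists 0; last by move=> s; rewrite bcoord0 eqxx.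
    exact: linear_fun0 deform_lin.
  - move=> k v w [v' <- hv] [w' <- hw]; exists (k *: v' + w'); first exact: deform_lin.
    move=> s; rewrite bcoord_lin => c0; have [cu|/hv//] := eqVneq (cd v' s) 0.
    by apply: hw; apply: contra c0 => /eqP ->; rewrite cu mulr0 addr0.
  - move=> _ [s [ps _ /(_ isT) bs] <-]; exists (mono s); first exact: deform_basis.
    by move=> t; have [->//|ts] := eqVneq t s; rewrite bcoord_basis// (negPf ts) eqxx.
have up : forall s, cd u s != 0 -> (mono_idx s).1 <= p.
  by apply: deform_bound; rewrite ux.
have xu : wpart p x = wpart p u.
  have := wpart_low (deform_low up); rewrite ux.
  have -> : x - u = (-1) *: u + x by rewrite scaleN1r addrC.
  by rewrite wpart_lin scaleN1r addrC => /eqP; rewrite subr_eq0 => /eqP.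
rewrite xu; apply: (@coord_span_ind (fun v => v \in CgH)) => [||s ps c0].
- exact: rpred0.
- by move=> k v w hv hw; rewrite rpredD ?rpredZ.
apply: killed_mono_C.
  by apply: ubad; move: c0; rewrite bcoord_restr; case: ifP => // _; rewrite eqxx.
apply: xV; move: c0; rewrite -xu bcoord_restr; case: ifP => // _; by rewrite eqxx.
Qed.

Lemma ghom_sum_VgH i j n a b : ghom i a -> ghom j b -> i.2 + j.2 = - (chi_b i.2 j.2)%:R ->
  nprod a n b \in VgH.
Proof.
move=> ha hb ij; apply: (VgH_ghom (ghom_nprod H_ham g_aut n ha hb)).
by rewrite /idx_prod /= ij addNr.
Qed.

(** The star product with the same factors and the same index has the given
    product as its leading term. *)
Lemma C_lift p x : x \in CgH -> exists2 y, y \in JgH & y - wpart p x \in FVlt H g p.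
Proof.
move: x; apply: C_ind.
- exists 0; first exact: rpred0.
  by rewrite prD0 subrr rpred0.
- move=> k u v [u' u'J hu] [v' v'J hv]; exists (k *: u' + v'); first by rewrite rpredD ?rpredZ.
  by rewrite wpart_lin opprD addrACA -scalerBr rpredD ?rpredZ.
move=> i j a b pa pb ha hb _ _ ij; set n := -2 + _.
have hv := ghom_nprod H_ham g_aut n ha hb; rewrite (wpart_ghom p hv).
case: eqP => ip; last by exists 0; rewrite ?subrr rpred0.
exists (star H g n a b).
  apply: mem_lspan; exists i, a, j, b; split=> //.
  by rewrite ij rpredN rpred_nat.
rewrite (star_ghom _ _ ha); apply/FVltP; have := smode_low 1 (idx_gamma i) n ha hb.
move=> /coord_spaceP h; split=> [|s /h]; last by rewrite ip => /andP[].
apply/VgHP => s /h /andP[/eqP -> _].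
by rewrite /idx_prod /= ij addNr.
Qed.

(** * The Poisson superalgebra R *)

Lemma VgH_nprod a b n : a \in VgH -> b \in VgH -> nprod a n b \in VgH.
Proof.
move=> /VgHP aV /VgHP bV; apply: (@coord_span_ind (fun a => nprod a n b \in VgH)) => [||s _ /aV s0].
- by rewrite nprod0l rpred0.
- by move=> k u w hu hw; rewrite nprodDl nprodZl rpredD ?rpredZ.
apply: (@coord_span_ind (fun b => nprod _ n b \in VgH)) => [||t _ /bV t0].
- by rewrite nprod0r rpred0.
- by move=> k u w hu hw; rewrite nprodDr nprodZr rpredD ?rpredZ.
apply: (ghom_sum_VgH n (mono_ghom s) (mono_ghom t)).
by rewrite /chi_b s0 t0 addr0 leNgt ltrN10 oppr0.
Qed.

Lemma vac_VgH : vac V \in VgH.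
Proof. exact: (VgH_ghom (ghom_vac H_ham g_aut)). Qed.

Lemma C_VgH x : x \in CgH -> x \in VgH.
Proof. by rewrite inE => /andP[]. Qed.

Lemma C_deep a b n : a \in VgH -> b \in VgH -> n <= -2 -> nprod a n b \in CgH.
Proof.
move=> /VgHP aV /VgHP bV n2.
apply: (@coord_span_ind (fun a => nprod a n b \in CgH)) => [||s _ /aV s0].
- by rewrite nprod0l rpred0.
- by move=> k u w hu hw; rewrite nprodDl nprodZl rpredD ?rpredZ.
apply: (@coord_span_ind (fun b => nprod _ n b \in CgH)) => [||t _ /bV t0].
- by rewrite nprod0r rpred0.
- by move=> k u w hu hw; rewrite nprodDr nprodZr rpredD ?rpredZ.
have ch : chi_b (mono_idx s).2 (mono_idx t).2 = false by rewrite /chi_b s0 t0 addr0 leNgt ltrN10.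
apply: (C_mem (mono_ghom s) (mono_ghom t)); first by rewrite ch s0 t0 addr0 oppr0.
by rewrite /chi -/(chi_b _ _) ch addr0.
Qed.

Definition ppart (b : bool) v := restr (fun s => mono_parity s == b) v.

Lemma ppart_split v : v = ppart false v + ppart true v.
Proof.
apply: (bcoord_inj (basis := e_free)) => s; rewrite bcoordD !bcoord_restr.
by case: (mono_parity s); rewrite ?addr0 ?add0r.
Qed.

Lemma ppart_par (b : bool) v : vpar b (ppart b v).
Proof.
by apply: vpar_of_coord => s; rewrite bcoord_restr; case: ifPn => [/eqP//|]; rewrite eqxx.
Qed.

Lemma ppart_lin (b : bool) : linear (ppart b).
Proof. by move=> k u v; rewrite /ppart restr_lin. Qed.

Lemma ppart_id (b c : bool) v : vpar b v -> ppart c v = if b == c then v else 0.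
Proof.
move=> hv; case: ifP => bc.
  by apply: restr_id => s /(vpar_coord hv) ->.
by apply: restr_eq0 => s /(vpar_coord hv) ->; rewrite bc.
Qed.

Lemma ppart_VgH (b : bool) v : v \in VgH -> ppart b v \in VgH.
Proof.
move=> /VgHP vV; apply/VgHP => s; rewrite bcoord_restr; case: ifP => _; first exact: vV.
by rewrite eqxx.
Qed.

Lemma ppart_C (b : bool) x : x \in CgH -> ppart b x \in CgH.
Proof.
move: x; apply: C_ind.
- by rewrite /ppart restr_eq0 ?rpred0// => s; rewrite bcoord0 eqxx.
- by move=> k u v hu hv; rewrite ppart_lin rpredD ?rpredZ.
move=> i j a c pa pc ha hc hpa hpc ij; rewrite (ppart_id _ (nprod_par _ hpa hpc)).
by case: ifP => _; [exact: C_gen|exact: rpred0].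
Qed.

Lemma wpart_C p x : x \in CgH -> wpart p x \in CgH.
Proof.
move: x; apply: C_ind.
- by rewrite prD0 rpred0.
- by move=> k u v hu hv; rewrite wpart_lin rpredD ?rpredZ.
move=> i j a c pa pc ha hc hpa hpc ij.
rewrite (wpart_ghom p (ghom_nprod H_ham g_aut _ ha hc)).
by case: ifP => _; [exact: C_gen|exact: rpred0].
Qed.

(** All terms of the skew-symmetry formula but the first are products of index
    at most -2 with the vacuum. *)
Lemma C_skew pa pb a b n : a \in VgH -> b \in VgH -> vpar pa a -> vpar pb b ->
  nprod b n a + ((-1) ^ n * (-1) ^+ (pa && pb)) *: nprod a n b \in CgH.
Proof.
move=> aV bV ha hb; rewrite (nprod_skew n ha hb).
have [N PN] := nprod_bound a n b.
rewrite (@tsum_first _ _ N); last by move=> k /PN ->; rewrite nprod0l scaler0.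
rewrite expr0 scale1r subr0 addr0 (vac_right _).1 addrC -scalerBr opprD addNKr.
apply: rpredZ; rewrite rpredN; apply: tsum_in => k; apply: rpredZ.
by apply: C_deep; [exact: VgH_nprod|exact: vac_VgH|lia].
Qed.

Lemma C_right c x n : -1 <= n <= 0 -> x \in CgH -> c \in VgH -> nprod x n c \in CgH.
Proof.
move=> n01 xC cV; rewrite [x]ppart_split [c]ppart_split nprodDl !nprodDr.
have main (b b' : bool) : nprod (ppart b x) n (ppart b' c) \in CgH.
  have hx := ppart_C b xC; have hc := ppart_VgH b' cV.
  have := C_skew n hc (C_VgH hx) (ppart_par b' c) (ppart_par b x).
  move=> h.
  rewrite -[nprod _ _ _](addrK (((-1) ^ n * (-1) ^+ (b' && b)) *: nprod (ppart b' c) n (ppart b x))).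
  by apply: rpredB => //; apply: rpredZ; exact: C_left.
by rewrite !rpredD.
Qed.

(** All terms of the associativity formula but the first are products of index
    at most -2. *)
Lemma C_assoc a b c : a \in VgH -> b \in VgH -> c \in VgH ->
  nprod (nprod a (-1) b) (-1) c - nprod a (-1) (nprod b (-1) c) \in CgH.
Proof.
move=> /VgHP aV /VgHP bV cV.
suff main pa pb u v : u \in VgH -> v \in VgH -> vpar pa u -> vpar pb v ->
    nprod (nprod u (-1) v) (-1) c - nprod u (-1) (nprod v (-1) c) \in CgH.
  have sV s : (mono_idx s).2 = 0 -> mono s \in VgH by exact: VgH_ghom (mono_ghom s).
  apply: (@coord_span_ind (fun a => nprod (nprod a _ b) _ c - nprod a _ _ \in CgH))
    => [||s _ /aV s0].
  - by rewrite !nprod0l subrr rpred0.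
  - move=> k u w hu hw; rewrite !(nprodDl, nprodZl) opprD addrACA -scalerBr.
    by rewrite rpredD ?rpredZ.
  apply: (@coord_span_ind (fun b => nprod (nprod _ _ b) _ c - nprod _ _ (nprod b _ c) \in CgH))
    => [||t _ /bV t0].
  - by rewrite nprod0r !nprod0l nprod0r subrr rpred0.
  - move=> k u w hu hw; rewrite !(nprodDl, nprodZl, nprodDr, nprodZr) opprD addrACA -scalerBr.
    by rewrite rpredD ?rpredZ.
  apply: (main _ _ _ _ (sV _ s0) (sV _ t0)); exact: (mono_parP e_par).
move=> uV vV hu hv; rewrite (nprod_assoc _ _ _ hu hv).
have [N1 PN1] := nprod_bound v (-1) c; have [N2 PN2] := nprod_bound u 0 c.
rewrite (@tsum_first _ _ (maxn N1 N2)); last first.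
  move=> k; rewrite geq_max => /andP[/PN1 -> /PN2]; rewrite add0r => ->.
  by rewrite !nprod0r scaler0 subrr scaler0.
have cancel4 (x y z : V) : x - y + z - x = z - y.
  by rewrite addrAC (addrAC x) subrr add0r addrC.
rewrite expr0 gbinom0 mulr1 scale1r ?subr0 ?addr0 cancel4.
have deep k : nprod v (-1 - 1 - k%:Z) (nprod u k%:Z c) \in CgH.
  by apply: C_deep; rewrite ?VgH_nprod//; lia.
apply: rpredB; last by apply: rpredZ; have := deep 0%N; rewrite subr0.
apply: tsum_in => k; apply: rpredZ; apply: rpredB; last by apply: rpredZ.
by apply: C_deep; rewrite ?VgH_nprod//; lia.
Qed.

(** The 0-th mode is a derivation of all products; this is both the Leibniz rule
    and the Jacobi identity. *)
Lemma nprod0_der pa pb a b c n : vpar pa a -> vpar pb b ->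
  nprod a 0 (nprod b n c) = nprod (nprod a 0 b) n c +
    (-1) ^+ (pa && pb) *: nprod b n (nprod a 0 c).
Proof.
move=> ha hb; have := nprod_comm c 0 n ha hb.
rewrite (@tsum_one _ _ 0%N); last by move=> [//|k] _; rewrite gbinom0S scale0r.
by rewrite gbinom0 scale1r add0r subr0 => /(canRL (subrK _)).
Qed.

Local Notation Rcl := (R_class H g).

Lemma R_ex (x : R_gH H g) : exists2 a, a \in VgH & x = Rcl a.
Proof. by exists (subquot_repr x); [exact: repr_in|rewrite /R_class class_repr]. Qed.

Lemma R_eq a b : a \in VgH -> b \in VgH -> Rcl a = Rcl b <-> a - b \in CgH.
Proof. exact: class_eq. Qed.

Lemma R_lin (k : K) a b : a \in VgH -> b \in VgH ->
  Rcl (k *: a + b) = k *: Rcl a + Rcl b.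
Proof. exact: class_lin. Qed.

Lemma R_nprod n a b : -1 <= n <= 0 -> a \in VgH -> b \in VgH ->
  Rcl (nprod (subquot_repr (Rcl a)) n (subquot_repr (Rcl b))) = Rcl (nprod a n b).
Proof.
move=> n01 aV bV; have ra := repr_in (Rcl a); have rb := repr_in (Rcl b).
have ea : subquot_repr (Rcl a) - a \in CgH.
  by apply/R_eq => //; rewrite /R_class class_repr.
have eb : subquot_repr (Rcl b) - b \in CgH.
  by apply/R_eq => //; rewrite /R_class class_repr.
apply/R_eq; rewrite ?VgH_nprod//.
by rewrite nprod_subE; apply: rpredD; [exact: C_right|exact: C_left].
Qed.

Lemma R_mulE a b : a \in VgH -> b \in VgH ->
  R_mul (Rcl a) (Rcl b) = Rcl (nprod a (-1) b).
Proof. by move=> aV bV; rewrite /R_mul R_nprod. Qed.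

Lemma R_brE a b : a \in VgH -> b \in VgH ->
  R_bracket (Rcl a) (Rcl b) = Rcl (nprod a 0 b).
Proof. by move=> aV bV; rewrite /R_bracket R_nprod. Qed.

Lemma R_well : R_well_defined H g.
Proof. by move=> a b aV bV; rewrite R_mulE// R_brE. Qed.

Lemma R_poissonP : poisson_superalgebra (R_poisson H g).
Proof.
have RV a b (k : K) : a \in VgH -> b \in VgH -> k *: a + b \in VgH.
  by move=> aV bV; rewrite rpredD ?rpredZ.
split.
- split.
  + split.
    * move=> b; exists 0; first by split; [exact: rpred0|exact: vpar0].
      by rewrite /R_class class0.
    * move=> b k _ _ [u [uV hu] <-] [v [vV hv] <-]; exists (k *: u + v).
        by split; [exact: RV|exact: vparL].
      by rewrite R_lin.
    * move=> x; have [a aV ->] := R_ex x; exists (Rcl (ppart false a)), (Rcl (ppart true a)).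
      split; [exists (ppart false a)|exists (ppart true a)|] => //.
      - by split; [exact: ppart_VgH|exact: ppart_par].
      - by split; [exact: ppart_VgH|exact: ppart_par].
      rewrite [in LHS](ppart_split a) -[in LHS](scale1r (ppart false a)).
      by rewrite R_lin ?ppart_VgH// scale1r.
    * move=> _ [u [uV hu] <-] [v [vV hv]] /esym uv.
      have : u - v \in CgH by apply/R_eq.
      move/(ppart_C false); have -> : u - v = (-1) *: v + u by rewrite scaleN1r addrC.
      rewrite ppart_lin (ppart_id false hu) (ppart_id false hv) scaler0 add0r => uC.
      by apply/class_eq0.
  + by exists (vac V) => //; split; [exact: vac_VgH|exact: vac_even].
  + move=> b c _ _ [u [uV hu] <-] [v [vV hv] <-]; exists (nprod u (-1) v);
      last by rewrite /= R_mulE.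
    by split; [exact: VgH_nprod|exact: nprod_par].
  + move=> b c _ _ [u [uV hu] <-] [v [vV hv] <-]; exists (nprod u 0 v); last by rewrite /= R_brE.
    by split; [exact: VgH_nprod|exact: nprod_par].
- split=> x k y z; have [a aV ->] := R_ex x; have [b bV ->] := R_ex y;
    have [c cV ->] := R_ex z; rewrite -R_lin//=.
  + by rewrite !R_mulE ?RV// nprodDr nprodZr R_lin ?VgH_nprod.
  + by rewrite !R_mulE ?RV// nprodDl nprodZl R_lin ?VgH_nprod.
  + by rewrite !R_brE ?RV// nprodDr nprodZr R_lin ?VgH_nprod.
  + by rewrite !R_brE ?RV// nprodDl nprodZl R_lin ?VgH_nprod.
- split.
  + move=> x y z; have [a aV ->] := R_ex x; have [b bV ->] := R_ex y; have [c cV ->] := R_ex z.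
    rewrite /= !R_mulE ?VgH_nprod//; apply/esym/R_eq; rewrite ?VgH_nprod//; exact: C_assoc.
  + move=> x; have [a aV ->] := R_ex x; rewrite /= R_mulE ?vac_VgH//.
    by rewrite vac_left eqxx.
  + move=> b c _ _ [u [uV hu] <-] [v [vV hv] <-]; rewrite /= !R_mulE//.
    rewrite -[RHS]addr0 -[X in _ + X](class0 VgH CgH) -R_lin ?VgH_nprod ?rpred0// addr0.
    apply/R_eq; rewrite ?rpredZ ?VgH_nprod//.
    have := C_skew (-1) vV uV hv hu.
    by rewrite expN1r -[`|_|%N]/1%N expr1 andbC mulN1r scaleNr.
- move=> b c x y z [u [uV hu] <-] [v [vV hv] <-]; have [w wV ->] := R_ex z; rewrite /=.
  rewrite !R_brE ?VgH_nprod//; split.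
    rewrite -scaleNr -[RHS]addr0 -[X in _ + X](class0 VgH CgH) -R_lin ?VgH_nprod ?rpred0// addr0.
    apply/R_eq; rewrite ?rpredZ ?VgH_nprod// scaleNr opprK.
    by have := C_skew 0 uV vV hu hv; rewrite expr0z mul1r.
  by rewrite (nprod0_der _ _ hu hv) addrC R_lin ?VgH_nprod// addrC.
- move=> b c x y z [u [uV hu] <-] [v [vV hv] <-]; have [w wV ->] := R_ex z; rewrite /=.
  rewrite !(R_mulE, R_brE) ?VgH_nprod//.
  by rewrite (nprod0_der _ _ hu hv) addrC R_lin ?VgH_nprod// addrC.
Qed.

Local Notation FVp := (FV H g).
Local Notation Zcl := (zhu_class H g).
Local Notation grcl := (gr_class H g).

(** * The graded Zhu algebra *)

Lemma FV_VgH p v : v \in FVp p -> v \in VgH.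
Proof. by move=> /FVP[]. Qed.

Lemma FVlt_VgH p v : v \in FVlt H g p -> v \in VgH.
Proof. by move=> /FVltP[]. Qed.

Lemma FVlt_FV p v : v \in FVlt H g p -> v \in FVp p.
Proof. by move=> /FVltP[vV vp]; apply/FVP; split=> // s /vp /ltW. Qed.

Lemma Z_lin (k : K) a b : a \in VgH -> b \in VgH -> Zcl (k *: a + b) = k *: Zcl a + Zcl b.
Proof. exact: class_lin. Qed.

Lemma Z_in p a : a \in FVp p -> Zcl a \in FZhu H g p.
Proof. by move=> aF; apply: mem_lspan; exists a. Qed.

Lemma Z_lt_in p a : a \in FVlt H g p -> Zcl a \in FZhult H g p.
Proof. by move=> aF; apply: mem_lspan; exists a. Qed.

Lemma Z_lt_ex p z : z \in FZhult H g p -> exists2 a, a \in FVlt H g p & z = Zcl a.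
Proof.
move: z; apply: lspan_ind.
- by exists 0; [exact: rpred0|rewrite /zhu_class class0].
- move=> k _ _ [u uF ->] [v vF ->]; exists (k *: u + v); first by rewrite rpredD ?rpredZ.
  by rewrite Z_lin ?(FVlt_VgH uF) ?(FVlt_VgH vF).
- by move=> _ [a aF <-]; exists a.
Qed.

Lemma Z_ex p z : z \in FZhu H g p -> exists2 a, a \in FVp p & z = Zcl a.
Proof.
move: z; apply: lspan_ind.
- by exists 0; [exact: rpred0|rewrite /zhu_class class0].
- move=> k _ _ [u uF ->] [v vF ->]; exists (k *: u + v); first by rewrite rpredD ?rpredZ.
  by rewrite Z_lin ?(FV_VgH uF) ?(FV_VgH vF).
- by move=> _ [a aF <-]; exists a.
Qed.

Lemma gr_lin p (k : K) a b : a \in FVp p -> b \in FVp p ->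
  grcl p (k *: a + b) = k *: grcl p a + grcl p b.
Proof.
move=> aF bF; rewrite /gr_class Z_lin ?(FV_VgH aF) ?(FV_VgH bF)//.
by rewrite class_lin ?Z_in.
Qed.

Lemma gr0 p : grcl p 0 = 0.
Proof. by rewrite /gr_class /zhu_class !class0. Qed.

Lemma wpart_FV p r v : v \in VgH -> r <= p -> wpart r v \in FVp p.
Proof.
move=> /VgHP vV rp; apply/FVP; split; [apply/VgHP|] => s; rewrite bcoord_restr.
  by case: ifP => _; [exact: vV|rewrite eqxx].
by case: ifP => [/eqP ->//|_]; rewrite eqxx.
Qed.

Lemma sub_wpart p v : v \in FVp p -> v - wpart p v \in FVlt H g p.
Proof.
move=> /FVP[/VgHP vV vp].
have key s : cd (v - wpart p v) s != 0 -> cd v s != 0 /\ (mono_idx s).1 != p.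
  rewrite bcoordB bcoord_restr; case: ifP => [_|/negbT]; first by rewrite subrr eqxx.
  by rewrite subr0.
apply/FVltP; split; first by apply/VgHP => s /key[/vV].
by move=> s /key[/vp h1 h2]; rewrite lt_neqAle h2.
Qed.

(** The kernel: one direction is that leading terms of J lie in C, the other
    that elements of C are such leading terms. *)
Lemma gr_eq0 p a : a \in FVp p -> grcl p a = 0 <-> wpart p a \in CgH.
Proof.
move=> aF; have aV := FV_VgH aF; rewrite /gr_class class_eq0 ?Z_in//; split.
  move=> /Z_lt_ex[b bF /class_eq abJ]; have bV := FVlt_VgH bF.
  have {}abJ : a - b \in JgH by exact: abJ.
  have := leading_J_C abJ (rpredB aF (FVlt_FV bF)).
  have -> : a - b = (-1) *: b + a by rewrite scaleN1r addrC.
  rewrite wpart_lin (_ : wpart p b = 0) ?scaler0 ?add0r//; apply: wpart_low.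
  by apply/coord_spaceP; case/FVltP: bF.
move=> /(C_lift p)[y yJ yF].
have pp : wpart p (wpart p a) = wpart p a.
  by apply: restr_id => s; rewrite bcoord_restr; case: ifP => //; rewrite eqxx.
rewrite pp in yF; pose b := a - y.
have bF : b \in FVlt H g p.
  have -> : b = (a - wpart p a) - (y - wpart p a) by rewrite opprB addrA subrK.
  by rewrite rpredB// sub_wpart.
suff -> : Zcl a = Zcl b by exact: Z_lt_in.
by apply/class_eq => //; [exact: FVlt_VgH bF|rewrite opprB addrC subrK].
Qed.

Lemma gr_eq p a b : a \in FVp p -> b \in FVp p ->
  grcl p a = grcl p b <-> wpart p a - wpart p b \in CgH.
Proof.
move=> aF bF; have -> : wpart p a - wpart p b = wpart p ((-1) *: b + a).
  by rewrite wpart_lin scaleN1r addrC.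
rewrite -gr_eq0 ?rpredD ?rpredZ//; rewrite gr_lin// scaleN1r addrC; split.
  by move=> ->; rewrite subrr.
by move/eqP; rewrite subr_eq0 => /eqP.
Qed.

Lemma gr_reprP p (x : gr_piece H g p) : gr_repr x \in FVp p /\ grcl p (gr_repr x) = x.
Proof.
rewrite /gr_repr; case: xgetP => [a _ []//|none]; exfalso.
have [a aF ea] := Z_ex (repr_in x); apply: (none a); split=> //.
by rewrite /gr_class -ea class_repr.
Qed.

(** Both star operations at once: the exponent is gamma for the product and
    gamma - 1 for the bracket. *)
Definition star_op (c : seq (nat * I) -> K) n a b : V :=
  lin_ext e_free (fun s => smode (bseries 1 (c s)) (mono s) n b) a.

Lemma star_op_linr c n a : linear (star_op c n a).
Proof.
move=> k u v; rewrite /star_op /lin_ext scaler_sumr -big_split; apply: eq_bigr => s _.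
by rewrite linearP scalerDr !scalerA mulrC.
Qed.

Lemma wpart_mono p s : wpart p (mono s) = if (mono_idx s).1 == p then mono s else 0.
Proof. exact: wpart_ghom (mono_ghom s). Qed.

Lemma star_op_mono c n s b : pbw_index e s ->
  star_op c n (mono s) b = smode (bseries 1 (c s)) (mono s) n b.
Proof.
move=> ps; rewrite /star_op.
rewrite (eq_lin_ext (f' := fun t => smode (bseries 1 (c s)) (mono t) n b)).
  exact: (lin_ext_id _ (smode_linl (bseries 1 (c s)) n b)).
by move=> t; rewrite bcoord_basis//; case: (t =P s) => [->//|_]; rewrite eqxx.
Qed.

(** For monomials the leading term is the ordinary product, and it has weight
    exactly p + q - n - 1 only if the factors have weights p and q. *)
Lemma star_op_top c n p q a b : a \in FVp p -> b \in FVp q ->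
  star_op c n a b \in FVp (p + q - n%:~R - 1) /\
  wpart (p + q - n%:~R - 1) (star_op c n a b) = nprod (wpart p a) n (wpart q b).
Proof.
move=> /FVP[/VgHP aV ap] /FVP[/VgHP bV bq]; set r := p + q - _ - 1.
pose P u v := star_op c n u v \in FVp r /\
  wpart r (star_op c n u v) = nprod (wpart p u) n (wpart q v).
have ol v : linear (star_op c n ^~ v) by move=> k u w; exact: lin_ext_lin.
apply: (@coord_span_ind (P^~ b)) => [|k u w [u1 u2] [w1 w2]|s ps sa].
- by rewrite /P (linear_fun0 (ol b)) !prD0 nprod0l; split=> //; exact: rpred0.
- split; first by rewrite ol rpredD ?rpredZ.
  by rewrite ol !wpart_lin u2 w2 nprodDl nprodZl.
apply: (@coord_span_ind (P (mono s))) => [|k u w [u1 u2] [w1 w2]|t pt tb].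
- by rewrite /P (linear_fun0 (star_op_linr c n (mono s))) !prD0 nprod0r; split=> //; exact: rpred0.
- split; first by rewrite star_op_linr rpredD ?rpredZ.
  by rewrite star_op_linr !wpart_lin u2 w2 nprodDr nprodZr.
have s0 := aV _ sa; have t0 := bV _ tb; have sp := ap _ sa; have tq := bq _ tb.
have hst := ghom_nprod H_ham g_aut n (mono_ghom s) (mono_ghom t).
have i2 : (idx_prod (mono_idx s) (mono_idx t) n).2 = 0.
  by rewrite /idx_prod /chi_b /= s0 t0 addr0 leNgt ltrN10 addr0.
have i1 : (idx_prod (mono_idx s) (mono_idx t) n).1 <= r by rewrite /idx_prod /r /= !lerD2r lerD.
rewrite /P star_op_mono//.
have /coord_spaceP low := smode_low 1 (c s) n (mono_ghom s) (mono_ghom t).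
have lowF : smode (bseries 1 (c s)) (mono s) n (mono t) - nprod (mono s) n (mono t) \in FVlt H g r.
  apply/FVltP; split; first by apply/VgHP => t' /low /andP[/eqP ->].
  by move=> t' /low /andP[_ /lt_le_trans]; exact.
rewrite -[smode _ _ _ _](subrK (nprod (mono s) n (mono t))); split.
  apply: rpredD; first exact: FVlt_FV.
  apply/FVP; split; first exact: VgH_ghom hst i2.
  by move=> t' /(ghom_coord hst) ->.
rewrite -[X in X + _]scale1r wpart_lin (_ : wpart r (_ - _) = 0); last first.
  by apply: wpart_low; apply/coord_spaceP; case/FVltP: lowF.
rewrite scaler0 add0r (wpart_ghom r hst) !wpart_mono.
have -> : ((idx_prod (mono_idx s) (mono_idx t) n).1 == r) =
    ((mono_idx s).1 == p) && ((mono_idx t).1 == q).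
  rewrite /idx_prod /r /= !(inj_eq (addIr _)).
  apply/eqP/andP => [h|[/eqP -> /eqP ->]//]; split; apply/eqP; lra.
by case: eqP => _; rewrite ?nprod0l//; case: eqP => _; rewrite ?nprod0r.
Qed.

(** Since csupp may list vanishing coordinates, this may contain superfluous
    weights. *)
Definition weights a : seq R := undup [seq (mono_idx s).1 | s <- csupp e_free a].

Lemma wpart_out p a : p \notin weights a -> wpart p a = 0.
Proof.
move=> pa; apply: restr_eq0 => s c0; apply: contra pa => /eqP <-.
rewrite mem_undup; apply: (map_f (fun s => (mono_idx s).1)).
by have [_ _ cv _] := csupp_spec e_free a; apply: contraR c0 => /cv ->.
Qed.

Lemma wpart_sum a : \sum_(p <- weights a) wpart p a = a.
Proof.
apply: (bcoord_inj (basis := e_free)) => s; rewrite bcoord_sum.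
have [c0|c0] := eqVneq (cd a s) 0.
  by rewrite c0 big1// => p _; rewrite bcoord_restr c0 if_same.
have sa : s \in csupp e_free a.
  by have [_ _ cv _] := csupp_spec e_free a; apply: contraR c0 => /cv ->.
rewrite (bigD1_seq (mono_idx s).1) ?undup_uniq ?mem_undup//=; last first.
  exact: (map_f (fun s => (mono_idx s).1)).
rewrite bcoord_restr eqxx.
by rewrite big1 ?addr0// => p; rewrite bcoord_restr eq_sym => /negPf ->.
Qed.

Lemma wpart_wpart p q a : wpart p (wpart q a) = if p == q then wpart p a else 0.
Proof.
apply: (bcoord_inj (basis := e_free)) => s; rewrite !bcoord_restr.
have [->|pq] := eqVneq p q; first by rewrite bcoord_restr; case: ((mono_idx s).1 == q).
by rewrite bcoord0; case: ifP => // /eqP ->; rewrite (negPf pq).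
Qed.

Local Notation grZ := (grZhu H g).

Lemma gr_ext (x y : grZ) : (forall p, dsum_proj x p = dsum_proj y p) -> x = y.
Proof. by move=> xy; apply/val_inj/functional_extensionality_dep. Qed.

Lemma proj_lin (k : K) (x y : grZ) p :
  dsum_proj (k *: x + y) p = k *: dsum_proj x p + dsum_proj y p.
Proof. by rewrite /dsum_proj linearP. Qed.

Lemma proj0 p : dsum_proj (0 : grZ) p = 0.
Proof. by apply: (linear_fun0 (f := fun x : grZ => dsum_proj x p)) => k x y; exact: proj_lin. Qed.

Lemma symbol_subproof a : (fun p => grcl p (wpart p a) : gr_piece H g p) \in
  Lsubspace (dsum_closed (gr_piece H g)).
Proof.
apply/asboolP; apply: (sub_finite_set _ (finite_seq (weights a))) => p /= pa.
by apply: contrapT => /negP /wpart_out e0; apply: pa; rewrite e0 gr0.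
Qed.

(** The image of a vector of V_{g,H} in gr Zhu, weight by weight. *)
Definition symbol a : grZ := exist (fun f : dprod (gr_piece H g) =>
  f \in Lsubspace (dsum_closed (gr_piece H g))) _ (symbol_subproof a).

Lemma symbolE a p : dsum_proj (symbol a) p = grcl p (wpart p a).
Proof. by []. Qed.

Lemma symbol_lin (k : K) a b : a \in VgH -> b \in VgH ->
  symbol (k *: a + b) = k *: symbol a + symbol b.
Proof.
move=> aV bV; apply: gr_ext => p; rewrite proj_lin !symbolE wpart_lin.
by rewrite gr_lin ?wpart_FV.
Qed.

Lemma symbol0 : symbol 0 = 0.
Proof.
have := symbol_lin (-1) (rpred0 VgH) (rpred0 VgH).
by rewrite scaler0 addr0 scaleN1r addNr.
Qed.

Lemma symbol_sum (J : Type) (r : seq J) (E : J -> V) : (forall k, E k \in VgH) ->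
  symbol (\sum_(k <- r) E k) = \sum_(k <- r) symbol (E k).
Proof.
move=> EV; elim: r => [|k r IH]; first by rewrite !big_nil symbol0.
rewrite !big_cons -IH -[E k]scale1r symbol_lin ?scale1r//.
by rewrite rpred_sum.
Qed.

Lemma gr_in_proj p (x : gr_piece H g p) : dsum_proj (gr_in x) p = x.
Proof. exact: dfwith_in. Qed.

Lemma gr_in_proj0 p q (x : gr_piece H g p) : p != q -> dsum_proj (gr_in x) q = 0.
Proof. exact: dfwith_out. Qed.

Lemma symbol_hom p a : wpart p a = a -> symbol a = gr_in (grcl p a).
Proof.
move=> pa; apply: gr_ext => q; rewrite symbolE; have [<-|pq] := eqVneq p q.
  by rewrite gr_in_proj pa.
by rewrite gr_in_proj0// -pa wpart_wpart eq_sym (negPf pq) gr0.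
Qed.

(** C is graded by the conformal weight, so a vector lies in C as soon as all its
    components do. *)
Lemma symbol_eq0 a : a \in VgH -> symbol a = 0 <-> a \in CgH.
Proof.
move=> aV; split=> [a0|aC].
  rewrite -(wpart_sum a); apply: rpred_sum => p _.
  have : grcl p (wpart p a) = 0 by rewrite -symbolE a0 proj0.
  by move/gr_eq0; rewrite wpart_wpart eqxx; apply; exact: wpart_FV.
apply: gr_ext => p; rewrite symbolE proj0; apply/gr_eq0; first exact: wpart_FV.
by apply: wpart_C; exact: wpart_C.
Qed.

Lemma symbol_eq a b : a \in VgH -> b \in VgH -> a - b \in CgH -> symbol a = symbol b.
Proof.
move=> aV bV abC; have := (symbol_eq0 (rpredB aV bV)).2 abC.
have -> : a - b = (-1) *: b + a by rewrite scaleN1r addrC.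
by rewrite symbol_lin// scaleN1r addrC => /eqP; rewrite subr_eq0 => /eqP.
Qed.

Definition grmap (x : R_gH H g) : grZ := symbol (subquot_repr x).

Lemma grmapE a : a \in VgH -> grmap (Rcl a) = symbol a.
Proof.
move=> aV; apply: symbol_eq => //; first exact: repr_in.
by apply/R_eq => //; rewrite ?repr_in// /R_class class_repr.
Qed.

Lemma fsum_seq (M : zmodType) (P : set R) (r : seq R) (E : R -> M) : uniq r ->
  (forall p, P p -> p \in r) -> (forall p, p \in r -> ~ P p -> E p = 0) ->
  \sum_(p \in P) E p = \sum_(p <- r) E p.
Proof.
move=> ur Pr E0; rewrite [RHS]fsbig_seq//; apply: fsbig_widen; first exact: Pr.
by move=> p [/= pr /E0 ->].
Qed.

(** The product for n = -1 and the bracket for n = 0. *)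
Definition gr_op c n (x y : grZ) : grZ :=
  \sum_(p \in gr_supp x) \sum_(q \in gr_supp y)
    gr_in (grcl (p + q - n%:~R - 1) (star_op c n (gr_repr (dsum_proj x p))
                                        (gr_repr (dsum_proj y q)))).

(** The chosen representatives differ from the components of a and b by lower
    terms and elements of C, and C is an ideal; the sums over the supports may be
    extended to all weights of a and b because the added terms vanish. *)
Lemma gr_op_symbol c n a b : -1 <= n <= 0 -> a \in VgH -> b \in VgH ->
  gr_op c n (symbol a) (symbol b) = symbol (nprod a n b).
Proof.
move=> n01 aV bV.
have repC p v : v \in VgH -> gr_repr (grcl p (wpart p v)) \in FVp p /\
    wpart p (gr_repr (grcl p (wpart p v))) - wpart p v \in CgH.
  move=> vV; have [rF re] := gr_reprP (grcl p (wpart p v)); split=> //.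
  have vF := wpart_FV vV (lexx p).
  by move: re => /(gr_eq rF vF); rewrite wpart_wpart eqxx.
have prV p v : v \in VgH -> wpart p v \in VgH by move=> vV; exact: FV_VgH (wpart_FV vV (lexx p)).
have homn p q :
    wpart (p + q - n%:~R - 1) (nprod (wpart p a) n (wpart q b)) = nprod (wpart p a) n (wpart q b).
  have [_] := star_op_top (fun=> 0) n (wpart_FV aV (lexx p)) (wpart_FV bV (lexx q)).
  rewrite !wpart_wpart !eqxx => <-; by rewrite wpart_wpart eqxx.
have term p q : gr_in (grcl (p + q - n%:~R - 1)
    (star_op c n (gr_repr (dsum_proj (symbol a) p)) (gr_repr (dsum_proj (symbol b) q)))) =
    symbol (nprod (wpart p a) n (wpart q b)).
  rewrite (symbol_hom (homn p q)) !symbolE; congr gr_in.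
  have [raF raC] := repC p a aV; have [rbF rbC] := repC q b bV.
  have [oF oE] := star_op_top c n raF rbF.
  apply/gr_eq => //.
    by rewrite -homn; apply: wpart_FV => //; apply: VgH_nprod; exact: prV.
  rewrite oE homn; set ra := wpart p (gr_repr _) in raC *; set rb := wpart q (gr_repr _) in rbC *.
  rewrite nprod_subE; apply: rpredD; first by apply: C_right => //; apply: prV; exact: FV_VgH rbF.
  by apply: C_left => //; exact: prV.
have zeroC p v : v \in VgH -> ~ gr_supp (symbol v) p -> wpart p v \in CgH.
  move=> vV /contrapT; rewrite symbolE => /gr_eq0; rewrite wpart_wpart eqxx; apply.
  exact: wpart_FV.
have inw p v : gr_supp (symbol v) p -> p \in weights v.
  move=> vp; apply: contrapT => /negP /wpart_out e0; apply: vp.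
  by rewrite symbolE e0 gr0.
have sym0 v : v \in CgH -> symbol v = 0 by move=> vC; apply/symbol_eq0 => //; exact: C_VgH.
rewrite /gr_op (@fsum_seq _ _ (weights a)) ?undup_uniq//; first last.
- move=> p pa np; apply: fsbig1 => q _; rewrite term sym0//.
  by apply: C_right => //; [exact: zeroC|exact: prV].
- by move=> p; exact: inw.
under eq_bigr => p _.
  rewrite (@fsum_seq _ _ (weights b)) ?undup_uniq//; first last.
  - move=> q qb nq; rewrite term sym0//.
    by apply: C_left => //; [exact: prV|exact: zeroC].
  - by move=> q; exact: inw.
  under eq_bigr do rewrite term.
  rewrite -symbol_sum; last by move=> q; apply: VgH_nprod; exact: prV.
  rewrite -raddf_sum /= wpart_sum; over.
rewrite -symbol_sum; last by move=> p; apply: VgH_nprod => //; exact: prV.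
by rewrite -[X in nprod X](wpart_sum a) -[in RHS]/(nprodl n b _) raddf_sum.
Qed.

Lemma gr_mulE (x y : grZ) : gr_mul x y = gr_op (fun s => idx_gamma (mono_idx s)) (-1) x y.
Proof.
apply: eq_fsbigr => p _; apply: eq_fsbigr => q _; rewrite starE.
by have -> : p + q - (-1)%:~R - 1 = p + q by rewrite rmorphN1; ring.
Qed.

Lemma gr_brE (x y : grZ) : gr_bracket x y = gr_op (fun s => idx_gamma (mono_idx s) - 1) 0 x y.
Proof.
apply: eq_fsbigr => p _; apply: eq_fsbigr => q _; rewrite star_brE.
by rewrite subr0.
Qed.

Lemma symbol_FV p a : a \in FVp p -> gr_in (grcl p a) = symbol (wpart p a).
Proof.
move=> aF; rewrite (symbol_hom (p := p)) ?wpart_wpart ?eqxx//; congr gr_in.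
apply/gr_eq => //; first by apply: wpart_FV => //; exact: FV_VgH aF.
by rewrite wpart_wpart eqxx subrr rpred0.
Qed.

Lemma gr_well : grZhu_well_defined H g.
Proof.
move=> p q a b aF bF; have aV := FV_VgH aF; have bV := FV_VgH bF.
have prV r v : v \in VgH -> wpart r v \in VgH by move=> vV; exact: FV_VgH (wpart_FV vV (lexx r)).
rewrite gr_mulE gr_brE (symbol_FV aF) (symbol_FV bF) !gr_op_symbol ?prV//.
have [F1 e1] := star_op_top (fun s => idx_gamma (mono_idx s)) (-1) aF bF.
have [F2 e2] := star_op_top (fun s => idx_gamma (mono_idx s) - 1) 0 aF bF.
rewrite -e1 -e2 -!symbol_FV// starE star_brE; split; last by rewrite subr0.
by have -> : p + q - (-1)%:~R - 1 = p + q by rewrite rmorphN1; ring.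
Qed.

Lemma grmap_canonical : canonical_map (grmap : R_poisson H g -> grZhu_poisson H g).
Proof.
move=> p a aV Ha; rewrite grmapE// (symbol_hom (p := p))//; apply: restr_id => s c0.
have := H_coord a s; rewrite Ha bcoordZ => /(mulIf c0) [<-].
by rewrite eqxx.
Qed.

Lemma symbol_surj (y : grZ) : exists2 a, a \in VgH & symbol a = y.
Proof.
have [r0 yr0] : exists r : seq R, dsupp (val y) = [set` r].
  by apply/finite_seqP; have /asboolP := valP y.
pose r := undup r0; pose rp p := gr_repr (dsum_proj y p).
have rF p : rp p \in FVp p by have [] := gr_reprP (dsum_proj y p).
have rV p : wpart p (rp p) \in VgH by exact: FV_VgH (wpart_FV (FV_VgH (rF p)) (lexx p)).
exists (\sum_(p <- r) wpart p (rp p)); first by apply: rpred_sum => p _; exact: rV.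
apply: gr_ext => p; rewrite symbolE.
have -> : wpart p (\sum_(q <- r) wpart q (rp q)) = if p \in r then wpart p (rp p) else 0.
  have prsum (L : seq R) : wpart p (\sum_(q <- L) wpart q (rp q)) =
      \sum_(q <- L) if p == q then wpart p (rp p) else 0.
    elim: L => [|q L IH]; first by rewrite !big_nil prD0.
    rewrite !big_cons -IH -[wpart q _]scale1r wpart_lin scale1r wpart_wpart.
    by case: eqP => [->|].
  rewrite prsum; case: ifP => pr.
    rewrite (bigD1_seq p) ?undup_uniq//= eqxx big1 ?addr0// => q.
    by rewrite eq_sym => /negPf ->.
  rewrite big_seq big1// => q qr; case: eqP => // pq.
  by rewrite pq qr in pr.
case: ifPn => pr.
  have [_ <-] := gr_reprP (dsum_proj y p); rewrite -/(rp p).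
  by apply/gr_eq => //; [exact: wpart_FV (FV_VgH (rF p)) _|rewrite wpart_wpart eqxx subrr rpred0].
rewrite gr0; apply/esym; apply: contrapT => yp; move/negP: pr; apply.
by rewrite mem_undup; have : [set` r0] p by rewrite -yr0.
Qed.

Lemma wpart_par (b : bool) p a : vpar b a -> vpar b (wpart p a).
Proof.
move=> ha; apply: vpar_of_coord => s; rewrite bcoord_restr.
by case: ifP => _; [exact: vpar_coord|rewrite eqxx].
Qed.

Lemma ppart_wpart (b : bool) p a : ppart b (wpart p a) = wpart p (ppart b a).
Proof.
apply: (bcoord_inj (basis := e_free)) => s; rewrite !bcoord_restr.
by case: (mono_parity s == b); case: ((mono_idx s).1 == p).
Qed.

(** The part of the wrong parity of a representative has all its components
    in C. *)
Lemma gr_par_lift (b : bool) (y : grZ) : gr_par b y ->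
  exists2 x, R_par b x & grmap x = y.
Proof.
have [a aV <-] := symbol_surj y => ya.
have pV := ppart_VgH b aV; exists (Rcl (ppart b a)).
  by exists (ppart b a) => //; split; [|exact: ppart_par].
rewrite grmapE//; apply: symbol_eq => //.
suff nC : ppart (~~ b) a \in CgH.
  have -> : ppart b a - a = - ppart (~~ b) a; last by rewrite rpredN.
  rewrite [X in _ - X]ppart_split; case: (b) => /=; first by rewrite opprD addrCA subrr addr0.
  by rewrite opprD addrA subrr add0r.
rewrite -(wpart_sum (ppart _ a)); apply: rpred_sum => p _; rewrite -ppart_wpart.
have [u [uF ub]] := ya p; rewrite symbolE => /(gr_eq (wpart_FV aV (lexx p)) uF).
rewrite wpart_wpart eqxx => /(ppart_C (~~ b)).
have -> : wpart p a - wpart p u = (-1) *: wpart p u + wpart p a by rewrite scaleN1r addrC.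
rewrite ppart_lin (ppart_id _ (wpart_par p ub)).
by case: (b) => /=; rewrite scaler0 add0r.
Qed.

Lemma grmap_iso : poisson_isomorphism (grmap : R_poisson H g -> grZhu_poisson H g).
Proof.
have lin : linear grmap.
  move=> k x y; have [a aV ->] := R_ex x; have [b bV ->] := R_ex y.
  by rewrite -R_lin// !grmapE ?symbol_lin ?rpredD ?rpredZ.
have inj : injective grmap.
  move=> x y; have [a aV ->] := R_ex x; have [b bV ->] := R_ex y.
  rewrite !grmapE// => ab; apply/R_eq => //; apply/symbol_eq0; first exact: rpredB.
  have -> : a - b = (-1) *: b + a by rewrite scaleN1r addrC.
  by rewrite symbol_lin// scaleN1r ab addNr.
have surj y : exists x, grmap x = y.
  by have [a aV <-] := symbol_surj y; exists (Rcl a); rewrite grmapE.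
split.
- split=> //; have /choice[k kP] := surj.
  by exists k => // x; apply: inj; rewrite kP.
- move=> b _ [a [aV ha] <-] p; rewrite grmapE//; exists (wpart p a).
  by split; [exact: wpart_FV|exact: wpart_par|].
- rewrite /= grmapE ?vac_VgH// (symbol_hom (p := 0))//.
  by rewrite (wpart_ghom 0 (ghom_vac H_ham g_aut)) eqxx.
- move=> x y; have [a aV ->] := R_ex x; have [b bV ->] := R_ex y.
  by rewrite /= R_mulE// !grmapE ?VgH_nprod// gr_mulE gr_op_symbol.
- move=> x y; have [a aV ->] := R_ex x; have [b bV ->] := R_ex y.
  by rewrite /= R_brE// !grmapE ?VgH_nprod// gr_brE gr_op_symbol.
Qed.

Lemma gr_poissonP : poisson_superalgebra (grZhu_poisson H g).
Proof.
apply: (poisson_transport grmap_iso) R_poissonP => b y yb.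
by have [x xb <-] := gr_par_lift yb; exists x.
Qed.

End Main.

Theorem theoremE (R : realType) (V : vertexSuperalgebra R)
  (H g : {linear V -> V})
  (H_hamiltonian : hamiltonian H)
  (H_real : forall c : R[i], eigenvalue_of H c -> c \is Num.real)
  (g_automorphism : vsa_automorphism g)
  (g_diagonalizable : diagonalizable_op g)
  (g_unitary : forall c : R[i], eigenvalue_of g c -> `|c| = 1)
  (gH_commute : forall v : V, g (H v) = H (g v))
  (d : Order.disp_t) (I : orderType d) (e : I -> V)
  (e_homogeneous : homogeneous_generators e H g)
  (e_free : freely_generated e)
  (G : set R)
  (G_discrete : discrete_subgroup G)
  (e_pregraded : pregraded e G) :
  [/\ poisson_superalgebra (R_poisson H g) /\ R_well_defined H g,
      poisson_superalgebra (grZhu_poisson H g) /\ grZhu_well_defined H g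
    & exists f : R_poisson H g -> grZhu_poisson H g,
        canonical_map f /\ poisson_isomorphism f].
Proof.
have [par e_par] : exists par : I -> bool, forall al, vpar (par al) (e al).
  suff /choice[par parP] : forall al, exists p, vpar p (e al) by exists par.
  by move=> al; have [] := e_homogeneous al.
have [wt [ep e_ghom]] := gen_homogeneous H_real g_unitary e_homogeneous
  (fun al => gen_neq0 al e_free).
have [gdeg [gdeg_gt0 pregr]] := pregraded_degrees G_discrete e_pregraded.
split.
- split; first exact: (R_poissonP H_hamiltonian g_automorphism e_free e_par e_ghom).
  exact: (R_well H_hamiltonian g_automorphism e_free e_par e_ghom).
- split; first exact: (gr_poissonP H_hamiltonian g_automorphism e_free e_par e_ghom gdeg_gt0 pregr).
  exact: (gr_well H_hamiltonian g_automorphism e_free e_par e_ghom gdeg_gt0 pregr).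
- exists (grmap wt ep e_free); split.
    exact: (grmap_canonical H_hamiltonian g_automorphism e_free e_par e_ghom gdeg_gt0 pregr).
  exact: (grmap_iso H_hamiltonian g_automorphism e_free e_par e_ghom gdeg_gt0 pregr).
Qed.
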